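(* Let $P$ be a simple polygon with no acute vertex angles, in which no three vertices define a right angle. Then the human can catch the puppy on $P$, starting from any initial configuration.
   Context: The track is the boundary of $P$. A human and a puppy are points on the track. The human walks along the track at bounded speed and may change direction. The puppy, with unbounded speed and while the human is stationary, runs along the track in a direction in which its Euclidean straight-line distance to the human decreases, until it reaches a point where this distance is locally minimal (if both directions decrease the distance it picks either); when at such a point, the puppy stays until the human moves, and then moves along the track so as to remain at a local minimum until forced to run again. (At a vertex the puppy's direction of motion is tracked: a puppy at a vertex faces along one of the incident edges or turns between them.) The human catches the puppy when their positions coincide. *)

(* Defs.v *)
From Stdlib Require Import Reals ZArith Arith.
Open Scope R_scope.

Definition point := (R * R)%type.
Definition psub (a b : point) : point := (fst a - fst b, snd a - snd b).
Definition dot (a b : point) : R := fst a * fst b + snd a * snd b.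
Definition cross (a b : point) : R := fst a * snd b - snd a * fst b.
Definition enorm (a : point) : R := sqrt (dot a a).

(* ---------- polygons ----------
   A polygon with n vertices is given by V : nat -> point; its vertices are
   V 0, ..., V (n-1) in boundary order (indices are read modulo n). *)
Definition vtxZ (n : nat) (V : nat -> point) (k : Z) : point :=
  V (Z.to_nat (Z.modulo k (Z.of_nat n))).

(* Parametrization of the boundary (the "track") by s : R, periodic of period n:
   for k <= s < k+1 the point lies on edge [v_k, v_{k+1}] at fraction s - k. *)
Definition track (n : nat) (V : nat -> point) (s : R) : point :=
  let k := Int_part s in
  let f := s - IZR k in
  let a := vtxZ n V k in
  let b := vtxZ n V (k + 1)%Z in
  ((1 - f) * fst a + f * fst b, (1 - f) * snd a + f * snd b).

Definition simple_polygon (n : nat) (V : nat -> point) : Prop :=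
  (3 <= n)%nat /\
  forall s t, 0 <= s < INR n -> 0 <= t < INR n ->
    track n V s = track n V t -> s = t.

Fixpoint sumR (f : nat -> R) (m : nat) : R :=
  match m with O => 0 | S k => sumR f k + f k end.

(* twice the signed area (positive iff the vertices are listed counterclockwise) *)
Definition area2 (n : nat) (V : nat -> point) : R :=
  sumR (fun i => cross (V i) (V ((i + 1) mod n)%nat)) n.

Definition prev_v (n : nat) (V : nat -> point) (i : nat) : point :=
  V ((i + n - 1) mod n)%nat.
Definition next_v (n : nat) (V : nat -> point) (i : nat) : point :=
  V ((i + 1) mod n)%nat.

(* the interior angle of the polygon at vertex i is acute (< 90 degrees):
   the vertex is convex (a strict turn in the orientation of the polygon)
   and the two incident edge vectors make an angle < 90 degrees. *)
Definition acute_vertex (n : nat) (V : nat -> point) (i : nat) : Prop :=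
  0 < dot (psub (prev_v n V i) (V i)) (psub (next_v n V i) (V i)) /\
  0 < cross (psub (V i) (prev_v n V i)) (psub (next_v n V i) (V i)) * area2 n V.

Definition no_right_triple (n : nat) (V : nat -> point) : Prop :=
  forall i j k : nat, (i < n)%nat -> (j < n)%nat -> (k < n)%nat ->
    i <> j -> j <> k -> i <> k ->
    dot (psub (V i) (V j)) (psub (V k) (V j)) <> 0.

(* ---------- the human / puppy game ----------
   Positions on the track are parameters s : R (lifted, read through [track]). *)

Definition pdist (n : nat) (V : nat -> point) (h s : R) : R :=
  enorm (psub (track n V s) (track n V h)).

Definition local_min (n : nat) (V : nat -> point) (h s : R) : Prop :=
  exists eps, 0 < eps /\
    forall u, Rabs (u - s) < eps -> pdist n V h s <= pdist n V h u.

(* with the human stationary at h, the puppy at s runs along the track in a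
   direction sg (+1 or -1) in which the distance strictly decreases, and stops at
   the first local minimum s' reached. *)
Definition puppy_run (n : nat) (V : nat -> point) (h s s' : R) : Prop :=
  exists sg a, (sg = 1 \/ sg = -1) /\ 0 < a /\ s' = s + sg * a /\
    (forall x y, 0 <= x -> x < y -> y <= a ->
       pdist n V h (s + sg * y) < pdist n V h (s + sg * x)) /\
    local_min n V h s'.

Definition puppy_settle (n : nat) (V : nat -> point) (h p p' : R) : Prop :=
  (p' = p /\ local_min n V h p) \/ puppy_run n V h p p'.

(* a move of the human: she walks at constant (parameter) speed from h to h + d
   during the time interval [0,1]; her position at time t is h + t d. *)
Definition hpos (h d t : R) : R := h + t * d.

(* q : [0,1] -> R is a puppy trajectory consistent with the human move (h, d),
   starting at p: at all times the puppy is at a local minimum, it moves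
   continuously (right-continuous, with left limits) while it remains at a local
   minimum, and its only discontinuities are runs forced when the position it was
   tracking ceases to be a local minimum. *)
Definition puppy_response (n : nat) (V : nat -> point) (h d p : R)
    (q : R -> R) : Prop :=
  q 0 = p /\
  (forall t, 0 <= t <= 1 -> local_min n V (hpos h d t) (q t)) /\
  (forall t, 0 <= t < 1 -> forall eps, 0 < eps -> exists del, 0 < del /\
      forall u, t <= u < t + del -> Rabs (q u - q t) < eps) /\
  (forall t, 0 < t <= 1 -> exists L,
      (forall eps, 0 < eps -> exists del, 0 < del /\
         forall u, t - del < u < t -> Rabs (q u - L) < eps) /\
      (L = q t \/ puppy_run n V (hpos h d t) L (q t))).

(* Win h p: from the configuration (human at h, puppy at p) the human has a
   strategy (adaptive, finitely many moves) that catches the puppy whatever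
   legal choices the puppy makes. *)
Inductive human_wins (n : nat) (V : nat -> point) : R -> R -> Prop :=
| hw_caught : forall h p, track n V h = track n V p -> human_wins n V h p
| hw_move : forall h p d,
    (exists q, puppy_response n V h d p q) ->
    (forall q, puppy_response n V h d p q ->
       (exists t, 0 <= t <= 1 /\ track n V (hpos h d t) = track n V (q t)) \/
       human_wins n V (hpos h d 1) (q 1)) ->
    human_wins n V h p.

(* Main.v *)
Require Import Defs.
From Stdlib Require Import Reals Lra Lia Psatz ZArith Classical ClassicalEpsilon Bool Arith.
From Coquelicot Require Import Compactness.
Open Scope R_scope.

(** On each edge the squared distance to the human is a quadratic function whose
    minimum is at the foot of the perpendicular from her, so the local minima and
    maxima of the distance are governed by the positions of these feet.  As the
    human moves a little, every local extremum persists, except where a foot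
    reaches a vertex that is a local maximum: there (transversally, because no
    three vertices define a right angle) a minimum and a maximum merge and the
    puppy runs.

    Suppose that some configurations, the trap, cannot be won.  For every position
    of the human there are trapped positions of the puppy.  Walking back and forth
    across a merging point shows that being below the whole trap, above it, or
    neither is locally constant on the set of critical configurations, which thus
    splits into three compact pieces at positive distance.

    Replace the extrema by the zeros of [d(h,p+eps)^2 - d(h,p-eps)^2], that is, let
    the human be on the perpendicular bisector of a short chord.  For fixed [p],
    different zeros are at different places of this bisector, as the polygon is
    simple, and never at the midpoint of the chord.  If the human is at a point of
    the track farthest from the origin, nothing lies on the bisector beyond her.
    Over that point each of the three pieces has an odd number of zeros, hence two
    pieces have an odd number of zeros on the same side of the chord.  On a fine
    grid these are two disjoint closed curves, both crossing the strip
    [h < p < h + n] essentially, and counting modulo 2 the pairs of points on a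
    common bisector, the one of the first curve above the one of the second, in
    two ways gives a contradiction. *)

(** The distance is only piecewise smooth in [p], and pairs of extrema appear and vanish at
    vertices, so the critical set is no level set to which a parity argument applies directly. The
    difference over a short chord is Lipschitz in both positions, and by Rolle's argument each of
    its zeros is within [eps] of an extremum, whose piece it inherits. No single extremum has to be
    followed any more; only parities of sign changes count. Over the farthest point the difference
    is positive just after the human, negative just below the lowest trapped minimum, positive just
    above the highest one, and negative just before the human one turn later; this makes each of the
    three pieces odd. Three pieces are forced by the two sides of a chord: two pieces might lie on
    opposite sides. On one side, the order of two pieces along the common bisector could change only
    at a coincidence of two points of the track, which compactness excludes by a margin. The
    constants depend on each other in one order: the distance [dL] of the pieces, the chord
    parameter [eps], the margin [eta] for that [eps], and last the mesh. *)

Fixpoint xsum (f : nat -> bool) (n : nat) : bool :=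
  match n with O => false | S k => xorb (xsum f k) (f k) end.

Lemma xsum_ext f g n :
  (forall i, (i < n)%nat -> f i = g i) -> xsum f n = xsum g n.
Proof.
  induction n as [|n IH]; simpl; intros H; [reflexivity|].
  rewrite IH by (intros; apply H; lia). rewrite H by lia. reflexivity.
Qed.

Lemma xsum_false n : xsum (fun _ => false) n = false.
Proof. induction n as [|n IH]; simpl; [reflexivity|now rewrite IH]. Qed.

Lemma xsum_zero f n :
  (forall i, (i < n)%nat -> f i = false) -> xsum f n = false.
Proof. intros H. rewrite (xsum_ext f (fun _ => false)) by exact H. apply xsum_false. Qed.

Lemma xorb4 a b c d : xorb (xorb a b) (xorb c d) = xorb (xorb a c) (xorb b d).
Proof. destruct a, b, c, d; reflexivity. Qed.

Lemma xsum_xorb f g n :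
  xsum (fun i => xorb (f i) (g i)) n = xorb (xsum f n) (xsum g n).
Proof.
  induction n as [|n IH]; simpl; [reflexivity|].
  rewrite IH. apply xorb4.
Qed.

Lemma xsum_andb b f n : xsum (fun i => b && f i) n = b && xsum f n.
Proof.
  induction n as [|n IH]; simpl; [now rewrite andb_false_r|].
  rewrite IH. destruct b, (xsum f n), (f n); reflexivity.
Qed.

Lemma xsum_swap (f : nat -> nat -> bool) n m :
  xsum (fun i => xsum (f i) m) n = xsum (fun j => xsum (fun i => f i j) n) m.
Proof.
  induction n as [|n IH]; simpl.
  - symmetry. apply xsum_false.
  - rewrite IH, <- xsum_xorb. reflexivity.
Qed.

Lemma xsum_telescope f n :
  xsum (fun i => xorb (f i) (f (S i))) n = xorb (f 0%nat) (f n).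
Proof.
  induction n as [|n IH]; simpl.
  - now rewrite xorb_nilpotent.
  - rewrite IH. destruct (f 0%nat), (f n), (f (S n)); reflexivity.
Qed.

Lemma xsum_split f p q :
  xsum f (p + q) = xorb (xsum f p) (xsum (fun k => f (p + k)%nat) q).
Proof.
  induction q as [|q IH].
  - rewrite Nat.add_0_r. simpl. now rewrite xorb_false_r.
  - rewrite Nat.add_succ_r. simpl. rewrite IH.
    now rewrite xorb_assoc.
Qed.

(** * Disjoint level curves on a grid *)

(* [uh i j] marks the edge from [(i,j)] to [(i+1,j)] and [uv i j] the edge from
   [(i,j)] to [(i,j+1)].  A marking with an even number of marks around every
   square is a discrete closed curve; the remaining clauses say that it stays
   away from the two slanted sides of the strip it lives in. *)
Definition closed_curve (N W K : nat) (uh uv : nat -> nat -> bool) : Prop :=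
  (forall i j, (i < W)%nat -> (j < K)%nat ->
     xorb (uh i j) (uh i (S j)) = xorb (uv i j) (uv (S i) j)) /\
  (forall j, (j < K)%nat -> uv 0%nat j = false) /\
  (forall j, (j < K)%nat -> uv W j = false) /\
  (forall i, (N <= i)%nat -> uh i 0%nat = false) /\
  (forall i, (i < N)%nat -> uh i K = false).

Definition marked (uh uv : nat -> nat -> bool) (i j : nat) : Prop :=
  uh i j = true \/ uh i (S j) = true \/ uv i j = true \/ uv (S i) j = true.

Definition same_or_next (i x : nat) : Prop := x = i \/ x = S i.

(* [gt j y x]: on row [j], column [y] lies above column [x]. *)
Definition separated (W K : nat) (gt : nat -> nat -> nat -> bool)
    (ah av bh bv : nat -> nat -> bool) : Prop :=
  forall i i' j, (i < W)%nat -> (i' < W)%nat -> (j < K)%nat ->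
    marked ah av i j -> marked bh bv i' j ->
    exists v, forall x y r, same_or_next i x -> same_or_next i' y ->
      same_or_next j r -> gt r y x = v /\ gt r x y = negb v.

Definition top_at (N W K : nat) (gt : nat -> nat -> nat -> bool)
    (av bh : nat -> nat -> bool) : Prop :=
  forall i j, (i < W)%nat -> (j < K)%nat ->
    av N j = true -> bh i j = true -> gt j i N = false.

(** The top row to the right of column [N] and column [N] itself bound a rectangle whose other two
    sides carry no marks. Summing the square condition over it, one column of squares at a time,
    leaves only these two parities. *)
Lemma curve_row_column N W K uh uv :
  (N <= W)%nat -> closed_curve N W K uh uv ->
  xsum (fun i => uh i K) W = xsum (fun j => uv N j) K.
Proof.
  intros HNW (Hsq & _ & HW & H0 & HK).
  replace W with (N + (W - N))%nat at 1 by lia.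
  rewrite xsum_split, (xsum_zero _ N) by (intros i Hi; apply HK, Hi).
  rewrite xorb_false_l.
  set (phi := fun k => xsum (fun j => uv (N + k)%nat j) K).
  assert (Hphi : forall k, (k < W - N)%nat ->
                   uh (N + k)%nat K = xorb (phi k) (phi (S k))).
  { intros k Hk. unfold phi. rewrite <- xsum_xorb.
    rewrite (xsum_ext _ (fun j => xorb (uh (N + k)%nat j) (uh (N + k)%nat (S j)))).
    - rewrite xsum_telescope, H0 by lia. now rewrite xorb_false_l.
    - intros j Hj. rewrite Hsq by lia. now rewrite Nat.add_succ_r. }
  rewrite (xsum_ext _ (fun k => xorb (phi k) (phi (S k)))) by exact Hphi.
  rewrite xsum_telescope.
  replace (phi (W - N)%nat) with false.
  - rewrite xorb_false_r. unfold phi. now rewrite Nat.add_0_r.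
  - unfold phi. symmetry. apply xsum_zero. intros j Hj.
    replace (N + (W - N))%nat with W by lia. now apply HW.
Qed.

Section Restrict.
Context (N W K : nat) (gt : nat -> nat -> nat -> bool).
Context (ah av bh bv : nat -> nat -> bool).
Context (Hb : closed_curve N W K bh bv) (Hsep : separated W K gt ah av bh bv).

(** A parity, not a truth value of being above: it counts the marks of [b] on row [j] above column
    [i]. Along a curve separated from [b] it cannot change, the discrete form of staying on one
    side. *)
Definition above (i j : nat) : bool := xsum (fun i' => bh i' j && gt j i' i) W.

Lemma above_row i j r : (i < W)%nat -> (j < K)%nat -> marked ah av i j ->
  same_or_next j r -> above i r = above (S i) r.
Proof.
  intros Hi Hj Hm Hr. apply xsum_ext. intros i' Hi'.
  destruct (bh i' r) eqn:E; [|reflexivity]. simpl.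
  assert (Hm' : marked bh bv i' j).
  { unfold marked. destruct Hr; subst r; tauto. }
  destruct (Hsep i i' j Hi Hi' Hj Hm Hm') as [v Hv].
  rewrite (proj1 (Hv i i' r (or_introl eq_refl) (or_introl eq_refl) Hr)).
  now rewrite (proj1 (Hv (S i) i' r (or_intror eq_refl) (or_introl eq_refl) Hr)).
Qed.

(** From one row to the next the marks of [b] change only through its vertical edges, and by
    separation all edges around one square of [b] compare with column [i] in the same way. The sum
    telescopes, and [bv] is empty at both ends. *)
Lemma above_column i j : (i < W)%nat -> (j < K)%nat -> marked ah av i j ->
  above i j = above i (S j).
Proof.
  intros Hi Hj Hm. destruct Hb as (Hsq & Hv0 & HvW & _ & _).
  assert (E : xorb (above i j) (above i (S j)) = false).
  { unfold above. rewrite <- xsum_xorb.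
    rewrite (xsum_ext _ (fun i' => xorb (bv i' j && gt j i' i)
                                        (bv (S i') j && gt j (S i') i))).
    - rewrite (xsum_telescope (fun i' => bv i' j && gt j i' i)).
      now rewrite Hv0, HvW by assumption.
    - intros i' Hi'. specialize (Hsq i' j Hi' Hj).
      destruct (bh i' j || bh i' (S j) || bv i' j || bv (S i') j) eqn:E.
      + assert (Hm' : marked bh bv i' j).
        { unfold marked. rewrite !orb_true_iff in E. tauto. }
        destruct (Hsep i i' j Hi Hi' Hj Hm Hm') as [v Hv].
        rewrite (proj1 (Hv i i' j (or_introl eq_refl) (or_introl eq_refl) (or_introl eq_refl))).
        rewrite (proj1 (Hv i i' (S j) (or_introl eq_refl) (or_introl eq_refl) (or_intror eq_refl))).
        rewrite (proj1 (Hv i (S i') j (or_introl eq_refl) (or_intror eq_refl) (or_introl eq_refl))).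
        destruct v; rewrite ?andb_true_r, ?andb_false_r; [exact Hsq|reflexivity].
      + rewrite !orb_false_iff in E. destruct E as (((-> & ->) & ->) & ->).
        reflexivity. }
  now apply xorb_eq.
Qed.

Definition lowh (i j : nat) : bool := ah i j && negb (above i j).
Definition lowv (i j : nat) : bool := av i j && negb (above i j).

(** Around a square marked by [a] the parity [above] has a single value, so the square condition is
    either kept or emptied as a whole. *)
Lemma low_closed_curve : closed_curve N W K ah av -> closed_curve N W K lowh lowv.
Proof.
  intros (Hsq & H0 & HW & Hl & Hr). unfold lowh, lowv.
  repeat split; intros.
  - destruct (ah i j || ah i (S j) || av i j || av (S i) j) eqn:E.
    + assert (Hm : marked ah av i j).
      { unfold marked. rewrite !orb_true_iff in E. tauto. }
      rewrite <- (above_row i j j) by (try assumption; now left).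
      rewrite <- (above_column i j) by assumption.
      destruct (above i j); simpl; rewrite ?andb_true_r, ?andb_false_r; auto.
    + rewrite !orb_false_iff in E. destruct E as (((-> & ->) & ->) & ->).
      reflexivity.
  - now rewrite H0 by assumption.
  - now rewrite HW by assumption.
  - now rewrite Hl by assumption.
  - now rewrite Hr by assumption.
Qed.

(** On column [N], later that of the farthest point, no mark of [b] is above a mark of [a], so the
    restriction removes nothing there and the curve stays odd. *)
Lemma low_column : top_at N W K gt av bh ->
  xsum (fun j => lowv N j) K = xsum (fun j => av N j) K.
Proof.
  intros Htop. apply xsum_ext. intros j Hj. unfold lowv.
  destruct (av N j) eqn:E; [|reflexivity]. simpl.
  unfold above. rewrite xsum_zero; [reflexivity|].
  intros i Hi. destruct (bh i j) eqn:E'; [|reflexivity].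
  simpl. apply (Htop i j); assumption.
Qed.

End Restrict.

(* Count, on the top row, the pairs of a mark of [a0] above a mark of [b], where
   [a0] consists of the marks of [a] with an even number of marks of [b] above
   them.  Summing over [a0] gives an odd number, summing over [b] an even one. *)
Theorem no_two_odd_curves N W K gt ah av bh bv :
  (N <= W)%nat -> (0 < K)%nat ->
  closed_curve N W K ah av -> closed_curve N W K bh bv ->
  separated W K gt ah av bh bv ->
  top_at N W K gt av bh -> top_at N W K gt bv ah ->
  xsum (fun j => av N j) K = true -> xsum (fun j => bv N j) K = true -> False.
Proof.
  intros HNW HK Ha Hb Hsep Hta Htb Hoa Hob.
  set (a0h := lowh W gt ah bh). set (a0v := lowv W gt av bh).
  assert (Ha0 : closed_curve N W K a0h a0v) by (now apply low_closed_curve with bv).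
  assert (Hsep0 : separated W K gt bh bv a0h a0v).
  { intros i i' j Hi Hi' Hj Hm Hm'.
    destruct (Hsep i' i j Hi' Hi Hj) as [v Hv].
    - unfold marked, a0h, a0v, lowh, lowv in *.
      rewrite !andb_true_iff in Hm'. tauto.
    - exact Hm.
    - exists (negb v). intros x y r Hx Hy Hr.
      destruct (Hv y x r Hy Hx Hr) as [-> ->].
      now rewrite negb_involutive. }
  set (b0h := lowh W gt bh a0h). set (b0v := lowv W gt bv a0h).
  assert (Hb0 : closed_curve N W K b0h b0v) by (now apply low_closed_curve with a0v).
  assert (Ra0 : xsum (fun i => a0h i K) W = true).
  { rewrite (curve_row_column N W K a0h a0v) by assumption.
    unfold a0v. now rewrite (low_column N W K). }
  assert (Rb : xsum (fun i => bh i K) W = true)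
    by now rewrite (curve_row_column N W K bh bv).
  assert (Rb0 : xsum (fun i => b0h i K) W = true).
  { rewrite (curve_row_column N W K b0h b0v) by assumption.
    unfold b0v. rewrite (low_column N W K); [assumption|].
    intros i j Hi Hj H1 H2. apply (Htb i j); auto.
    unfold a0h, lowh in H2. now apply andb_true_iff in H2. }
  set (P := fun x y => a0h x K && (bh y K && gt K x y)).
  (* A mark of [a0] has an even number of marks of [b] above it and [b] is odd on the row, so an odd
     number lies below; and [a0] is odd. *)
  assert (E1 : xsum (fun x => xsum (P x) W) W = true).
  { rewrite <- Ra0. apply xsum_ext. intros x Hx. unfold P.
    rewrite xsum_andb. destruct (a0h x K) eqn:E; [|reflexivity]. simpl.
    assert (E' : above W gt bh x K = false).
    { unfold a0h, lowh in E. apply andb_true_iff in E. destruct E as [_ E].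
      now apply negb_true_iff in E. }
    assert (Ex : xorb (xsum (fun y => bh y K && gt K x y) W) (above W gt bh x K) = true).
    { unfold above. rewrite <- xsum_xorb. rewrite <- Rb. apply xsum_ext.
      intros y Hy. destruct (bh y K) eqn:Eb; [|reflexivity]. simpl.
      destruct (Hsep x y (K - 1)%nat) as [v Hv]; try lia.
      - right; left. replace (S (K - 1)) with K by lia.
        unfold a0h, lowh in E. now apply andb_true_iff in E.
      - right; left. now replace (S (K - 1)) with K by lia.
      - destruct (Hv x y K) as [-> ->]; try (left; reflexivity).
        + right; lia.
        + now destruct v. }
    rewrite E', xorb_false_r in Ex. exact Ex. }
  (* A mark of [b] has an odd number of marks of [a0] above it exactly when it is not in [b0]; both
     [b] and [b0] are odd, so their difference is even. *)
  assert (E2 : xsum (fun x => xsum (P x) W) W = false).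
  { rewrite xsum_swap.
    rewrite (xsum_ext _ (fun y => xorb (bh y K) (b0h y K))).
    - rewrite xsum_xorb, Rb, Rb0. reflexivity.
    - intros y Hy. unfold P, b0h, lowh.
      rewrite (xsum_ext _ (fun i => bh y K && (a0h i K && gt K i y))).
      + rewrite xsum_andb. fold (above W gt a0h y K).
        destruct (bh y K), (above W gt a0h y K); reflexivity.
      + intros i Hi. destruct (a0h i K), (bh y K), (gt K i y); reflexivity. }
  congruence.
Qed.

Lemma Rabs_bounds x c : Rabs x <= c -> - c <= x <= c.
Proof. unfold Rabs. destruct (Rcase_abs x); lra. Qed.

Lemma Rabs_bounds_lt x c : Rabs x < c -> - c < x < c.
Proof. unfold Rabs. destruct (Rcase_abs x); lra. Qed.


Section Polygon.
Context (n : nat) (V : nat -> point).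
Context (Hsimple : simple_polygon n V) (Hnoright : no_right_triple n V).

Notation tr := (track n V).
Notation vx := (vtxZ n V).
Notation lmin := (local_min n V).
Notation run := (puppy_run n V).
Notation settle := (puppy_settle n V).
Notation Win := (human_wins n V).

(** * The track, feet of perpendiculars and squared distances *)

Definition edge (k : Z) : point := psub (vx (k + 1)%Z) (vx k).
Definition sqlen (k : Z) : R := dot (edge k) (edge k).
(** The foot of the perpendicular from the human on the line of edge [k], as a parameter that
    extends that of the edge; it may lie outside [k] to [k + 1], and its place relative to these two
    numbers decides where the distance falls and rises on the edge. *)
Definition foot (k : Z) (h : R) : R :=
  IZR k + dot (psub (tr h) (vx k)) (edge k) / sqlen k.

Notation ft := foot.
Definition sqd (h s : R) : R := dot (psub (tr s) (tr h)) (psub (tr s) (tr h)).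
Notation D := sqd.

Lemma Int_part_unique k s : IZR k <= s < IZR k + 1 -> Int_part s = k.
Proof.
  intros Hs. destruct (base_Int_part s) as [H1 H2].
  assert (IZR (Int_part s) < IZR (k + 1)) by (rewrite plus_IZR; lra).
  assert (IZR k < IZR (Int_part s + 1)) by (rewrite plus_IZR; lra).
  apply lt_IZR in H. apply lt_IZR in H0. lia.
Qed.

Lemma track_left k s : IZR k <= s < IZR k + 1 ->
  tr s = (fst (vx k) + (s - IZR k) * fst (edge k),
          snd (vx k) + (s - IZR k) * snd (edge k)).
Proof.
  intros Hs. unfold track. rewrite (Int_part_unique k s Hs).
  unfold edge, psub; cbn [fst snd]. f_equal; ring.
Qed.

Lemma track_vertex k : tr (IZR k) = vx k.
Proof.
  rewrite (track_left k) by lra. rewrite (surjective_pairing (vx k)) at 3.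
  f_equal; ring.
Qed.

Lemma track_on_edge k s : IZR k <= s <= IZR k + 1 ->
  tr s = (fst (vx k) + (s - IZR k) * fst (edge k),
          snd (vx k) + (s - IZR k) * snd (edge k)).
Proof.
  intros [H1 H2]. destruct H2 as [H2|H2]; [now apply track_left|].
  subst s. rewrite <- plus_IZR, track_vertex, plus_IZR.
  unfold edge, psub; cbn [fst snd]. rewrite (surjective_pairing (vx (k + 1))) at 1.
  f_equal; ring.
Qed.

Lemma on_some_edge s : exists k, IZR k <= s < IZR k + 1.
Proof. exists (Int_part s). destruct (base_Int_part s). lra. Qed.

Lemma n_ge_3 : (3 <= n)%nat.
Proof. exact (proj1 Hsimple). Qed.

Lemma INRn_ge_3 : 3 <= INR n.
Proof. pose proof (le_INR _ _ n_ge_3) as H. simpl in H. lra. Qed.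

Lemma vx_period k c : vx (k + c * Z.of_nat n)%Z = vx k.
Proof.
  pose proof n_ge_3. unfold vtxZ. rewrite Z.mod_add by lia. reflexivity.
Qed.

Lemma track_period s c : tr (s + IZR c * INR n) = tr s.
Proof.
  destruct (on_some_edge s) as [k Hk].
  rewrite (track_left k s Hk).
  rewrite (track_left (k + c * Z.of_nat n)).
  - unfold edge. replace (k + c * Z.of_nat n + 1)%Z with (k + 1 + c * Z.of_nat n)%Z by ring.
    rewrite !vx_period, plus_IZR, mult_IZR, <- INR_IZR_INZ.
    f_equal; f_equal; f_equal; ring.
  - rewrite plus_IZR, mult_IZR, <- INR_IZR_INZ. lra.
Qed.

Lemma reduce_mod s : exists c, 0 <= s + IZR c * INR n < INR n.
Proof.
  pose proof INRn_ge_3 as Hn.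
  destruct (base_Int_part (s / INR n)) as [H1 H2].
  exists (- Int_part (s / INR n))%Z. rewrite opp_IZR.
  set (m := IZR (Int_part (s / INR n))) in *.
  assert (E : s = s / INR n * INR n) by (field; lra).
  set (q := s / INR n) in *. rewrite E. split; nra.
Qed.

Lemma track_inj s t : tr s = tr t -> exists c, s = t + IZR c * INR n.
Proof.
  intros E. destruct (reduce_mod s) as [a Ha]. destruct (reduce_mod t) as [b Hb].
  assert (Heq : s + IZR a * INR n = t + IZR b * INR n).
  { apply (proj2 Hsimple); try assumption. now rewrite !track_period. }
  exists (b - a)%Z. rewrite minus_IZR. lra.
Qed.

Lemma track_inj_near s t : tr s = tr t -> Rabs (s - t) < INR n -> s = t.
Proof.
  intros E Hst. destruct (track_inj s t E) as [c ->].
  pose proof INRn_ge_3 as Hn.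
  replace (t + IZR c * INR n - t) with (IZR c * INR n) in Hst by ring.
  rewrite Rabs_mult, (Rabs_right (INR n)) in Hst by lra.
  assert (Hc : Rabs (IZR c) < 1) by nra.
  rewrite <- abs_IZR in Hc. apply lt_IZR in Hc.
  assert (c = 0)%Z by lia. subst c. simpl. ring.
Qed.

Lemma sqlen_pos k : 0 < sqlen k.
Proof.
  assert (H : 0 <= sqlen k) by (unfold sqlen, dot; nra).
  destruct H as [H|H]; [exact H|exfalso].
  assert (E : tr (IZR k) = tr (IZR k + 1)).
  { rewrite !(track_on_edge k) by lra.
    unfold sqlen, dot in H.
    assert (fst (edge k) = 0) by nra. assert (snd (edge k) = 0) by nra.
    rewrite H0, H1. f_equal; ring. }
  pose proof INRn_ge_3.
  apply track_inj_near in E; [lra|].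
  rewrite Rabs_left; lra.
Qed.

Lemma sqd_period h s c d :
  sqd (h + IZR c * INR n) (s + IZR d * INR n) = sqd h s.
Proof. unfold sqd. now rewrite !track_period. Qed.

Lemma sqd_nonneg h s : 0 <= sqd h s.
Proof. unfold sqd, dot. nra. Qed.

Lemma sqd_zero h s : sqd h s = 0 -> tr s = tr h.
Proof.
  unfold sqd, dot, psub; cbn [fst snd]. intros H.
  set (a := fst (tr s) - fst (tr h)) in *. set (b := snd (tr s) - snd (tr h)) in *.
  assert (Ha : a = 0) by (clear -H; nra). assert (Hb : b = 0) by (clear -H; nra). subst a b.
  apply injective_projections; lra.
Qed.

Lemma sqd_refl h s : tr s = tr h -> sqd h s = 0.
Proof. unfold sqd, dot, psub. intros ->. cbn [fst snd]. ring. Qed.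

Lemma sqd_edge k h s t :
  IZR k <= s <= IZR k + 1 -> IZR k <= t <= IZR k + 1 ->
  sqd h s - sqd h t = sqlen k * ((s - t) * (s + t - 2 * foot k h)).
Proof.
  intros H1 H2. pose proof (sqlen_pos k) as HL.
  unfold sqd. rewrite (track_on_edge k s H1), (track_on_edge k t H2).
  unfold foot. unfold sqlen in *.
  set (u := tr h) in *. set (v := vx k). set (e := edge k) in *.
  unfold dot, psub in *. cbn [fst snd] in *.
  field. lra.
Qed.

Lemma foot_left k h :
  foot (k - 1) h - IZR k =
  dot (psub (tr h) (vx k)) (edge (k - 1)) / sqlen (k - 1).
Proof.
  pose proof (sqlen_pos (k - 1)) as HL. unfold foot.
  unfold sqlen in *.
  assert (E : vx k = (fst (vx (k - 1)) + fst (edge (k - 1)),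
                      snd (vx (k - 1)) + snd (edge (k - 1)))).
  { unfold edge, psub; cbn [fst snd]. replace (k - 1 + 1)%Z with k by ring.
    rewrite (surjective_pairing (vx k)) at 1. f_equal; ring. }
  rewrite E, minus_IZR.
  set (e := edge (k - 1)) in *. set (v := vx (k - 1)). set (u := tr h).
  unfold dot, psub in *; cbn [fst snd] in *. field. lra.
Qed.

Lemma foot_right k h :
  foot k h - IZR k = dot (psub (tr h) (vx k)) (edge k) / sqlen k.
Proof. unfold foot. ring. Qed.

Lemma foot_self k h : IZR k <= h <= IZR k + 1 -> foot k h = h.
Proof.
  intros Hh. pose proof (sqlen_pos k) as HL. unfold foot.
  rewrite (track_on_edge k h Hh). unfold sqlen in *.
  unfold dot, psub in *; cbn [fst snd] in *. field. lra.
Qed.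

Lemma foot_affine k j x y : IZR j <= x <= IZR j + 1 -> IZR j <= y <= IZR j + 1 ->
  foot k x - foot k y = (x - y) * (dot (edge j) (edge k) / sqlen k).
Proof.
  intros Hx Hy. pose proof (sqlen_pos k) as HL. unfold foot.
  rewrite (track_on_edge j x Hx), (track_on_edge j y Hy). unfold sqlen in *.
  unfold dot, psub in *; cbn [fst snd] in *. field. lra.
Qed.

(** ** Bounded Lipschitz functions *)

Lemma edges_bounded : exists C, 0 <= C /\
  forall k, Rabs (fst (vx k)) <= C /\ Rabs (snd (vx k)) <= C /\
            Rabs (fst (edge k)) <= C /\ Rabs (snd (edge k)) <= C.
Proof.
  assert (HV : exists C, 0 <= C /\ forall i, (i < n)%nat ->
                 Rabs (fst (V i)) <= C /\ Rabs (snd (V i)) <= C).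
  { generalize n. intros m. induction m as [|m [C [HC IH]]].
    - exists 0. split; [lra|]. intros i Hi. lia.
    - exists (Rmax C (Rmax (Rabs (fst (V m))) (Rabs (snd (V m))))).
      pose proof (Rmax_l C (Rmax (Rabs (fst (V m))) (Rabs (snd (V m))))).
      pose proof (Rmax_r C (Rmax (Rabs (fst (V m))) (Rabs (snd (V m))))).
      pose proof (Rmax_l (Rabs (fst (V m))) (Rabs (snd (V m)))).
      pose proof (Rmax_r (Rabs (fst (V m))) (Rabs (snd (V m)))).
      split; [lra|]. intros i Hi.
      assert (Hc : (i < m)%nat \/ i = m) by lia. destruct Hc as [Hc| ->].
      + destruct (IH i Hc). lra.
      + lra. }
  destruct HV as [C [HC HV]]. pose proof n_ge_3 as Hn.
  assert (Hvx : forall k, Rabs (fst (vx k)) <= C /\ Rabs (snd (vx k)) <= C).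
  { intros k. apply HV.
    pose proof (Z.mod_pos_bound k (Z.of_nat n)). lia. }
  exists (2 * C). split; [lra|]. intros k.
  destruct (Hvx k) as [H1 H2]. destruct (Hvx (k + 1)%Z) as [H3 H4].
  unfold edge, psub; cbn [fst snd].
  apply Rabs_bounds in H1, H2, H3, H4.
  repeat split; apply Rabs_le; lra.
Qed.

Definition lip1 (f : R -> R) : Prop :=
  exists C, 0 <= C /\ (forall s, Rabs (f s) <= C) /\
            forall s t, Rabs (f s - f t) <= C * Rabs (s - t).

(** Points on different edges are joined through the vertices between them; as the parameter is
    monotone, the bounds on the single edges add up. *)
Lemma track_lip : lip1 (fun s => fst (tr s)) /\ lip1 (fun s => snd (tr s)).
Proof.
  destruct edges_bounded as [C [HC HB]].
  assert (Hgen : forall (g : R -> R) (w u : Z -> R),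
    (forall k, Rabs (w k) <= C /\ Rabs (u k) <= C) ->
    (forall k s, IZR k <= s <= IZR k + 1 -> g s = w k + (s - IZR k) * u k) ->
    lip1 g).
  { intros g w u Hwu Hg.
    assert (Hloc : forall k s t, IZR k <= s <= IZR k + 1 -> IZR k <= t <= IZR k + 1 ->
                     Rabs (g s - g t) <= C * Rabs (s - t)).
    { intros k s t H1 H2. rewrite (Hg k s H1), (Hg k t H2).
      replace (w k + (s - IZR k) * u k - (w k + (t - IZR k) * u k))
        with (u k * (s - t)) by ring.
      rewrite Rabs_mult. apply Rmult_le_compat_r; [apply Rabs_pos|apply Hwu]. }
    assert (Hind : forall m k s t, IZR k <= s < IZR k + 1 -> s <= t <= IZR k + 1 + INR m ->
                     Rabs (g s - g t) <= C * Rabs (s - t)).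
    { induction m as [|m IH]; intros k s t H1 H2.
      - simpl in H2. apply (Hloc k); lra.
      - rewrite S_INR in H2. destruct (Rle_dec t (IZR k + 1)) as [Ht|Ht].
        + apply (Hloc k); lra.
        + pose proof (Hloc k s (IZR k + 1)) as Ha.
          assert (Hb := IH (k + 1)%Z (IZR k + 1) t).
          rewrite plus_IZR in Hb.
          specialize (Ha ltac:(lra) ltac:(lra)). specialize (Hb ltac:(lra) ltac:(lra)).
          pose proof (Rabs_triang (g s - g (IZR k + 1)) (g (IZR k + 1) - g t)) as Hc.
          replace (g s - g (IZR k + 1) + (g (IZR k + 1) - g t)) with (g s - g t) in Hc by ring.
          rewrite (Rabs_left1 (s - t)) by lra.
          rewrite (Rabs_left1 (s - (IZR k + 1))) in Ha by lra.
          rewrite (Rabs_left1 (IZR k + 1 - t)) in Hb by lra.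
          lra. }
    exists (2 * C). split; [lra|]. split.
    - intros s. destruct (on_some_edge s) as [k Hk].
      rewrite (Hg k s) by lra. destruct (Hwu k) as [H1 H2].
      apply Rabs_bounds in H1, H2. apply Rabs_le.
      set (f := s - IZR k). assert (Hf : 0 <= f <= 1) by (unfold f; lra).
      assert (0 <= f * (C - u k)) by (apply Rmult_le_pos; lra).
      assert (0 <= f * (C + u k)) by (apply Rmult_le_pos; lra).
      assert (0 <= (1 - f) * C) by (apply Rmult_le_pos; lra).
      lra.
    - assert (Hle : forall s t, s <= t -> Rabs (g s - g t) <= 2 * C * Rabs (s - t)).
      { intros s t Hst. destruct (on_some_edge s) as [k Hk].
        destruct (INR_unbounded (t - s)) as [m Hm].
        pose proof (Hind m k s t Hk ltac:(lra)). pose proof (Rabs_pos (s - t)). nra. }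
      intros s t. destruct (Rle_dec s t) as [H|H]; [now apply Hle|].
      rewrite (Rabs_minus_sym (g s)), (Rabs_minus_sym s). apply Hle. lra. }
  split.
  - apply (Hgen _ (fun k => fst (vx k)) (fun k => fst (edge k))).
    + intros k. destruct (HB k) as (? & ? & ? & ?). tauto.
    + intros k s H. now rewrite (track_on_edge k s H).
  - apply (Hgen _ (fun k => snd (vx k)) (fun k => snd (edge k))).
    + intros k. destruct (HB k) as (? & ? & ? & ?). tauto.
    + intros k s H. now rewrite (track_on_edge k s H).
Qed.

(** * Local minima and maxima in terms of feet *)

Definition local_max (h s : R) : Prop :=
  exists eps, 0 < eps /\
    forall u, Rabs (u - s) < eps -> pdist n V h u <= pdist n V h s.
Notation lmax := local_max.

Definition local_ext (h s : R) : Prop := local_min n V h s \/ local_max h s.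
Notation lext := local_ext.

Lemma pdist_le h s t : pdist n V h s <= pdist n V h t <-> D h s <= D h t.
Proof.
  unfold pdist, enorm. fold (D h s). fold (D h t).
  pose proof (sqd_nonneg h s). pose proof (sqd_nonneg h t).
  split; intros H1; [now apply sqrt_le_0|now apply sqrt_le_1].
Qed.

Lemma pdist_lt h s t : pdist n V h s < pdist n V h t <-> D h s < D h t.
Proof.
  unfold pdist, enorm. fold (D h s). fold (D h t).
  pose proof (sqd_nonneg h s). pose proof (sqd_nonneg h t).
  split; intros H1; [now apply sqrt_lt_0|now apply sqrt_lt_1].
Qed.

Lemma sqd_dec k h s t : IZR k <= s -> s < t -> t <= IZR k + 1 -> t <= ft k h ->
  D h t < D h s.
Proof.
  intros H1 H2 H3 H4. pose proof (sqlen_pos k) as HL.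
  assert (E := sqd_edge k h s t ltac:(lra) ltac:(lra)).
  assert (0 < (s - t) * (s + t - 2 * ft k h)) by nra.
  assert (0 < sqlen k * ((s - t) * (s + t - 2 * ft k h))) by (apply Rmult_lt_0_compat; lra).
  lra.
Qed.

Lemma sqd_inc k h s t : IZR k <= s -> s < t -> t <= IZR k + 1 -> ft k h <= s ->
  D h s < D h t.
Proof.
  intros H1 H2 H3 H4. pose proof (sqlen_pos k) as HL.
  assert (E := sqd_edge k h t s ltac:(lra) ltac:(lra)).
  assert (0 < (t - s) * (t + s - 2 * ft k h)) by nra.
  assert (0 < sqlen k * ((t - s) * (t + s - 2 * ft k h))) by (apply Rmult_lt_0_compat; lra).
  lra.
Qed.

Lemma local_min_sqd h s : local_min n V h s <->
  exists eps, 0 < eps /\ forall u, Rabs (u - s) < eps -> D h s <= D h u.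
Proof.
  split; intros [eps [He H]]; exists eps; (split; [exact He|]); intros u Hu;
    apply pdist_le; auto.
Qed.

Lemma local_max_sqd h s : local_max h s <->
  exists eps, 0 < eps /\ forall u, Rabs (u - s) < eps -> D h u <= D h s.
Proof.
  split; intros [eps [He H]]; exists eps; (split; [exact He|]); intros u Hu;
    apply pdist_le; auto.
Qed.

Lemma small_step a b : 0 < a -> 0 < b -> exists t, 0 < t < a /\ t < b.
Proof.
  intros Ha Hb. exists (Rmin a b / 2).
  pose proof (Rmin_l a b). pose proof (Rmin_r a b).
  assert (0 < Rmin a b) by (now apply Rmin_glb_lt). lra.
Qed.

Lemma Rabs_plus_sub s t : 0 < t -> Rabs (s + t - s) = t.
Proof. intros. replace (s + t - s) with t by ring. apply Rabs_right. lra. Qed.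

Lemma Rabs_minus_sub s t : 0 < t -> Rabs (s - t - s) = t.
Proof.
  intros. replace (s - t - s) with (- t) by ring. rewrite Rabs_Ropp.
  apply Rabs_right. lra.
Qed.

Lemma min_nearby h s d : 0 < d -> local_min n V h s ->
  exists t, 0 < t < d /\ D h s <= D h (s + t) /\ D h s <= D h (s - t).
Proof.
  intros Hd Hm. apply local_min_sqd in Hm. destruct Hm as [eps [He Hm]].
  destruct (small_step eps d He Hd) as [t [Ht1 Ht2]]. exists t.
  split; [lra|]. split; apply Hm; rewrite ?Rabs_plus_sub, ?Rabs_minus_sub; lra.
Qed.

Lemma max_nearby h s d : 0 < d -> local_max h s ->
  exists t, 0 < t < d /\ D h (s + t) <= D h s /\ D h (s - t) <= D h s.
Proof.
  intros Hd Hm. apply local_max_sqd in Hm. destruct Hm as [eps [He Hm]].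
  destruct (small_step eps d He Hd) as [t [Ht1 Ht2]]. exists t.
  split; [lra|]. split; apply Hm; rewrite ?Rabs_plus_sub, ?Rabs_minus_sub; lra.
Qed.

Lemma not_min_right k h s : IZR k <= s < IZR k + 1 -> s < ft k h -> ~ local_min n V h s.
Proof.
  intros Hk Hf Hm.
  destruct (min_nearby h s (Rmin (ft k h - s) (IZR k + 1 - s))) as (t & [Ht0 Ht] & H & _);
    [apply Rmin_glb_lt; lra|exact Hm|].
  apply Rmin_Rgt_l in Ht. pose proof (sqd_dec k h s (s + t)). lra.
Qed.

Lemma not_min_left k h s : IZR k < s <= IZR k + 1 -> ft k h < s -> ~ local_min n V h s.
Proof.
  intros Hk Hf Hm.
  destruct (min_nearby h s (Rmin (s - ft k h) (s - IZR k))) as (t & [Ht0 Ht] & _ & H);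
    [apply Rmin_glb_lt; lra|exact Hm|].
  apply Rmin_Rgt_l in Ht. pose proof (sqd_inc k h (s - t) s). lra.
Qed.

Lemma not_max_right k h s : IZR k <= s < IZR k + 1 -> ft k h <= s -> ~ local_max h s.
Proof.
  intros Hk Hf Hm.
  destruct (max_nearby h s (IZR k + 1 - s)) as (t & Ht & H & _); [lra|exact Hm|].
  pose proof (sqd_inc k h s (s + t)). lra.
Qed.

Lemma not_max_left k h s : IZR k < s <= IZR k + 1 -> s <= ft k h -> ~ local_max h s.
Proof.
  intros Hk Hf Hm.
  destruct (max_nearby h s (s - IZR k)) as (t & Ht & _ & H); [lra|exact Hm|].
  pose proof (sqd_dec k h (s - t) s). lra.
Qed.

Lemma IZR_pred k : IZR (k - 1) = IZR k - 1.
Proof. now rewrite minus_IZR. Qed.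

Lemma min_interior k h s : IZR k < s < IZR k + 1 ->
  (local_min n V h s <-> ft k h = s).
Proof.
  intros Hk. split.
  - intros Hm. destruct (Rtotal_order (ft k h) s) as [H|[H|H]]; [|exact H|].
    + exfalso. revert Hm. apply (not_min_left k); lra.
    + exfalso. revert Hm. apply (not_min_right k); lra.
  - intros E. apply local_min_sqd. exists (Rmin (s - IZR k) (IZR k + 1 - s)).
    split; [apply Rmin_glb_lt; lra|]. intros u Hu. apply Rmin_Rgt_l in Hu.
    destruct Hu as [H1 H2]. apply Rabs_bounds_lt in H1, H2.
    destruct (Rtotal_order u s) as [H|[H|H]].
    + left. apply (sqd_dec k); lra.
    + subst u. right. reflexivity.
    + left. apply (sqd_inc k); lra.
Qed.

Lemma max_interior k h s : IZR k < s < IZR k + 1 -> ~ local_max h s.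
Proof.
  intros Hk. destruct (Rle_dec (ft k h) s).
  - apply (not_max_right k); lra.
  - apply (not_max_left k); lra.
Qed.

(** A foot exactly at the vertex still makes the distance increase away from it along that edge.
    Equality therefore belongs to the minima, and [max_vertex] has strict inequalities. *)
Lemma min_vertex k h :
  local_min n V h (IZR k) <-> IZR k <= ft (k - 1) h /\ ft k h <= IZR k.
Proof.
  pose proof (IZR_pred k) as Ek. split.
  - intros Hm. split; apply Rnot_lt_le; intros H; revert Hm.
    + apply (not_min_left (k - 1)); lra.
    + apply (not_min_right k); lra.
  - intros [H1 H2]. apply local_min_sqd. exists 1. split; [lra|].
    intros u Hu. apply Rabs_bounds_lt in Hu.
    destruct (Rtotal_order u (IZR k)) as [H|[H|H]].
    + left. apply (sqd_dec (k - 1)); lra.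
    + subst u. right. reflexivity.
    + left. apply (sqd_inc k); lra.
Qed.

Lemma max_vertex k h :
  local_max h (IZR k) <-> ft (k - 1) h < IZR k /\ IZR k < ft k h.
Proof.
  pose proof (IZR_pred k) as Ek. split.
  - intros Hm. split; apply Rnot_le_lt; intros H; revert Hm.
    + apply (not_max_left (k - 1)); lra.
    + apply (not_max_right k); lra.
  - intros [H1 H2]. apply local_max_sqd.
    exists (Rmin 1 (Rmin (IZR k - ft (k - 1) h) (ft k h - IZR k))).
    split; [repeat apply Rmin_glb_lt; lra|].
    intros u Hu. apply Rmin_Rgt_l in Hu. destruct Hu as [Hu Hu'].
    apply Rmin_Rgt_l in Hu'. destruct Hu' as [Hu' Hu''].
    apply Rabs_bounds_lt in Hu, Hu', Hu''.
    destruct (Rtotal_order u (IZR k)) as [H|[H|H]].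
    + left. apply (sqd_inc (k - 1)); lra.
    + subst u. right. reflexivity.
    + left. apply (sqd_dec k); lra.
Qed.

Lemma interior_or_vertex s :
  (exists k, IZR k < s < IZR k + 1) \/ exists k, s = IZR k.
Proof.
  destruct (on_some_edge s) as [k [[H|H] H']].
  - left. exists k. lra.
  - right. exists k. lra.
Qed.

(** ** Where a foot reaches a vertex *)

Lemma vx_index k : exists i, (i < n)%nat /\ vx k = V i /\ (Z.of_nat i = k mod Z.of_nat n)%Z.
Proof.
  pose proof n_ge_3. exists (Z.to_nat (k mod Z.of_nat n)).
  pose proof (Z.mod_pos_bound k (Z.of_nat n)).
  repeat split; lia.
Qed.

Lemma mod_succ_neq k : ((k + 1) mod Z.of_nat n <> k mod Z.of_nat n)%Z.
Proof.
  pose proof n_ge_3 as Hn. intros E.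
  pose proof (Z.div_mod (k + 1) (Z.of_nat n)).
  pose proof (Z.div_mod k (Z.of_nat n)).
  assert (1 = Z.of_nat n * ((k + 1) / Z.of_nat n - k / Z.of_nat n))%Z by nia.
  set (q := ((k + 1) / Z.of_nat n - k / Z.of_nat n)%Z) in *.
  assert (q <= 0 \/ 1 <= q)%Z by lia. nia.
Qed.

(** If vertex [m] is the other end of the edge, the product is a squared length up to sign; every
    other vertex is covered by [no_right_triple]. *)
Lemma no_right_vertex m k j : (j = k - 1 \/ j = k)%Z -> vx m <> vx k ->
  dot (psub (vx m) (vx k)) (edge j) <> 0.
Proof.
  intros Hj Hne.
  assert (Hw : forall w, (w = k - 1 \/ w = k + 1)%Z ->
            dot (psub (vx m) (vx k)) (psub (vx w) (vx k)) <> 0).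
  { intros w Hw.
    destruct (vx_index m) as (im & Him & Em & Mm).
    destruct (vx_index k) as (ik & Hik & Ek & Mk).
    destruct (vx_index w) as (iw & Hiw & Ew & Mw).
    assert (Hkw : ik <> iw).
    { intros E. subst iw. rewrite Mk in Mw. destruct Hw as [-> | ->].
      - apply (mod_succ_neq (k - 1)). now replace (k - 1 + 1)%Z with k by ring.
      - now apply (mod_succ_neq k). }
    assert (Hmk : im <> ik) by (intros E; apply Hne; congruence).
    destruct (Nat.eq_dec im iw) as [E|E].
    - rewrite Em, Ew, E.
      assert (Hpos : 0 < dot (psub (vx w) (vx k)) (psub (vx w) (vx k))).
      { destruct Hw as [-> | ->].
        - pose proof (sqlen_pos (k - 1)) as H. unfold sqlen, edge in H.
          replace (k - 1 + 1)%Z with k in H by ring.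
          unfold dot, psub in *. cbn [fst snd] in *. lra.
        - exact (sqlen_pos k). }
      rewrite Ew in Hpos. lra.
    - rewrite Em, Ek, Ew. apply Hnoright; auto. }
  destruct Hj as [-> | ->].
  - specialize (Hw (k - 1)%Z (or_introl eq_refl)). unfold edge.
    replace (k - 1 + 1)%Z with k by ring. intros E. apply Hw.
    unfold dot, psub in *. cbn [fst snd] in *. lra.
  - apply Hw. now right.
Qed.

Lemma foot_vertex_dot j k h : (j = k - 1 \/ j = k)%Z ->
  ft j h - IZR k = dot (psub (tr h) (vx k)) (edge j) / sqlen j.
Proof.
  intros [-> | ->]; [now apply foot_left|apply foot_right].
Qed.

Lemma foot_vertex_zero j k h : (j = k - 1 \/ j = k)%Z -> ft j h = IZR k ->
  dot (psub (tr h) (vx k)) (edge j) = 0.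
Proof.
  intros Hj E. pose proof (foot_vertex_dot j k h Hj) as H.
  pose proof (sqlen_pos j).
  apply Rmult_eq_reg_r with (/ sqlen j).
  - unfold Rdiv in H. lra.
  - apply Rinv_neq_0_compat. lra.
Qed.

(** The foot is affine while the human stays on one edge. With slope zero both ends of her edge
    would lie on the perpendicular at vertex [k], hence by [no_right_vertex] both at [vx k]. For the
    same reason she is not at a vertex. *)
Lemma foot_cross j k h0 : (j = k - 1 \/ j = k)%Z -> ft j h0 = IZR k -> tr h0 <> vx k ->
  exists c del, c <> 0 /\ 0 < del /\
    forall h, Rabs (h - h0) < del -> ft j h - IZR k = c * (h - h0).
Proof.
  intros Hj E Hne.
  assert (Hvert : forall m, ft j (IZR m) = IZR k -> vx m = vx k).
  { intros m Em. apply NNPP. intros Hm.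
    apply (no_right_vertex m k j Hj Hm). rewrite <- (track_vertex m).
    now apply foot_vertex_zero. }
  destruct (interior_or_vertex h0) as [[m Hm]|[m ->]].
  2:{ exfalso. apply Hne. rewrite track_vertex. now apply Hvert. }
  set (c := dot (edge m) (edge j) / sqlen j).
  assert (Haff : forall h, IZR m <= h <= IZR m + 1 -> ft j h = ft j (IZR m) + (h - IZR m) * c).
  { intros h Hh. pose proof (foot_affine j m h (IZR m) Hh ltac:(lra)) as H. fold c in H. lra. }
  exists c, (Rmin (h0 - IZR m) (IZR m + 1 - h0)). repeat split.
  - intros Hc. rewrite Hc in Haff.
    assert (E0 : ft j (IZR m) = IZR k) by (rewrite <- E, (Haff h0); lra).
    assert (E1 : ft j (IZR (m + 1)) = IZR k).
    { rewrite plus_IZR, Haff by lra. lra. }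
    apply Hvert in E0, E1.
    pose proof (sqlen_pos m) as HL. unfold sqlen, edge in HL.
    rewrite E0, E1 in HL. unfold dot, psub in HL. cbn [fst snd] in HL. lra.
  - apply Rmin_glb_lt; lra.
  - intros h Hh. apply Rmin_Rgt_l in Hh. destruct Hh as [H1 H2].
    apply Rabs_bounds_lt in H1, H2. rewrite <- E, (Haff h), (Haff h0) by lra. ring.
Qed.

(** Otherwise the two edges would overlap near their common vertex, against simplicity. *)
Lemma no_spike k a b : 0 < a -> 0 < b ->
  ~ (a * fst (edge k) = - b * fst (edge (k - 1)) /\
     a * snd (edge k) = - b * snd (edge (k - 1))).
Proof.
  intros Ha Hb [H1 H2]. pose proof (IZR_pred k) as Ek.
  destruct (small_step (/ a) (/ b)) as [t [Ht1 Ht2]]; try now apply Rinv_0_lt_compat.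
  assert (Hta : 0 < t * a < 1).
  { split; [apply Rmult_lt_0_compat; lra|].
    apply Rmult_lt_reg_r with (/ a); [now apply Rinv_0_lt_compat|].
    rewrite Rmult_assoc, Rinv_r by lra. lra. }
  assert (Htb : 0 < t * b < 1).
  { split; [apply Rmult_lt_0_compat; lra|].
    apply Rmult_lt_reg_r with (/ b); [now apply Rinv_0_lt_compat|].
    rewrite Rmult_assoc, Rinv_r by lra. lra. }
  assert (Heq : tr (IZR k + t * a) = tr (IZR k - t * b)).
  { rewrite (track_on_edge k) by lra.
    rewrite (track_on_edge (k - 1)) by lra.
    assert (Ev : vx k = (fst (vx (k - 1)%Z) + fst (edge (k - 1)),
                         snd (vx (k - 1)%Z) + snd (edge (k - 1)))).
    { unfold edge, psub. cbn [fst snd]. replace (k - 1 + 1)%Z with k by ring.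
      apply injective_projections; cbn [fst snd]; ring. }
    rewrite Ev. cbn [fst snd]. rewrite Ek.
    replace (IZR k + t * a - IZR k) with (t * a) by ring. rewrite !Rmult_assoc, H1, H2.
    f_equal; ring. }
  apply track_inj_near in Heq; [lra|].
  pose proof INRn_ge_3. apply Rabs_def1; lra.
Qed.

(** Both edges are perpendicular to the line from the vertex to the human, hence parallel, and by
    [no_spike] they point the same way. The two feet then pass the vertex together, and the local
    minimum passes it with them. *)
Lemma feet_parallel k h0 : ft (k - 1) h0 = IZR k -> ft k h0 = IZR k -> tr h0 <> vx k ->
  exists c, 0 < c /\ forall h, ft k h - IZR k = c * (ft (k - 1) h - IZR k).
Proof.
  intros E1 E2 Hne.
  apply (foot_vertex_zero (k - 1) k) in E1; [|now left].
  apply (foot_vertex_zero k k) in E2; [|now right].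
  pose proof (sqlen_pos (k - 1)) as L1. pose proof (sqlen_pos k) as L2.
  set (e := edge (k - 1)) in *. set (e' := edge k) in *.
  assert (Hpar : exists c, c <> 0 /\ fst e' = c * fst e /\ snd e' = c * snd e).
  { assert (Hcross : fst e * snd e' = snd e * fst e').
    { assert (Hu : fst (psub (tr h0) (vx k)) <> 0 \/ snd (psub (tr h0) (vx k)) <> 0).
      { apply NNPP. intros H. apply not_or_and in H. destruct H as [H H'].
        apply NNPP in H, H'. apply Hne. unfold psub in H, H'. cbn [fst snd] in H, H'.
        apply injective_projections; lra. }
      set (u := psub (tr h0) (vx k)) in *. unfold dot in E1, E2.
      apply Rminus_diag_uniq. 
      assert (F1 : fst u * (fst e * snd e' - snd e * fst e') = 0).
      { replace (fst u * (fst e * snd e' - snd e * fst e')) with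
          ((fst u * fst e + snd u * snd e) * snd e' -
           (fst u * fst e' + snd u * snd e') * snd e) by ring. rewrite E1, E2. ring. }
      assert (F2 : snd u * (fst e * snd e' - snd e * fst e') = 0).
      { replace (snd u * (fst e * snd e' - snd e * fst e')) with
          ((fst u * fst e' + snd u * snd e') * fst e -
           (fst u * fst e + snd u * snd e) * fst e') by ring. rewrite E1, E2. ring. }
      apply Rmult_integral in F1, F2. tauto. }
    unfold sqlen in L1, L2. fold e in L1. fold e' in L2. unfold dot in L1, L2.
    exists ((fst e * fst e' + snd e * snd e') / (fst e * fst e + snd e * snd e)).
    set (q := fst e * fst e + snd e * snd e) in *.
    assert (G1 : (fst e * fst e' + snd e * snd e') * fst e = fst e' * q).
    { unfold q. transitivity (fst e * fst e * fst e' + snd e * (fst e * snd e')); [ring|].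
      rewrite Hcross. ring. }
    assert (G2 : (fst e * fst e' + snd e * snd e') * snd e = snd e' * q).
    { unfold q. transitivity (fst e * (snd e * fst e') + snd e * snd e * snd e'); [ring|].
      rewrite <- Hcross. ring. }
    assert (G3 : fst e' = (fst e * fst e' + snd e * snd e') / q * fst e).
    { apply Rmult_eq_reg_r with q; [|lra]. rewrite <- G1. field. lra. }
    assert (G4 : snd e' = (fst e * fst e' + snd e * snd e') / q * snd e).
    { apply Rmult_eq_reg_r with q; [|lra]. rewrite <- G2. field. lra. }
    repeat split; auto. intros G. rewrite G in G3, G4.
    rewrite G3, G4 in L2. lra. }
  destruct Hpar as (c & Hc0 & Hx & Hy).
  assert (Hc : 0 < c).
  { apply Rnot_le_lt. intros Hc. apply (no_spike k 1 (- c)); [lra|lra|].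
    fold e e'. rewrite Hx, Hy. split; ring. }
  exists (/ c). split; [now apply Rinv_0_lt_compat|]. intros h.
  rewrite (foot_vertex_dot k k) by now right.
  rewrite (foot_vertex_dot (k - 1) k) by now left.
  unfold sqlen in *. fold e e' in L1, L2 |- *. unfold dot in *. rewrite Hx, Hy.
  field. repeat split; try lra. intros H. 
  rewrite Hx, Hy in L2. lra.
Qed.

(** * Continuous induction and Lipschitz functions of one variable *)

Lemma real_induction (P : R -> Prop) a b : a <= b ->
  (forall t, a <= t <= b -> (forall u, a <= u < t -> P u) -> P t) ->
  (forall t, a <= t < b -> (forall u, a <= u <= t -> P u) ->
     exists del, 0 < del /\ forall u, t < u < t + del -> u <= b -> P u) ->
  forall t, a <= t <= b -> P t.
Proof.
  intros Hab Hleft Hright.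
  set (E := fun t => a <= t <= b /\ forall u, a <= u <= t -> P u).
  assert (Ha : E a).
  { split; [lra|]. intros u Hu. replace u with a by lra. apply Hleft; [lra|].
    intros; lra. }
  destruct (completeness E) as [m [Hm1 Hm2]].
  - exists b. intros t [Ht _]. lra.
  - now exists a.
  - assert (Ham : a <= m) by (apply Hm1, Ha).
    assert (Hmb : m <= b) by (apply Hm2; intros t [Ht _]; lra).
    assert (Hlt : forall u, a <= u < m -> P u).
    { intros u Hu. apply NNPP. intros Hn.
      assert (m <= u); [|lra]. apply Hm2. intros t [Ht HP].
      apply Rnot_lt_le. intros H. apply Hn, HP. lra. }
    assert (Hm : P m) by (apply Hleft; [lra|exact Hlt]).
    assert (Hle : forall u, a <= u <= m -> P u).
    { intros u [H1 [H2| ->]]; [apply Hlt; lra|exact Hm]. }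
    destruct (Rle_lt_or_eq_dec m b Hmb) as [Hlt'|Heq].
    + exfalso. destruct (Hright m ltac:(lra) Hle) as [del [Hd HP]].
      destruct (small_step del (b - m)) as [s [Hs1 Hs2]]; try lra.
      assert (m + s <= m); [|lra]. apply Hm1. split; [lra|].
      intros u Hu. destruct (Rle_dec u m); [apply Hle; lra|apply HP; lra].
    + intros t Ht. apply Hle. lra.
Qed.

Definition lip (g : R -> R) : Prop :=
  exists C, 0 <= C /\ forall s t, Rabs (g s - g t) <= C * Rabs (s - t).

Lemma lip_near g h0 eps : lip g -> 0 < eps ->
  exists del, 0 < del /\ forall h, Rabs (h - h0) < del -> Rabs (g h - g h0) < eps.
Proof.
  intros (C & HC & H) He. exists (eps / (C + 1)).
  split; [apply Rdiv_lt_0_compat; lra|]. intros h Hh.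
  apply Rle_lt_trans with (C * Rabs (h - h0)); [apply H|].
  apply Rle_lt_trans with ((C + 1) * Rabs (h - h0)).
  - pose proof (Rabs_pos (h - h0)). nra.
  - apply Rlt_le_trans with ((C + 1) * (eps / (C + 1))).
    + apply Rmult_lt_compat_l; lra.
    + right. field. lra.
Qed.

Lemma lip_add g g' : lip g -> lip g' -> lip (fun t => g t + g' t).
Proof.
  intros (C & HC & H) (C' & HC' & H'). exists (C + C'). split; [lra|]. intros s t.
  replace (g s + g' s - (g t + g' t)) with ((g s - g t) + (g' s - g' t)) by ring.
  eapply Rle_trans; [apply Rabs_triang|]. specialize (H s t). specialize (H' s t). lra.
Qed.

Lemma lip_scale a g : lip g -> lip (fun t => a * g t).
Proof.
  intros (C & HC & H). exists (Rabs a * C).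
  split; [apply Rmult_le_pos; [apply Rabs_pos|exact HC]|]. intros s t.
  rewrite <- Rmult_minus_distr_l, Rabs_mult, Rmult_assoc.
  apply Rmult_le_compat_l; [apply Rabs_pos|apply H].
Qed.

Lemma lip_id : lip (fun t => t).
Proof. exists 1. split; [lra|]. intros s t. lra. Qed.

Lemma lip_const c : lip (fun _ => c).
Proof.
  exists 0. split; [lra|]. intros s t. rewrite Rminus_diag, Rabs_R0. lra.
Qed.

Lemma lip_comp g g' : lip g -> lip g' -> lip (fun t => g (g' t)).
Proof.
  intros (C & HC & H) (C' & HC' & H'). exists (C * C').
  split; [now apply Rmult_le_pos|]. intros s t.
  eapply Rle_trans; [apply H|]. rewrite Rmult_assoc. apply Rmult_le_compat_l; auto.
Qed.

Lemma ivt_zero g a b : a <= b -> lip g -> 0 < g a -> g b <= 0 ->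
  exists t, a <= t <= b /\ g t = 0.
Proof.
  intros Hab Hl Ha Hb. apply NNPP. intros Hn.
  assert (H : forall t, a <= t <= b -> 0 < g t).
  { apply real_induction; [exact Hab| |].
    - intros t Ht HP. destruct (Rtotal_order (g t) 0) as [H|[H|H]]; [|exfalso|exact H].
      + exfalso. destruct (lip_near g t (- g t) Hl ltac:(lra)) as [del [Hd Hdel]].
        destruct (Rle_lt_or_eq_dec a t (proj1 Ht)) as [Hat|Hat]; [|subst t; lra].
        destruct (small_step del (t - a)) as [s [Hs1 Hs2]]; try lra.
        specialize (Hdel (t - s)). rewrite Rabs_minus_sub in Hdel by lra.
        specialize (Hdel ltac:(lra)). apply Rabs_bounds_lt in Hdel.
        specialize (HP (t - s) ltac:(lra)). lra.
      + apply Hn. now exists t.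
    - intros t Ht HP. specialize (HP t ltac:(lra)).
      destruct (lip_near g t (g t) Hl HP) as [del [Hd Hdel]].
      exists del. split; [exact Hd|]. intros u Hu Hub.
      specialize (Hdel u). rewrite Rabs_right in Hdel by lra.
      specialize (Hdel ltac:(lra)). apply Rabs_bounds_lt in Hdel. lra. }
  specialize (H b ltac:(lra)). lra.
Qed.

Lemma locally_constant (Q : R -> Prop) a b :
  (forall t, a <= t <= b -> exists del, 0 < del /\
     forall u, a <= u <= b -> Rabs (u - t) < del -> (Q u <-> Q t)) ->
  forall s t, a <= s <= b -> a <= t <= b -> (Q s <-> Q t).
Proof.
  intros H.
  assert (Hab : a <= b -> forall t, a <= t <= b -> (Q a <-> Q t)).
  { intros Hle. apply real_induction; [exact Hle| |].
    - intros t Ht HP. destruct (Rle_lt_or_eq_dec a t (proj1 Ht)) as [Hat|Hat].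
      2:{ subst t. tauto. }
      destruct (H t Ht) as [del [Hd Hdel]].
      destruct (small_step del (t - a)) as [s [Hs1 Hs2]]; try lra.
      rewrite (HP (t - s)) by lra. apply Hdel; [lra|].
      rewrite Rabs_minus_sub; lra.
    - intros t Ht HP. destruct (H t ltac:(lra)) as [del [Hd Hdel]].
      exists del. split; [exact Hd|]. intros u Hu Hub.
      rewrite (HP t) by lra. symmetry. apply Hdel; [lra|].
      rewrite Rabs_right; lra. }
  intros s t Hs Ht. rewrite <- (Hab ltac:(lra) s Hs). apply Hab; lra.
Qed.

(** * Runs of the puppy as monotone stretches of the distance *)

Definition desc (h a b : R) : Prop := forall x y, a <= x -> x < y -> y <= b -> D h y < D h x.
Definition asc (h a b : R) : Prop := forall x y, a <= x -> x < y -> y <= b -> D h x < D h y.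

Lemma desc_trans h a b c : a <= b -> b <= c -> desc h a b -> desc h b c -> desc h a c.
Proof.
  intros Hab Hbc H1 H2 x y Hx Hxy Hy.
  destruct (Rle_dec y b) as [Hyb|Hyb]; [apply H1; lra|].
  destruct (Rle_dec b x) as [Hbx|Hbx]; [apply H2; lra|].
  apply Rlt_trans with (D h b); [apply H2; lra|apply H1; lra].
Qed.

Lemma asc_trans h a b c : a <= b -> b <= c -> asc h a b -> asc h b c -> asc h a c.
Proof.
  intros Hab Hbc H1 H2 x y Hx Hxy Hy.
  destruct (Rle_dec y b) as [Hyb|Hyb]; [apply H1; lra|].
  destruct (Rle_dec b x) as [Hbx|Hbx]; [apply H2; lra|].
  apply Rlt_trans with (D h b); [apply H1; lra|apply H2; lra].
Qed.

Lemma run_cases h p r : run h p r <->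
  ((p < r /\ desc h p r) \/ (r < p /\ asc h r p)) /\ lmin h r.
Proof.
  split.
  - intros (sg & a & Hsg & Ha & -> & Hdec & Hm). split; [|exact Hm].
    destruct Hsg as [-> | ->].
    + left. split; [lra|]. intros x y Hx Hxy Hy.
      specialize (Hdec (x - p) (y - p) ltac:(lra) ltac:(lra) ltac:(lra)).
      apply pdist_lt in Hdec. replace (p + 1 * (y - p)) with y in Hdec by ring.
      now replace (p + 1 * (x - p)) with x in Hdec by ring.
    + right. split; [lra|]. intros x y Hx Hxy Hy.
      specialize (Hdec (p - y) (p - x) ltac:(lra) ltac:(lra) ltac:(lra)).
      apply pdist_lt in Hdec. replace (p + -1 * (p - y)) with y in Hdec by ring.
      now replace (p + -1 * (p - x)) with x in Hdec by ring.
  - intros [[[Hp Hd]|[Hp Hd]] Hm].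
    + exists 1, (r - p). repeat split; [now left|lra|ring| |exact Hm].
      intros x y Hx Hxy Hy. apply pdist_lt. apply Hd; lra.
    + exists (-1), (p - r). repeat split; [now right|lra|ring| |exact Hm].
      intros x y Hx Hxy Hy. apply pdist_lt. apply Hd; lra.
Qed.

Lemma desc_no_ext h a b p : desc h a b -> a < p < b -> ~ lext h p.
Proof.
  intros Hd Hp [H|H].
  - destruct (min_nearby h p (b - p)) as (t & Ht & K & _); [lra|exact H|].
    specialize (Hd p (p + t)). lra.
  - destruct (max_nearby h p (p - a)) as (t & Ht & _ & K); [lra|exact H|].
    specialize (Hd (p - t) p). lra.
Qed.

Lemma asc_no_ext h a b p : asc h a b -> a < p < b -> ~ lext h p.
Proof.
  intros Hd Hp [H|H].
  - destruct (min_nearby h p (p - a)) as (t & Ht & _ & K); [lra|exact H|].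
    specialize (Hd (p - t) p). lra.
  - destruct (max_nearby h p (b - p)) as (t & Ht & K & _); [lra|exact H|].
    specialize (Hd p (p + t)). lra.
Qed.

Lemma run_no_ext h p r x : run h p r -> p < x < r \/ r < x < p -> ~ lext h x.
Proof.
  intros Hr Hx. apply run_cases in Hr. destruct Hr as [[[H Hd]|[H Hd]] _].
  - apply (desc_no_ext h p r); [exact Hd|lra].
  - apply (asc_no_ext h r p); [exact Hd|lra].
Qed.

Lemma run_not_min h p r : run h p r -> ~ lmin h p.
Proof.
  intros Hr H. apply run_cases in Hr. destruct Hr as [[[Hp Hd]|[Hp Hd]] _].
  - destruct (min_nearby h p (r - p)) as (t & Ht & K & _); [lra|exact H|].
    specialize (Hd p (p + t)). lra.
  - destruct (min_nearby h p (p - r)) as (t & Ht & _ & K); [lra|exact H|].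
    specialize (Hd (p - t) p). lra.
Qed.

Lemma caught_min h s : tr s = tr h -> lmin h s.
Proof.
  intros E. apply local_min_sqd. exists 1. split; [lra|]. intros u _.
  rewrite (sqd_refl h s E). apply sqd_nonneg.
Qed.

(** A descent through [n] whole edges would come back to the starting point at a smaller
    distance. *)
Lemma run_up_exists h k : IZR k < ft k h ->
  exists r, IZR k < r /\ desc h (IZR k) r /\ lmin h r.
Proof.
  assert (Hind : forall m k, IZR k < ft k h ->
     (exists r, IZR k < r /\ desc h (IZR k) r /\ lmin h r) \/
     desc h (IZR k) (IZR k + INR m)).
  { clear k. induction m as [|m IH]; intros k Hk.
    - right. intros x y Hx Hxy Hy. simpl in Hy. lra.
    - destruct (Rlt_dec (ft k h) (IZR k + 1)) as [Hlt|Hge].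
      + left. exists (ft k h). split; [exact Hk|]. split.
        * intros x y Hx Hxy Hy. apply (sqd_dec k); lra.
        * apply (min_interior k); lra.
      + assert (Hd : desc h (IZR k) (IZR (k + 1))).
        { rewrite plus_IZR. intros x y Hx Hxy Hy. apply (sqd_dec k); lra. }
        assert (Hlt : IZR k < IZR (k + 1)) by (rewrite plus_IZR; lra).
        destruct (Rle_dec (ft (k + 1) h) (IZR (k + 1))) as [Hle|Hgt].
        * left. exists (IZR (k + 1)). split; [exact Hlt|]. split; [exact Hd|].
          apply min_vertex. replace (k + 1 - 1)%Z with k by ring.
          split; [|exact Hle]. rewrite plus_IZR. lra.
        * destruct (IH (k + 1)%Z) as [(r & Hr1 & Hr2 & Hr3)|Hd']; [lra| |].
          -- left. exists r. split; [lra|]. split; [|exact Hr3].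
             apply desc_trans with (IZR (k + 1)); auto; lra.
          -- right. rewrite S_INR.
             replace (IZR k + (INR m + 1)) with (IZR (k + 1) + INR m)
               by (rewrite plus_IZR; ring).
             apply desc_trans with (IZR (k + 1)); auto; try lra.
             pose proof (pos_INR m). lra. }
  intros Hk. destruct (Hind n k Hk) as [H|H]; [exact H|exfalso].
  pose proof INRn_ge_3.
  specialize (H (IZR k) (IZR k + INR n) ltac:(lra) ltac:(lra) ltac:(lra)).
  pose proof (sqd_period h (IZR k) 0 1) as E.
  replace (h + 0 * INR n) with h in E by ring. rewrite Rmult_1_l in E. lra.
Qed.

Lemma run_down_exists h k : ft (k - 1) h < IZR k ->
  exists r, r < IZR k /\ asc h r (IZR k) /\ lmin h r.
Proof.
  assert (Hind : forall m k, ft (k - 1) h < IZR k ->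
     (exists r, r < IZR k /\ asc h r (IZR k) /\ lmin h r) \/
     asc h (IZR k - INR m) (IZR k)).
  { clear k. induction m as [|m IH]; intros k Hk.
    - right. intros x y Hx Hxy Hy. simpl in Hx. lra.
    - pose proof (IZR_pred k) as Ek.
      destruct (Rlt_dec (IZR (k - 1)) (ft (k - 1) h)) as [Hlt|Hge].
      + left. exists (ft (k - 1) h). split; [exact Hk|]. split.
        * intros x y Hx Hxy Hy. apply (sqd_inc (k - 1)); lra.
        * apply (min_interior (k - 1)); lra.
      + assert (Hd : asc h (IZR (k - 1)) (IZR k)).
        { intros x y Hx Hxy Hy. apply (sqd_inc (k - 1)); lra. }
        destruct (Rle_dec (IZR (k - 1)) (ft (k - 1 - 1) h)) as [Hle|Hgt].
        * left. exists (IZR (k - 1)). split; [lra|]. split; [exact Hd|].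
          apply min_vertex. lra.
        * destruct (IH (k - 1)%Z) as [(r & Hr1 & Hr2 & Hr3)|Hd']; [lra| |].
          -- left. exists r. split; [lra|]. split; [|exact Hr3].
             apply asc_trans with (IZR (k - 1)); auto; lra.
          -- right. rewrite S_INR.
             replace (IZR k - (INR m + 1)) with (IZR (k - 1) - INR m) by lra.
             pose proof (pos_INR m).
             apply asc_trans with (IZR (k - 1)); auto; lra. }
  intros Hk. destruct (Hind n k Hk) as [H|H]; [exact H|exfalso].
  pose proof INRn_ge_3.
  specialize (H (IZR k - INR n) (IZR k) ltac:(lra) ltac:(lra) ltac:(lra)).
  pose proof (sqd_period h (IZR k) 0 (-1)) as E.
  replace (h + 0 * INR n) with h in E by ring.
  replace (IZR k + -1 * INR n) with (IZR k - INR n) in E by ring. lra.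
Qed.

(** ** Short moves of the human *)

(* The puppy tracks the isolated branch [b] of local minima while the human moves
   from [h] to [h + d]; the branch may cease to be a local minimum at time 1. *)
Definition tracks (h d : R) (b : R -> R) : Prop :=
  lip b /\
  (forall t, 0 <= t < 1 -> lmin (hpos h d t) (b t)) /\
  (forall t, 0 <= t < 1 -> exists del, 0 < del /\ forall u s,
     t <= u < t + del -> Rabs (s - b t) < del -> lmin (hpos h d u) s -> s = b u).

Lemma response_tracks h d b q : tracks h d b -> puppy_response n V h d (b 0) q ->
  (forall t, 0 <= t < 1 -> q t = b t) /\ settle (hpos h d 1) (b 1) (q 1).
Proof.
  intros (Hc & Hm & Hi) (Hq0 & Hqm & Hqr & Hql).
  assert (H : forall t, 0 <= t <= 1 ->
            (t < 1 -> q t = b t) /\ (t = 1 -> settle (hpos h d 1) (b 1) (q 1))).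
  { apply (real_induction (fun t => (t < 1 -> q t = b t) /\
             (t = 1 -> settle (hpos h d 1) (b 1) (q 1)))); [lra| |].
    - intros t Ht HP.
      destruct (Rle_lt_or_eq_dec 0 t (proj1 Ht)) as [Ht0|Ht0].
      2:{ subst t. split; [intros _; exact Hq0|intros; lra]. }
      assert (HL : q t = b t \/ run (hpos h d t) (b t) (q t)).
      { destruct (Hql t ltac:(lra)) as (L & HL & Hor).
        assert (E : L = b t); [|subst L; destruct Hor; auto].
        apply NNPP. intros Hne.
        assert (He : 0 < Rabs (L - b t) / 2).
        { assert (0 < Rabs (L - b t)) by (apply Rabs_pos_lt; lra). lra. }
        destruct (HL _ He) as (d1 & Hd1 & H1).
        destruct (lip_near b t _ Hc He) as (d2 & Hd2 & H2).
        destruct (small_step t (Rmin d1 d2)) as [s [Hs1 Hs2]].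
        - lra.
        - now apply Rmin_glb_lt.
        - apply Rmin_Rgt_l in Hs2.
          specialize (H1 (t - s) ltac:(lra)). specialize (H2 (t - s)).
          rewrite Rabs_minus_sub in H2 by lra. specialize (H2 ltac:(lra)).
          destruct (HP (t - s) ltac:(lra)) as [E _]. rewrite E in H1 by lra.
          pose proof (Rabs_triang (- (b (t - s) - L)) (b (t - s) - b t)) as H3.
          rewrite Rabs_Ropp in H3.
          replace (- (b (t - s) - L) + (b (t - s) - b t)) with (L - b t) in H3 by ring.
          lra. }
      split.
      + intros Ht1. destruct HL as [HL|HL]; [exact HL|exfalso].
        apply (run_not_min _ _ _ HL). apply Hm. lra.
      + intros ->. destruct HL as [HL|HL]; [left|now right].
        split; [exact HL|]. rewrite <- HL. apply Hqm. lra.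
    - intros t Ht HP. destruct (HP t ltac:(lra)) as [E _]. specialize (E ltac:(lra)).
      destruct (Hi t Ht) as (d1 & Hd1 & H1).
      destruct (Hqr t Ht d1 Hd1) as (d2 & Hd2 & H2).
      exists (Rmin (Rmin d1 d2) (1 - t)). split.
      { repeat apply Rmin_glb_lt; lra. }
      intros u Hu Hu1.
      pose proof (Rmin_l (Rmin d1 d2) (1 - t)). pose proof (Rmin_r (Rmin d1 d2) (1 - t)).
      pose proof (Rmin_l d1 d2). pose proof (Rmin_r d1 d2).
      split; [intros _|intros; lra].
      apply H1; [lra| |apply Hqm; lra].
      rewrite <- E. apply H2. lra. }
  split.
  - intros t Ht. apply H; lra.
  - apply (H 1); lra.
Qed.

Lemma response_exists h d b q1 : tracks h d b -> settle (hpos h d 1) (b 1) q1 ->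
  exists q, puppy_response n V h d (b 0) q.
Proof.
  intros (Hc & Hm & Hi) Hset.
  exists (fun t => if Rlt_dec t 1 then b t else q1).
  assert (Hlt : forall t, t < 1 -> (if Rlt_dec t 1 then b t else q1) = b t)
    by (intros t Ht; destruct (Rlt_dec t 1); lra).
  assert (H1 : (if Rlt_dec 1 1 then b 1 else q1) = q1)
    by (destruct (Rlt_dec 1 1); lra).
  split; [apply Hlt; lra|]. split; [|split].
  - intros t Ht. destruct (Rlt_dec t 1) as [H|H].
    + apply Hm. lra.
    + replace t with 1 by lra. destruct Hset as [[-> Hs1]|Hr]; [exact Hs1|].
      now apply run_cases in Hr.
  - intros t Ht eps He. destruct (lip_near b t eps Hc He) as (d1 & Hd1 & H2).
    exists (Rmin d1 (1 - t)). split; [apply Rmin_glb_lt; lra|].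
    intros u Hu. pose proof (Rmin_l d1 (1 - t)). pose proof (Rmin_r d1 (1 - t)).
    rewrite !Hlt by lra. apply H2, Rabs_def1; lra.
  - intros t Ht. exists (b t). split.
    + intros eps He. destruct (lip_near b t eps Hc He) as (d1 & Hd1 & H2).
      exists (Rmin d1 t). split; [apply Rmin_glb_lt; lra|].
      intros u Hu. pose proof (Rmin_l d1 t). pose proof (Rmin_r d1 t).
      rewrite Hlt by lra. apply H2, Rabs_def1; lra.
    + destruct (Rlt_dec t 1) as [H|H]; [now left|].
      replace t with 1 by lra. destruct Hset as [[-> _]|Hr]; auto.
Qed.

Lemma win_tracks h d b : tracks h d b ->
  (exists q1, settle (hpos h d 1) (b 1) q1) ->
  (forall q1, settle (hpos h d 1) (b 1) q1 ->
     (exists t, 0 <= t < 1 /\ tr (hpos h d t) = tr (b t)) \/ Win (hpos h d 1) q1) ->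
  Win h (b 0).
Proof.
  intros Ht [q1 Hq1] Hw. apply hw_move with d.
  - now apply response_exists with q1.
  - intros q Hq. destruct (response_tracks h d b q Ht Hq) as [E Hset].
    destruct (Hw (q 1) Hset) as [(t & Ht1 & Hc)|H]; [left|now right].
    exists t. split; [lra|]. now rewrite E.
Qed.

Lemma win_shift c h p : Win h p -> Win (h + IZR c * INR n) p.
Proof.
  set (z := IZR c * INR n).
  assert (Hpd : forall x s, pdist n V (x + z) s = pdist n V x s).
  { intros x s. unfold pdist, z. now rewrite track_period. }
  assert (Hhp : forall x d t, hpos (x + z) d t = hpos x d t + z)
    by (intros; unfold hpos; ring).
  assert (Hmin : forall x s, lmin (x + z) s <-> lmin x s).
  { intros x s. unfold local_min. split; intros (e & He & Hu); exists e; split; auto;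
      intros u Hlt; specialize (Hu u Hlt); rewrite ?Hpd in *; exact Hu. }
  assert (Hrun : forall x s r, run (x + z) s r <-> run x s r).
  { intros x s r. unfold puppy_run. split; intros (sg & a & H1 & H2 & H3 & H4 & H5);
      exists sg, a; repeat split; auto; try (now apply Hmin);
      intros u v Hu Hv Hw; specialize (H4 u v Hu Hv Hw); rewrite ?Hpd in *; exact H4. }
  assert (Hresp : forall x d s q, puppy_response n V (x + z) d s q <->
                                  puppy_response n V x d s q).
  { intros x d s q. unfold puppy_response.
    split; intros (H1 & H2 & H3 & H4); repeat split; auto.
    - intros t Ht. specialize (H2 t Ht). rewrite Hhp in H2. now apply Hmin.
    - intros t Ht. destruct (H4 t Ht) as (L & HL & Hor). exists L. split; [exact HL|].
      rewrite Hhp, Hrun in Hor. exact Hor.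
    - intros t Ht. specialize (H2 t Ht). rewrite Hhp. now apply Hmin.
    - intros t Ht. destruct (H4 t Ht) as (L & HL & Hor). exists L. split; [exact HL|].
      rewrite Hhp, Hrun. exact Hor. }
  (* The recursive occurrence of [human_wins] is nested in a disjunction, hence the explicit
     fixpoint on the derivation. *)
  revert h p. fix IH 3. intros h p [h' p' E|h' p' d [q Hq] Hall].
  - apply hw_caught. unfold z. now rewrite track_period.
  - apply hw_move with d.
    + exists q. now apply Hresp.
    + intros q' Hq'. apply (proj1 (Hresp _ _ _ _)) in Hq'. rewrite Hhp.
      destruct (Hall q' Hq') as [(t & Ht & E)|H]; [left|right; exact (IH _ _ H)].
      exists t. split; [exact Ht|]. rewrite Hhp. unfold z.
      now rewrite track_period.
Qed.

(** ** The trap: configurations from which the human cannot win *)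

(** The strip selects one lift of the puppy for each human parameter, so the trapped positions over
    [h] are linearly ordered. *)
Definition trap (h p : R) : Prop := lmin h p /\ ~ Win h p /\ h < p < h + INR n.
Notation Trap := trap.

Lemma track_neq_strip h p : h < p < h + INR n -> tr h <> tr p.
Proof.
  intros Hp E. apply track_inj_near in E; [lra|].
  apply Rabs_def1; lra.
Qed.

Lemma track_self_shift h : tr (h + INR n) = tr h.
Proof.
  pose proof (track_period h 1) as E. now rewrite Rmult_1_l in E.
Qed.

(** If every way of settling were winning, the move would win. The surviving position stays in the
    strip: the branch cannot meet the human without a catch, and a run cannot pass [h1] or
    [h1 + INR n], where the distance is zero and therefore minimal. *)
Lemma trap_step h d b : tracks h d b -> trap h (b 0) ->
  (exists q1, settle (hpos h d 1) (b 1) q1) ->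
  exists q1, settle (hpos h d 1) (b 1) q1 /\ trap (hpos h d 1) q1.
Proof.
  intros Ht (Hm & Hw & Hstrip) Hex. apply NNPP. intros Hno. apply Hw.
  apply (win_tracks h d b Ht Hex). intros q1 Hq1.
  apply NNPP. intros Hnor. apply not_or_and in Hnor. destruct Hnor as [Hnc Hnw].
  assert (Hcat : forall t, 0 <= t < 1 -> tr (hpos h d t) <> tr (b t)).
  { intros t Htt E. apply Hnc. now exists t. }
  destruct Ht as (Hc & Hmin & _).
  assert (Hlip : forall c sg, lip (fun t => sg * (b t - hpos h d t) + c)).
  { intros c sg. apply lip_add; [|apply lip_const]. apply lip_scale.
    apply lip_add; [exact Hc|]. unfold hpos.
    assert (Hl : lip (fun t => -1 * (h + d * t))).
    { apply lip_scale, lip_add; [apply lip_const|apply lip_scale, lip_id]. }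
    destruct Hl as (C & HC & Hl). exists C. split; [exact HC|]. intros s t.
    now replace (- (h + s * d) - - (h + t * d)) with
      (-1 * (h + d * s) - -1 * (h + d * t)) by ring. }
  assert (Hin : forall t, 0 <= t < 1 -> hpos h d t < b t < hpos h d t + INR n).
  { intros t Htt. apply NNPP. intros Hout.
    assert (Hor : b t <= hpos h d t \/ hpos h d t + INR n <= b t) by lra.
    destruct Hor as [Hor|Hor].
    - destruct (ivt_zero (fun t => 1 * (b t - hpos h d t) + 0) 0 t) as (u & Hu & E);
        [lra|apply Hlip|unfold hpos; lra|lra|].
      apply (Hcat u ltac:(lra)). f_equal. lra.
    - destruct (ivt_zero (fun t => -1 * (b t - hpos h d t) + INR n) 0 t) as (u & Hu & E);
        [lra|apply Hlip|unfold hpos; lra|lra|].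
      apply (Hcat u ltac:(lra)).
      replace (b u) with (hpos h d u + INR n) by lra. now rewrite track_self_shift. }
  set (h1 := hpos h d 1) in *.
  assert (Hin1 : h1 <= b 1 <= h1 + INR n).
  { assert (Hlim : forall e, 0 < e -> exists t, 0 <= t < 1 /\
              Rabs (1 * (b t - hpos h d t) + 0 - (1 * (b 1 - h1) + 0)) < e).
    { intros e He. destruct (lip_near _ 1 e (Hlip 0 1) He) as (del & Hd & H1).
      destruct (small_step del 1) as [s [Hs1 Hs2]]; try lra.
      exists (1 - s). split; [lra|]. apply H1. rewrite Rabs_minus_sub; lra. }
    split; apply Rnot_lt_le; intros Hlt.
    - destruct (Hlim (h1 - b 1) ltac:(lra)) as (t & Ht1 & H1).
      specialize (Hin t Ht1). apply Rabs_bounds_lt in H1. lra.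
    - destruct (Hlim (b 1 - h1 - INR n) ltac:(lra)) as (t & Ht1 & H1).
      specialize (Hin t Ht1). apply Rabs_bounds_lt in H1. lra. }
  assert (Hclosed : h1 <= q1 <= h1 + INR n /\ lmin h1 q1).
  { destruct Hq1 as [[-> Hm1]|Hr]; [auto|].
    assert (Hm1 := Hr). apply run_cases in Hm1. destruct Hm1 as [_ Hm1].
    split; [|exact Hm1].
    assert (Hn1 : b 1 <> h1).
    { intros E. apply (run_not_min _ _ _ Hr). rewrite E. now apply caught_min. }
    assert (Hn2 : b 1 <> h1 + INR n).
    { intros E. apply (run_not_min _ _ _ Hr). rewrite E. apply caught_min, track_self_shift. }
    split; apply Rnot_lt_le; intros Hlt.
    - apply (run_no_ext _ _ _ h1 Hr); [right; lra|]. left. now apply caught_min.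
    - apply (run_no_ext _ _ _ (h1 + INR n) Hr); [left; lra|]. left.
      apply caught_min, track_self_shift. }
  destruct Hclosed as [Hcl Hm1].
  apply Hno. exists q1. split; [exact Hq1|]. split; [exact Hm1|]. split; [exact Hnw|].
  assert (Hn1 : q1 <> h1) by (intros ->; apply Hnw, hw_caught; reflexivity).
  assert (Hn2 : q1 <> h1 + INR n).
  { intros ->. apply Hnw, hw_caught. now rewrite track_self_shift. }
  lra.
Qed.

(** * Lebesgue numbers of coverings and continuity of the feet *)

Lemma lebesgue3 (P : R -> R -> R -> R -> Prop) a b a' b' a'' b'' :
  (forall r s t, a <= r <= b -> a' <= s <= b' -> a'' <= t <= b'' ->
     exists del, 0 < del /\ P r s t del) ->
  exists d, 0 < d /\ forall x y z, a <= x <= b -> a' <= y <= b' -> a'' <= z <= b'' ->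
    exists r s t del, a <= r <= b /\ a' <= s <= b' /\ a'' <= t <= b'' /\ d <= del /\
      Rabs (x - r) < del /\ Rabs (y - s) < del /\ Rabs (z - t) < del /\ P r s t del.
Proof.
  intros H.
  (* The radii are chosen as a function on the whole space, with the dummy value 1 outside the box.
     As [P] has the radius as an argument, local statements may be bounds in terms of it. *)
  assert (Hc : forall r s t, {del : posreal |
             a <= r <= b -> a' <= s <= b' -> a'' <= t <= b'' -> P r s t del}).
  { intros r s t. apply constructive_indefinite_description.
    destruct (classic (a <= r <= b /\ a' <= s <= b' /\ a'' <= t <= b'')) as [(Hr & Hs & Ht)|Ht].
    - destruct (H r s t Hr Hs Ht) as (del & Hd & HP). now exists (mkposreal del Hd).
    - exists (mkposreal 1 Rlt_0_1). tauto. }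
  destruct (compactness_value 3 (a, (a', (a'', tt))) (b, (b', (b'', tt)))
              (fun p => let '(r, (s, (t, _))) := p in proj1_sig (Hc r s t))) as [d Hd].
  exists d. split; [apply cond_pos|]. intros x y z Hx Hy Hz.
  specialize (Hd (x, (y, (z, tt)))). simpl in Hd.
  specialize (Hd (conj Hx (conj Hy (conj Hz I)))). apply NNPP in Hd.
  destruct Hd as ((r & s & t & []) & (H1 & H2 & H3 & _) & (H4 & H5 & H6 & _) & H7).
  exists r, s, t, (proj1_sig (Hc r s t)). repeat split; try tauto; try lra.
  now apply (proj2_sig (Hc r s t)).
Qed.

Lemma lebesgue2 (P : R -> R -> R -> Prop) a b a' b' :
  (forall s t, a <= s <= b -> a' <= t <= b' -> exists del, 0 < del /\ P s t del) ->
  exists d, 0 < d /\ forall x y, a <= x <= b -> a' <= y <= b' ->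
    exists s t del, a <= s <= b /\ a' <= t <= b' /\ d <= del /\
      Rabs (x - s) < del /\ Rabs (y - t) < del /\ P s t del.
Proof.
  intros H. destruct (lebesgue3 (fun s t _ del => P s t del) a b a' b' 0 0) as (d & Hd & Hc).
  - intros r s _ Hr Ht _. now apply H.
  - exists d. split; [exact Hd|]. intros x y Hx Hy.
    destruct (Hc x y 0 Hx Hy ltac:(lra)) as (s & t & _ & del & H1 & H2 & _ & H3 & H4 & H5 & _ & H6).
    exists s, t, del. tauto.
Qed.

Lemma lebesgue1 (P : R -> R -> Prop) a b :
  (forall t, a <= t <= b -> exists del, 0 < del /\ P t del) ->
  exists d, 0 < d /\ forall x, a <= x <= b ->
    exists t del, a <= t <= b /\ d <= del /\ Rabs (x - t) < del /\ P t del.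
Proof.
  intros H. destruct (lebesgue2 (fun t _ del => P t del) a b 0 0) as (d & Hd & Hc).
  - intros s _ Ht _. now apply H.
  - exists d. split; [exact Hd|]. intros x Hx.
    destruct (Hc x 0 Hx ltac:(lra)) as (t & _ & del & H1 & _ & H2 & H3 & _ & H4).
    exists t, del. tauto.
Qed.

Lemma Rmin3 a b c : 0 < a -> 0 < b -> 0 < c ->
  exists d, 0 < d /\ d <= a /\ d <= b /\ d <= c.
Proof.
  intros. exists (Rmin a (Rmin b c)).
  pose proof (Rmin_l a (Rmin b c)). pose proof (Rmin_r a (Rmin b c)).
  pose proof (Rmin_l b c). pose proof (Rmin_r b c).
  repeat split; try lra. repeat apply Rmin_glb_lt; lra.
Qed.

Lemma foot_lip k : lip (ft k).
Proof.
  destruct track_lip as [(C1 & HC1 & _ & H1) (C2 & HC2 & _ & H2)].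
  set (A1 := Rabs (fst (edge k) / sqlen k)).
  set (A2 := Rabs (snd (edge k) / sqlen k)).
  pose proof (Rabs_pos (fst (edge k) / sqlen k)) as HA1. fold A1 in HA1.
  pose proof (Rabs_pos (snd (edge k) / sqlen k)) as HA2. fold A2 in HA2.
  exists (C1 * A1 + C2 * A2).
  split; [apply Rplus_le_le_0_compat; apply Rmult_le_pos; assumption|]. intros s t.
  pose proof (sqlen_pos k) as HL.
  replace (ft k s - ft k t) with
    ((fst (tr s) - fst (tr t)) * (fst (edge k) / sqlen k) +
     (snd (tr s) - snd (tr t)) * (snd (edge k) / sqlen k)).
  2:{ unfold foot, dot, psub. cbn [fst snd]. field. lra. }
  eapply Rle_trans; [apply Rabs_triang|]. rewrite !Rabs_mult. fold A1 A2.
  specialize (H1 s t). specialize (H2 s t). cbv beta in H1, H2.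
  pose proof (Rabs_pos (s - t)).
  assert (Rabs (fst (tr s) - fst (tr t)) * A1 <= C1 * Rabs (s - t) * A1)
    by (apply Rmult_le_compat_r; lra).
  assert (Rabs (snd (tr s) - snd (tr t)) * A2 <= C2 * Rabs (s - t) * A2)
    by (apply Rmult_le_compat_r; lra).
  lra.
Qed.

Lemma foot_near k h0 eps : 0 < eps ->
  exists del, 0 < del /\ forall h, Rabs (h - h0) < del ->
    ft k h0 - eps < ft k h < ft k h0 + eps.
Proof.
  intros He. destruct (lip_near (ft k) h0 eps (foot_lip k) He) as (del & Hd & H).
  exists del. split; [exact Hd|]. intros h Hh. specialize (H h Hh).
  apply Rabs_bounds_lt in H. lra.
Qed.

Lemma ext_interior k h s : IZR k < s < IZR k + 1 -> lext h s -> ft k h = s.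
Proof.
  intros Hk [H|H]; [now apply min_interior|].
  exfalso. now apply (max_interior k h s).
Qed.

(** * Branches of extrema and the classification of configurations off the diagonal *)

Definition branch (h0 p0 : R) (b : R -> R) (del : R) : Prop :=
  0 < del /\ lip b /\ b h0 = p0 /\
  forall h, Rabs (h - h0) < del ->
    lext h (b h) /\ forall s, Rabs (s - p0) < del -> lext h s -> s = b h.

Definition min_branch (h0 p0 : R) (b : R -> R) (del : R) : Prop :=
  branch h0 p0 b del /\ forall h, Rabs (h - h0) < del -> lmin h (b h).

Lemma ext_near_vertex k h s : Rabs (s - IZR k) < 1 -> lext h s ->
  (s < IZR k /\ ft (k - 1) h = s) \/
  (s = IZR k /\ IZR k <= ft (k - 1) h /\ ft k h <= IZR k) \/
  (s = IZR k /\ ft (k - 1) h < IZR k /\ IZR k < ft k h) \/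
  (IZR k < s /\ ft k h = s).
Proof.
  intros Hk He. apply Rabs_bounds_lt in Hk. pose proof (IZR_pred k) as Ek.
  destruct (Rtotal_order s (IZR k)) as [Hlt|[->|Hgt]].
  - left. split; [exact Hlt|]. apply ext_interior; [lra|exact He].
  - destruct He as [He|He]; [apply min_vertex in He|apply max_vertex in He]; tauto.
  - right; right; right. split; [exact Hgt|]. apply ext_interior; [lra|exact He].
Qed.

Lemma track_vertex_neq h0 k : tr h0 <> tr (IZR k) -> tr h0 <> vx k.
Proof. now rewrite track_vertex. Qed.

Lemma min_branch_exists h0 p0 : lmin h0 p0 -> tr h0 <> tr p0 ->
  exists b del, min_branch h0 p0 b del.
Proof.
  intros Hm Hne. destruct (interior_or_vertex p0) as [[k Hk]|[k ->]].
  - assert (E : ft k h0 = p0) by (now apply min_interior).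
    set (r := Rmin (p0 - IZR k) (IZR k + 1 - p0)).
    assert (Hr0 : 0 < r) by (apply Rmin_glb_lt; lra).
    assert (Hr1 : r <= p0 - IZR k) by apply Rmin_l.
    assert (Hr2 : r <= IZR k + 1 - p0) by apply Rmin_r.
    destruct (foot_near k h0 r Hr0) as (d & Hd & Hf).
    exists (ft k), (Rmin d r).
    pose proof (Rmin_l d r). pose proof (Rmin_r d r).
    assert (Hmin : forall h, Rabs (h - h0) < Rmin d r -> lmin h (ft k h)).
    { intros h Hh. specialize (Hf h ltac:(lra)).
      apply (min_interior k); [lra|reflexivity]. }
    split; [|exact Hmin].
    split; [now apply Rmin_glb_lt|]. split; [apply foot_lip|]. split; [exact E|].
    intros h Hh. split; [left; now apply Hmin|]. intros s Hsp He.
    symmetry. apply (ext_interior k); [|exact He].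
    apply Rabs_bounds_lt in Hsp. lra.
  - apply min_vertex in Hm. destruct Hm as [Ha Hb].
    apply track_vertex_neq in Hne.
    pose proof (IZR_pred k) as Ek.
    set (al := fun h => ft (k - 1) h - IZR k). set (be := fun h => ft k h - IZR k).
    assert (Hex : exists d, 0 < d /\ forall h, Rabs (h - h0) < d ->
               -1 < al h /\ be h < 1 /\ ~ (al h < 0 /\ 0 < be h)).
    { destruct (foot_near (k - 1) h0 1 Rlt_0_1) as (d1 & Hd1 & H1).
      destruct (foot_near k h0 1 Rlt_0_1) as (d2 & Hd2 & H2).
      (* The excluded signs are those of a local maximum at the vertex. If both feet are at the
         vertex over [h0], only [feet_parallel] keeps them from separating in this way. *)
      assert (Hc : exists d3, 0 < d3 /\ forall h, Rabs (h - h0) < d3 ->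
                 ~ (al h < 0 /\ 0 < be h)).
      { destruct Ha as [Ha|Ha].
        - destruct (foot_near (k - 1) h0 (ft (k - 1) h0 - IZR k)) as (d3 & Hd3 & H3); [lra|].
          exists d3. split; [exact Hd3|]. intros h Hh. specialize (H3 h Hh).
          unfold al. lra.
        - destruct Hb as [Hb|Hb].
          + destruct (foot_near k h0 (IZR k - ft k h0)) as (d3 & Hd3 & H3); [lra|].
            exists d3. split; [exact Hd3|]. intros h Hh. specialize (H3 h Hh).
            unfold be. lra.
          + destruct (feet_parallel k h0) as (c & Hc & Hpar); auto.
            exists 1. split; [lra|]. intros h _. unfold al, be. rewrite Hpar.
            intros [H H']. nra. }
      destruct Hc as (d3 & Hd3 & H3).
      destruct (Rmin3 d1 d2 d3 Hd1 Hd2 Hd3) as (d & Hd & L1 & L2 & L3).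
      exists d. split; [exact Hd|]. intros h Hh.
      specialize (H1 h ltac:(lra)). specialize (H2 h ltac:(lra)).
      specialize (H3 h ltac:(lra)). unfold al, be in *. repeat split; lra. }
    destruct Hex as (d & Hd & Hex).
    (* The left foot while it is before the vertex, the right foot once it is past it, and the
       vertex otherwise; near [h0] at most one of the two terms is nonzero. *)
    exists (fun h => IZR k + (Rmin (al h) 0 + Rmax (be h) 0)), (Rmin d 1).
    pose proof (Rmin_l d 1). pose proof (Rmin_r d 1).
    assert (Hval : forall h, Rabs (h - h0) < Rmin d 1 ->
       (al h < 0 /\ be h <= 0 /\ IZR k + (Rmin (al h) 0 + Rmax (be h) 0) = ft (k - 1) h) \/
       (0 <= al h /\ be h <= 0 /\ IZR k + (Rmin (al h) 0 + Rmax (be h) 0) = IZR k) \/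
       (0 <= al h /\ 0 < be h /\ IZR k + (Rmin (al h) 0 + Rmax (be h) 0) = ft k h)).
    { intros h Hh. specialize (Hex h ltac:(lra)). destruct Hex as (H1 & H2 & H3).
      destruct (Rlt_dec (al h) 0) as [Hal|Hal], (Rlt_dec 0 (be h)) as [Hbe|Hbe].
      - tauto.
      - left. rewrite Rmin_left, Rmax_right by lra. unfold al in *. lra.
      - right; right. rewrite Rmin_right, Rmax_left by lra. unfold be in *. lra.
      - right; left. rewrite Rmin_right, Rmax_right by lra. lra. }
    assert (Hmin : forall h, Rabs (h - h0) < Rmin d 1 ->
               lmin h (IZR k + (Rmin (al h) 0 + Rmax (be h) 0))).
    { intros h Hh. specialize (Hex h ltac:(lra)).
      destruct (Hval h Hh) as [(H1 & H2 & ->)|[(H1 & H2 & ->)|(H1 & H2 & ->)]];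
        unfold al, be in *.
      - apply (min_interior (k - 1)); [lra|reflexivity].
      - apply min_vertex. lra.
      - apply (min_interior k); [lra|reflexivity]. }
    split; [|exact Hmin].
    split; [apply Rmin_glb_lt; lra|]. split; [|split].
    + destruct (foot_lip (k - 1)) as (C1 & HC1 & H1).
      destruct (foot_lip k) as (C2 & HC2 & H2).
      exists (C1 + C2). split; [lra|]. intros s t. specialize (H1 s t). specialize (H2 s t).
      assert (HA : Rabs (Rmin (al s) 0 - Rmin (al t) 0) <= Rabs (ft (k - 1) s - ft (k - 1) t)).
      { unfold al, Rmin, Rabs.
        destruct (Rle_dec (ft (k - 1) s - IZR k) 0), (Rle_dec (ft (k - 1) t - IZR k) 0);
        repeat destruct (Rcase_abs _); lra. }
      assert (HB : Rabs (Rmax (be s) 0 - Rmax (be t) 0) <= Rabs (ft k s - ft k t)).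
      { unfold be, Rmax, Rabs.
        destruct (Rle_dec (ft k s - IZR k) 0), (Rle_dec (ft k t - IZR k) 0);
        repeat destruct (Rcase_abs _); lra. }
      replace (IZR k + (Rmin (al s) 0 + Rmax (be s) 0) - (IZR k + (Rmin (al t) 0 + Rmax (be t) 0)))
        with ((Rmin (al s) 0 - Rmin (al t) 0) + (Rmax (be s) 0 - Rmax (be t) 0)) by ring.
      eapply Rle_trans; [apply Rabs_triang|]. lra.
    + unfold al, be. rewrite Rmin_right, Rmax_right by lra. ring.
    + intros h Hh. split; [left; now apply Hmin|]. intros s Hsp He.
      destruct (ext_near_vertex k h s ltac:(lra) He) as [K|[K|[K|K]]];
        destruct (Hval h Hh) as [(H1 & H2 & ->)|[(H1 & H2 & ->)|(H1 & H2 & ->)]];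
        unfold al, be in *; lra.
Qed.

(** Local maxima occur only at vertices, so their branches are constant. *)
Definition max_branch (h0 p0 del : R) : Prop :=
  branch h0 p0 (fun _ => p0) del /\ forall h, Rabs (h - h0) < del -> lmax h p0.

Lemma min_not_max h p : lmin h p -> ~ lmax h p.
Proof.
  intros Hm HM. destruct (interior_or_vertex p) as [[k Hk]|[k ->]].
  - now apply (max_interior k h p).
  - apply min_vertex in Hm. apply max_vertex in HM. lra.
Qed.

Lemma max_branch_exists h0 p0 : lmax h0 p0 -> exists del, max_branch h0 p0 del.
Proof.
  intros Hm. destruct (interior_or_vertex p0) as [[k Hk]|[k ->]].
  { exfalso. now apply (max_interior k h0 p0). }
  pose proof (IZR_pred k) as Ek.
  apply max_vertex in Hm. destruct Hm as [Ha Hb].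
  destruct (foot_near (k - 1) h0 ((IZR k - ft (k - 1) h0) / 2)) as (d1 & Hd1 & H1); [lra|].
  destruct (foot_near k h0 ((ft k h0 - IZR k) / 2)) as (d2 & Hd2 & H2); [lra|].
  destruct (Rmin3 ((IZR k - ft (k - 1) h0) / 2) ((ft k h0 - IZR k) / 2) 1)
    as (d3 & Hd3 & L1 & L2 & L3); try lra.
  destruct (Rmin3 d1 d2 d3 Hd1 Hd2 Hd3) as (d & Hd & M1 & M2 & M3).
  exists d. split.
  2:{ intros h Hh. specialize (H1 h ltac:(lra)). specialize (H2 h ltac:(lra)).
      apply max_vertex. lra. }
  split; [exact Hd|]. split; [|split; [reflexivity|]].
  - exists 0. split; [lra|]. intros s t.
    replace (IZR k - IZR k) with 0 by ring. rewrite Rabs_R0. lra.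
  - intros h Hh. specialize (H1 h ltac:(lra)). specialize (H2 h ltac:(lra)).
    split; [right; apply max_vertex; lra|].
    intros s Hsp He.
    destruct (ext_near_vertex k h s ltac:(lra) He) as [K|[K|[K|K]]];
      apply Rabs_bounds_lt in Hsp; lra.
Qed.

Definition regular (h0 p0 del : R) : Prop :=
  0 < del /\ forall h s, Rabs (h - h0) < del -> Rabs (s - p0) < del -> ~ lext h s.

(* On one side of [h0] (the side given by [tau]) the local minimum [g h] lies
   beside the local maximum [p0] (on the side given by [sg]); they merge at [h0]. *)
Definition pivot (h0 p0 : R) (sg tau : R) (g : R -> R) (del : R) : Prop :=
  (sg = 1 \/ sg = -1) /\ (tau = 1 \/ tau = -1) /\ 0 < del /\ lip g /\ g h0 = p0 /\
  (forall h, Rabs (h - h0) < del -> 0 < tau * (h - h0) ->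
     0 < sg * (g h - p0) /\ lmin h (g h) /\ lmax h p0 /\
     (forall s, 0 < sg * (s - p0) < sg * (g h - p0) -> ~ lext h s) /\
     exists e, 0 < e /\ forall h' s, Rabs (s - g h) < e -> lmin h' s -> s = g h') /\
  (forall h s, Rabs (h - h0) < del -> Rabs (s - p0) < del -> lext h s ->
     0 < tau * (h - h0) /\ (s = g h \/ s = p0)) /\
  (exists r, run h0 p0 r) /\ (forall r, run h0 p0 r -> sg * (r - p0) < 0).

Lemma regular_at_vertex h0 k : tr h0 <> vx k ->
  ft (k - 1) h0 < IZR k /\ ft k h0 < IZR k \/ IZR k < ft (k - 1) h0 /\ IZR k < ft k h0 ->
  exists del, regular h0 (IZR k) del.
Proof.
  intros Hne Hcase.
  destruct (Rmin3 1 (Rabs (IZR k - ft (k - 1) h0) / 2) (Rabs (ft k h0 - IZR k) / 2))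
    as (d0 & Hd0 & M0 & M1 & M2); try lra.
  1,2: assert (forall x, x <> 0 -> 0 < Rabs x / 2) as Habs
         by (intros x Hx; apply Rabs_pos_lt in Hx; lra); apply Habs; lra.
  destruct (foot_near (k - 1) h0 d0 Hd0) as (d1 & Hd1 & H1).
  destruct (foot_near k h0 d0 Hd0) as (d2 & Hd2 & H2).
  destruct (Rmin3 d0 d1 d2 Hd0 Hd1 Hd2) as (d & Hd & L0 & L1 & L2).
  exists d. split; [exact Hd|]. intros h s Hh Hsp He.
  specialize (H1 h ltac:(lra)). specialize (H2 h ltac:(lra)).
  destruct (ext_near_vertex k h s ltac:(lra) He) as [K|[K|[K|K]]];
    apply Rabs_bounds_lt in Hsp; destruct Hcase as [[A B]|[A B]];
    first [rewrite Rabs_right in M1 by lra|rewrite Rabs_left in M1 by lra];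
    first [rewrite Rabs_right in M2 by lra|rewrite Rabs_left in M2 by lra]; lra.
Qed.

(* The foot on edge [j] reaches the vertex [k] while the other edge [o] at [k]
   leads downhill. *)
Lemma pivot_at_vertex h0 k j o sg : tr h0 <> vx k ->
  (j = (k - 1)%Z /\ o = k /\ sg = -1 \/ j = k /\ o = (k - 1)%Z /\ sg = 1) ->
  ft j h0 = IZR k -> 0 < sg * (IZR k - ft o h0) ->
  exists tau del, pivot h0 (IZR k) sg tau (ft j) del.
Proof.
  intros Hne Hcase E Ho. pose proof (IZR_pred k) as Ek.
  destruct (foot_cross j k h0) as (c & d1 & Hc & Hd1 & H1); [lia || tauto|exact E|exact Hne|].
  (* [tau] is the sign of [sg * c]: it tells on which side of [h0] the foot has entered the interior
     of edge [j]. *)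
  assert (Htau : exists tau, (tau = 1 \/ tau = -1) /\
             forall x, 0 < sg * (c * x) <-> 0 < tau * x).
  { destruct (Rlt_dec 0 (sg * c)); [exists 1|exists (-1)]; (split; [auto|]);
      intros x; destruct Hcase as [(_ & _ & ->)|(_ & _ & ->)]; split; intros; nra. }
  destruct Htau as (tau & Htau & Hsgn).
  set (g := sg * (IZR k - ft o h0) / 2) in *. assert (Hg : 0 < g) by (unfold g; lra).
  destruct (foot_near o h0 g Hg) as (d2 & Hd2 & H2).
  destruct (foot_near j h0 1 Rlt_0_1) as (d3 & Hd3 & H3).
  destruct (Rmin3 1 g d3) as (d4 & Hd4 & M1 & M2 & M3); try lra.
  destruct (Rmin3 d1 d2 d4) as (d & Hd & L1 & L2 & L3); try lra.
  exists tau, d. unfold pivot.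
  split; [tauto|]. split; [exact Htau|]. split; [exact Hd|].
  split; [apply foot_lip|]. split; [exact E|]. split; [|split; [|split]].
  - intros h Hh Hside. specialize (H1 h ltac:(lra)).
    specialize (H2 h ltac:(lra)). specialize (H3 h ltac:(lra)).
    apply Hsgn in Hside. rewrite <- H1 in Hside.
    assert (Hint : IZR j < ft j h < IZR j + 1)
      by (destruct Hcase as [(-> & _ & ->)|(-> & _ & ->)]; lra).
    split; [exact Hside|]. split; [now apply (min_interior j)|].
    split; [|split].
    + apply max_vertex. unfold g in *.
      destruct Hcase as [(-> & -> & ->)|(-> & -> & ->)]; lra.
    + intros s Hsp He.
      assert (ft j h = s); [|subst s; lra].
      apply ext_interior; [|exact He].
      destruct Hcase as [(-> & _ & ->)|(-> & _ & ->)]; lra.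
    + exists (Rmin (ft j h - IZR j) (IZR j + 1 - ft j h)).
      split; [apply Rmin_glb_lt; lra|]. intros h' s Hsp Hm.
      apply Rmin_Rgt_l in Hsp. destruct Hsp as [G1 G2].
      apply Rabs_bounds_lt in G1, G2. symmetry. apply ext_interior; [lra|now left].
  - intros h s Hh Hsp He. specialize (H1 h ltac:(lra)).
    specialize (H2 h ltac:(lra)). rewrite <- Hsgn, <- H1. unfold g in *.
    destruct (ext_near_vertex k h s ltac:(lra) He) as [K|[K|[K|K]]];
      apply Rabs_bounds_lt in Hsp;
      destruct Hcase as [(-> & -> & ->)|(-> & -> & ->)];
      first [exfalso; lra|split; [lra|left; lra]|split; [lra|right; lra]].
  - destruct Hcase as [(-> & -> & ->)|(-> & -> & ->)];
      [destruct (run_up_exists h0 k) as (r & R1 & R2 & R3)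
      |destruct (run_down_exists h0 k) as (r & R1 & R2 & R3)];
      try lra; exists r; apply run_cases; auto.
  - intros r Hrun. apply run_cases in Hrun.
    destruct Hcase as [(-> & -> & ->)|(-> & -> & ->)];
      destruct Hrun as [[[R1 R2]|[R1 R2]] _]; try lra; exfalso.
    + destruct (small_step 1 (IZR k - r)) as [x [X1 X2]]; try lra.
      specialize (R2 (IZR k - x) (IZR k) ltac:(lra) ltac:(lra) ltac:(lra)).
      pose proof (sqd_dec (k - 1) h0 (IZR k - x) (IZR k)). lra.
    + destruct (small_step 1 (r - IZR k)) as [x [X1 X2]]; try lra.
      specialize (R2 (IZR k) (IZR k + x) ltac:(lra) ltac:(lra) ltac:(lra)).
      pose proof (sqd_inc k h0 (IZR k) (IZR k + x)). lra.
Qed.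

(** Of the nine positions of the two feet relative to a vertex, four give a minimum, one a maximum
    and two no extremum nearby. In the remaining two, the pivots, one foot is at the vertex and the
    other edge leads downhill. *)
Lemma classify h0 p0 : tr h0 <> tr p0 ->
  lmin h0 p0 \/ lmax h0 p0 \/ (exists del, regular h0 p0 del) \/
  exists sg tau g del, pivot h0 p0 sg tau g del.
Proof.
  intros Hne. destruct (interior_or_vertex p0) as [[k Hk]|[k ->]].
  - destruct (Req_dec (ft k h0) p0) as [E|E].
    + left. now apply (min_interior k).
    + right; right; left.
      set (r := Rmin (p0 - IZR k) (IZR k + 1 - p0)).
      assert (Hr1 : r <= p0 - IZR k) by apply Rmin_l.
      assert (Hr2 : r <= IZR k + 1 - p0) by apply Rmin_r.
      assert (Hr0 : 0 < r) by (apply Rmin_glb_lt; lra).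
      assert (Hab : 0 < Rabs (ft k h0 - p0) / 2).
      { assert (0 < Rabs (ft k h0 - p0)) by (apply Rabs_pos_lt; lra). lra. }
      destruct (lip_near (ft k) h0 _ (foot_lip k) Hab) as (d & Hd & Hf).
      destruct (Rmin3 r d _ Hr0 Hd Hab) as (del & Hdel & L1 & L2 & L3).
      exists del. split; [exact Hdel|]. intros h s Hh Hsp He.
      assert (Es : ft k h = s).
      { apply ext_interior; [|exact He]. apply Rabs_bounds_lt in Hsp. lra. }
      specialize (Hf h ltac:(lra)). rewrite Es in Hf.
      pose proof (Rabs_triang (ft k h0 - s) (s - p0)) as Ht.
      rewrite (Rabs_minus_sym (ft k h0) s) in Ht.
      replace (ft k h0 - s + (s - p0)) with (ft k h0 - p0) in Ht by ring. lra.
  - apply track_vertex_neq in Hne.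
    destruct (Rtotal_order (ft (k - 1) h0) (IZR k)) as [Ha|[Ha|Ha]];
    destruct (Rtotal_order (ft k h0) (IZR k)) as [Hb|[Hb|Hb]];
    try (left; apply min_vertex; lra).
    + right; right; left. apply regular_at_vertex; auto.
    + right; right; right. exists 1.
      destruct (pivot_at_vertex h0 k k (k - 1) 1) as (tau & del & H); auto; [lra|].
      now exists tau, (ft k), del.
    + right; left. apply max_vertex. lra.
    + right; right; right. exists (-1).
      destruct (pivot_at_vertex h0 k (k - 1) k (-1)) as (tau & del & H); auto; [lra|].
      now exists tau, (ft (k - 1)), del.
    + right; right; left. apply regular_at_vertex; auto.
Qed.

(** ** Moving along branches *)

Lemma tracks_branch h d b : lip b ->
  (forall t, 0 <= t < 1 -> lmin (hpos h d t) (b (hpos h d t))) ->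
  (forall t, 0 <= t < 1 -> exists e, 0 < e /\ forall h' s,
     Rabs (h' - hpos h d t) < e -> Rabs (s - b (hpos h d t)) < e ->
     lmin h' s -> s = b h') ->
  tracks h d (fun t => b (hpos h d t)).
Proof.
  intros Hl Hm Hi.
  assert (Hd0 : 0 < Rabs d + 1) by (pose proof (Rabs_pos d); lra).
  assert (Hclose : forall t u e, 0 < e -> Rabs (u - t) < e / (Rabs d + 1) ->
             Rabs (hpos h d u - hpos h d t) < e).
  { intros t u e He Hu.
    replace (hpos h d u - hpos h d t) with (d * (u - t)) by (unfold hpos; ring).
    rewrite Rabs_mult. apply Rle_lt_trans with ((Rabs d + 1) * Rabs (u - t)).
    - pose proof (Rabs_pos (u - t)). nra.
    - apply Rlt_le_trans with ((Rabs d + 1) * (e / (Rabs d + 1))).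
      + apply Rmult_lt_compat_l; lra.
      + right. field. lra. }
  split; [|split; [exact Hm|]].
  - apply lip_comp; [exact Hl|]. unfold hpos. destruct (lip_scale d _ lip_id) as (C & HC & H).
    exists C. split; [exact HC|]. intros s t.
    now replace (h + s * d - (h + t * d)) with (d * s - d * t) by ring.
  - intros t Ht. destruct (Hi t Ht) as (e & He & H).
    assert (Hq : 0 < e / (Rabs d + 1)) by (apply Rdiv_lt_0_compat; lra).
    exists (Rmin e (e / (Rabs d + 1))). split; [now apply Rmin_glb_lt|].
    pose proof (Rmin_l e (e / (Rabs d + 1))). pose proof (Rmin_r e (e / (Rabs d + 1))).
    intros u s Hu Hsp Hms. apply H; [|lra|exact Hms].
    apply Hclose; [exact He|]. rewrite Rabs_right; lra.
Qed.

Lemma hpos_0 h d : hpos h d 0 = h.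
Proof. unfold hpos. ring. Qed.

Lemma hpos_to h h1 : hpos h (h1 - h) 1 = h1.
Proof. unfold hpos. ring. Qed.

Lemma hpos_between h h1 t : 0 <= t <= 1 ->
  h <= hpos h (h1 - h) t <= h1 \/ h1 <= hpos h (h1 - h) t <= h.
Proof.
  intros Ht. unfold hpos. destruct (Rle_dec h h1); [left|right]; nra.
Qed.

Lemma settle_min h p q : lmin h p -> settle h p q -> q = p.
Proof.
  intros Hm [[E _]|H]; [exact E|]. exfalso. now apply (run_not_min h p q).
Qed.

(** The human can walk either way along an isolated branch of minima, and at the end the puppy has
    only one way to settle; so [trap_step] transports the trap in both directions. *)
Lemma trap_branch h0 p0 b del : min_branch h0 p0 b del ->
  exists e, 0 < e /\ forall h, Rabs (h - h0) < e -> (Trap h (b h) <-> Trap h0 p0).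
Proof.
  intros [(Hdel & Hl & Hb0 & Hb) Hm].
  destruct (lip_near b h0 (del / 2) Hl ltac:(lra)) as (d1 & Hd1 & H1).
  exists (Rmin d1 (del / 2)). split; [apply Rmin_glb_lt; lra|].
  pose proof (Rmin_l d1 (del / 2)) as L1. pose proof (Rmin_r d1 (del / 2)) as L2.
  set (e := Rmin d1 (del / 2)) in *.
  assert (Hmove : forall h h1, Rabs (h - h0) < e -> Rabs (h1 - h0) < e ->
             Trap h (b h) -> Trap h1 (b h1)).
  { intros h h1 Hh Hh1 HT.
    assert (Hpath : forall t, 0 <= t <= 1 -> Rabs (hpos h (h1 - h) t - h0) < e).
    { intros t Ht. destruct (hpos_between h h1 t Ht);
        apply Rabs_bounds_lt in Hh, Hh1; apply Rabs_def1; lra. }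
    destruct (trap_step h (h1 - h) (fun t => b (hpos h (h1 - h) t)))
      as (q1 & Hq & HT1).
    - apply tracks_branch; [exact Hl| |].
      + intros t Ht. apply Hm. specialize (Hpath t ltac:(lra)). lra.
      + intros t Ht. specialize (Hpath t ltac:(lra)).
        exists (del / 2). split; [lra|]. intros h' s Hh' Hsp Hms.
        destruct (Hb h') as [_ Hu].
        * pose proof (Rabs_triang (h' - hpos h (h1 - h) t) (hpos h (h1 - h) t - h0)) as Htr.
          replace (h' - hpos h (h1 - h) t + (hpos h (h1 - h) t - h0)) with (h' - h0)
            in Htr by ring. lra.
        * apply Hu; [|now left].
          specialize (H1 (hpos h (h1 - h) t) ltac:(lra)). rewrite Hb0 in H1.
          pose proof (Rabs_triang (s - b (hpos h (h1 - h) t)) (b (hpos h (h1 - h) t) - p0)) as Htr.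
          replace (s - b (hpos h (h1 - h) t) + (b (hpos h (h1 - h) t) - p0)) with (s - p0)
            in Htr by ring. lra.
    - now rewrite hpos_0.
    - exists (b h1). left. rewrite hpos_to. split; [reflexivity|].
      apply Hm. lra.
    - rewrite hpos_to in *. apply settle_min in Hq; [now subst q1|].
      apply Hm. lra. }
  intros h Hh. rewrite <- Hb0. assert (H00 : Rabs (h0 - h0) < e).
  { rewrite Rminus_diag, Rabs_R0. unfold e. apply Rmin_glb_lt; lra. }
  split; intros HT; eapply Hmove; eauto.
Qed.

(** Walking to the merging point destroys the minimum exactly at time 1; the puppy must run, and one
    of its runs ends trapped. *)
Lemma trap_pivot h0 p0 sg tau g del : pivot h0 p0 sg tau g del ->
  forall h, Rabs (h - h0) < del -> 0 < tau * (h - h0) -> Trap h (g h) ->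
  exists r, run h0 p0 r /\ Trap h0 r.
Proof.
  intros (Hsg & Htau & Hdel & Hl & Hg0 & Hside & Hnear & [r Hr0] & Hrs) h Hh Ht HT.
  destruct (trap_step h (h0 - h) (fun t => g (hpos h (h0 - h) t)))
    as (q1 & Hq & HT1).
  - assert (Hpath : forall t, 0 <= t < 1 -> Rabs (hpos h (h0 - h) t - h0) < del /\
                     0 < tau * (hpos h (h0 - h) t - h0)).
    { intros t Ht1.
      replace (hpos h (h0 - h) t - h0) with ((1 - t) * (h - h0)) by (unfold hpos; ring).
      split.
      - rewrite Rabs_mult, (Rabs_right (1 - t)) by lra.
        pose proof (Rabs_pos (h - h0)). nra.
      - replace (tau * ((1 - t) * (h - h0))) with ((1 - t) * (tau * (h - h0))) by ring.
        apply Rmult_lt_0_compat; lra. }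
    apply tracks_branch; [exact Hl| |].
    + intros t Ht1. destruct (Hpath t Ht1) as [P1 P2].
      now destruct (Hside _ P1 P2) as (_ & Hm & _).
    + intros t Ht1. destruct (Hpath t Ht1) as [P1 P2].
      destruct (Hside _ P1 P2) as (_ & _ & _ & _ & e & He & H).
      exists e. split; [exact He|]. intros h' s _ Hsp Hms. now apply H.
  - now rewrite hpos_0.
  - exists r. right. rewrite hpos_to, Hg0. exact Hr0.
  - rewrite hpos_to, Hg0 in *. destruct Hq as [[E Hmq]|Hq]; [exfalso|now exists q1].
    apply (run_not_min h0 p0 r Hr0 Hmq).
Qed.

(** ** Near the diagonal the human wins *)

(** On the human's own edge the only minimum is her position. If the puppy is on the other edge of a
    nearby vertex, it sits at the foot there; this foot is affine in her position and reaches the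
    vertex when she does, so she walks to the vertex. *)
Lemma diagonal_win h0 : exists del, 0 < del /\ forall h p,
  Rabs (h - h0) < del -> Rabs (p - h0) < del -> lmin h p -> Win h p.
Proof.
  assert (Hsame : forall k h p, IZR k <= h <= IZR k + 1 -> IZR k < p < IZR k + 1 ->
             lmin h p -> Win h p).
  { intros k h p Hh Hp Hm. apply hw_caught. f_equal.
    apply (min_interior k) in Hm; [|exact Hp].
    rewrite <- Hm. symmetry. now apply foot_self. }
  destruct (interior_or_vertex h0) as [[k Hk]|[k ->]].
  - exists (Rmin (h0 - IZR k) (IZR k + 1 - h0)). split; [apply Rmin_glb_lt; lra|].
    intros h p Hh Hp Hm. apply Rmin_Rgt_l in Hh, Hp.
    destruct Hh as [H1 H2], Hp as [H3 H4]. apply Rabs_bounds_lt in H1, H2, H3, H4.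
    apply (Hsame k); [lra|lra|exact Hm].
  - exists 1. split; [lra|]. intros h p Hh Hp Hm. apply Rabs_bounds_lt in Hh, Hp.
    pose proof (IZR_pred k) as Ek.
    assert (Hmeet : forall j i, (j = k - 1 \/ j = k)%Z -> (i = k - 1 \/ i = k)%Z ->
              IZR j < p < IZR j + 1 -> IZR i <= h <= IZR i + 1 -> h <> IZR k -> Win h p).
    { intros j i Hj Hi Hpj Hhi Eh.
      assert (Ej : ft j (IZR k) = IZR k) by (apply foot_self; destruct Hj; subst j; lra).
      assert (Hb0 : ft j h = p) by (now apply (min_interior j)).
      assert (Haff : forall t, 0 <= t <= 1 ->
                ft j (hpos h (IZR k - h) t) - IZR k = (1 - t) * (p - IZR k)).
      { intros t Ht.
        assert (Hik : IZR i <= IZR k <= IZR i + 1) by (destruct Hi; subst i; lra).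
        assert (Hx : IZR i <= hpos h (IZR k - h) t <= IZR i + 1)
          by (destruct (hpos_between h (IZR k) t Ht); lra).
        pose proof (foot_affine j i _ _ Hx Hik) as A1. pose proof (foot_affine j i _ _ Hhi Hik) as A2.
        rewrite Ej in A1, A2. rewrite Hb0 in A2. rewrite A1, A2. unfold hpos. ring. }
      assert (Hint : forall t, 0 <= t < 1 ->
                IZR j < ft j (hpos h (IZR k - h) t) < IZR j + 1).
      { intros t Ht. specialize (Haff t ltac:(lra)). destruct Hj as [-> | ->]; nra. }
      replace p with ((fun t => ft j (hpos h (IZR k - h) t)) 0)
        by (rewrite hpos_0; exact Hb0).
      apply (win_tracks h (IZR k - h) (fun t => ft j (hpos h (IZR k - h) t))).
      - apply tracks_branch; [apply foot_lip| |].
        + intros t Ht. apply (min_interior j); [now apply Hint|reflexivity].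
        + intros t Ht. specialize (Hint t Ht).
          set (y := ft j (hpos h (IZR k - h) t)) in *.
          exists (Rmin (y - IZR j) (IZR j + 1 - y)). split; [apply Rmin_glb_lt; lra|].
          intros h' s _ Hsp Hms. apply Rmin_Rgt_l in Hsp. destruct Hsp as [G1 G2].
          apply Rabs_bounds_lt in G1, G2. symmetry. apply ext_interior; [lra|now left].
      - exists (IZR k). left. rewrite hpos_to, Ej. split; [reflexivity|].
        now apply caught_min.
      - intros q1 Hq. right. rewrite hpos_to in *. rewrite Ej in Hq.
        apply settle_min in Hq; [|now apply caught_min]. subst q1. now apply hw_caught. }
    destruct (Rtotal_order p (IZR k)) as [Hlt|[Heq|Hgt]].
    + destruct (Rle_dec h (IZR k)) as [Hhk|Hhk].
      { apply (Hsame (k - 1)%Z); [lra|lra|exact Hm]. }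
      apply (Hmeet (k - 1)%Z k); auto; lra.
    + apply hw_caught. f_equal. subst p. apply min_vertex in Hm.
      destruct (Rle_dec h (IZR k)) as [Hhk|Hhk].
      * rewrite (foot_self (k - 1) h) in Hm by lra. lra.
      * rewrite (foot_self k h) in Hm by lra. lra.
    + destruct (Rle_dec (IZR k) h) as [Hhk|Hhk].
      { apply (Hsame k); [lra|lra|exact Hm]. }
      apply (Hmeet k (k - 1)%Z); auto; lra.
Qed.

Lemma min_shift c h p : lmin h p -> lmin (h + IZR c * INR n) p.
Proof.
  intros (e & He & H). exists e. split; [exact He|]. intros u Hu.
  specialize (H u Hu). unfold pdist in *. now rewrite track_period.
Qed.

Lemma near_caught_win h0 p0 : tr h0 = tr p0 -> exists del, 0 < del /\ forall h p,
  Rabs (h - h0) < del -> Rabs (p - p0) < del -> lmin h p -> Win h p.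
Proof.
  intros E. symmetry in E. apply track_inj in E. destruct E as [c ->].
  destruct (diagonal_win (h0 + IZR c * INR n)) as (del & Hd & H).
  exists del. split; [exact Hd|]. intros h p Hh Hp Hm.
  replace h with (h + IZR c * INR n + IZR (- c) * INR n) by (rewrite opp_IZR; ring).
  apply win_shift. apply H; [|exact Hp|now apply min_shift].
  now replace (h + IZR c * INR n - (h0 + IZR c * INR n)) with (h - h0) by ring.
Qed.

(** ** Where trapped configurations at a nearby position come from *)

(** [p1] is the configuration of which the trapped one is a perturbation: a minimum, then trapped
    itself, or a pivot, from which [trap_pivot] gives a run into the trap. Nothing trapped is near
    the diagonal, a maximum or a regular configuration. *)
Lemma trap_back h0 eta : 0 < eta -> exists d, 0 < d /\ forall h t',
  Rabs (h - h0) < d -> Trap h t' ->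
  exists p1 t, Rabs (t' - p1) < eta /\ Trap h0 t /\ (t = p1 \/ run h0 p1 t).
Proof.
  intros Heta.
  destruct (lebesgue1 (fun p1 del => forall h t', Rabs (h - h0) < del ->
              Rabs (t' - p1) < del -> Trap h t' -> Rabs (t' - p1) < eta /\
              exists t, Trap h0 t /\ (t = p1 \/ run h0 p1 t))
              (h0 - 1) (h0 + INR n + 1)) as (d & Hd & H).
  - intros p1 _.
    assert (Hcl : exists del, 0 < del /\ forall h t', Rabs (h - h0) < del ->
              Rabs (t' - p1) < del -> Trap h t' ->
              exists t, Trap h0 t /\ (t = p1 \/ run h0 p1 t)).
    { destruct (classic (tr h0 = tr p1)) as [E|E].
      { destruct (near_caught_win h0 p1 E) as (del & Hdel & H).
        exists del. split; [exact Hdel|]. intros h t' H1 H2 (Hm & Hw & _).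
        exfalso. apply Hw. now apply H. }
      destruct (classify h0 p1 E) as [Hm|[Hm|[(del & Hdel & H)|(sg & tau & g & del & Hp)]]].
      - destruct (min_branch_exists h0 p1 Hm E) as (b & del & Hb).
        destruct (trap_branch h0 p1 b del Hb) as (e & He & Ht).
        destruct Hb as [(Hdel & _ & _ & Hu) _].
        exists (Rmin del e). split; [now apply Rmin_glb_lt|].
        intros h t' H1 H2 HT. apply Rmin_Rgt_l in H1, H2.
        exists p1. split; [|now left]. apply (Ht h); [tauto|].
        destruct (Hu h) as [_ Hu']; [tauto|].
        rewrite <- (Hu' t'); [exact HT|tauto|]. left. apply HT.
      - destruct (max_branch_exists h0 p1 Hm) as (del & (Hdel & _ & _ & Hu) & HM).
        exists del. split; [exact Hdel|]. intros h t' H1 H2 HT. exfalso.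
        destruct (Hu h H1) as [_ Hu'].
        assert (Et : t' = p1) by (apply Hu'; [exact H2|left; apply HT]).
        subst t'. apply (min_not_max h p1); [apply HT|now apply HM].
      - exists del. split; [exact Hdel|]. intros h t' H1 H2 HT. exfalso.
        apply (H h t' H1 H2). left. apply HT.
      - assert (Hp' := Hp). destruct Hp' as (_ & _ & Hdel & _ & _ & Hside & Hnear & _).
        exists del. split; [exact Hdel|]. intros h t' H1 H2 HT.
        destruct (Hnear h t' H1 H2) as [Hs1 Hor]; [left; apply HT|].
        destruct Hor as [-> | ->].
        + destruct (trap_pivot _ _ _ _ _ _ Hp h H1 Hs1 HT) as (r & Hr1 & Hr2).
          exists r. split; [exact Hr2|now right].
        + exfalso. destruct (Hside h H1 Hs1) as (_ & _ & Hmx & _).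
          apply (min_not_max h p1); [apply HT|exact Hmx]. }
    destruct Hcl as (del & Hdel & H). exists (Rmin del eta).
    split; [now apply Rmin_glb_lt|]. intros h t' H1 H2 HT.
    apply Rmin_Rgt_l in H1, H2. split; [tauto|]. now apply (H h t').
  - exists (Rmin d 1). split; [apply Rmin_glb_lt; lra|]. intros h t' Hh HT.
    apply Rmin_Rgt_l in Hh. destruct Hh as [Hh1 Hh2]. assert (Hh3 := Hh2).
    apply Rabs_bounds_lt in Hh2.
    destruct (H t') as (p1 & del & _ & Hdd & Hp & HP).
    { destruct HT as (_ & _ & HT). lra. }
    destruct (HP h t' ltac:(lra) Hp HT) as [G1 (t & G2 & G3)].
    now exists p1, t.
Qed.

(** * Lipschitz functions of both positions and bisectors of short chords *)

Definition lip2 (f : R -> R -> R) : Prop :=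
  exists C, 0 <= C /\ (forall h p, Rabs (f h p) <= C) /\
    forall h p h' p', Rabs (f h p - f h' p') <= C * (Rabs (h - h') + Rabs (p - p')).

Lemma lip2_mul f g : lip2 f -> lip2 g -> lip2 (fun h p => f h p * g h p).
Proof.
  intros (C1 & H1 & B1 & L1) (C2 & H2 & B2 & L2). exists (C1 * C2 + C1 * C2).
  pose proof (Rmult_le_pos _ _ H1 H2) as H12.
  split; [lra|]. split.
  - intros h p. rewrite Rabs_mult.
    apply Rle_trans with (C1 * C2); [|lra].
    apply Rmult_le_compat; auto using Rabs_pos.
  - intros h p h' p'.
    replace (f h p * g h p - f h' p' * g h' p') with
      (f h p * (g h p - g h' p') + (f h p - f h' p') * g h' p') by ring.
    eapply Rle_trans; [apply Rabs_triang|]. rewrite !Rabs_mult.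
    set (z := Rabs (h - h') + Rabs (p - p')).
    assert (Hz : 0 <= z) by (apply Rplus_le_le_0_compat; apply Rabs_pos).
    assert (G1 : Rabs (f h p) * Rabs (g h p - g h' p') <= C1 * (C2 * z))
      by (apply Rmult_le_compat; auto using Rabs_pos; apply L2).
    assert (G2 : Rabs (f h p - f h' p') * Rabs (g h' p') <= (C1 * z) * C2)
      by (apply Rmult_le_compat; auto using Rabs_pos; apply L1).
    lra.
Qed.

Lemma lip2_add f g : lip2 f -> lip2 g -> lip2 (fun h p => f h p + g h p).
Proof.
  intros (C1 & H1 & B1 & L1) (C2 & H2 & B2 & L2). exists (C1 + C2).
  split; [lra|]. split.
  - intros h p. pose proof (Rabs_triang (f h p) (g h p)) as H.
    specialize (B1 h p). specialize (B2 h p). lra.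
  - intros h p h' p'.
    replace (f h p + g h p - (f h' p' + g h' p')) with
      ((f h p - f h' p') + (g h p - g h' p')) by ring.
    pose proof (Rabs_triang (f h p - f h' p') (g h p - g h' p')) as H.
    specialize (L1 h p h' p'). specialize (L2 h p h' p'). lra.
Qed.

Lemma lip2_sub f g : lip2 f -> lip2 g -> lip2 (fun h p => f h p - g h p).
Proof.
  intros Hf Hg. assert (Hc : lip2 (fun _ _ => -1)).
  { exists 1. split; [lra|]. split; [intros; apply Rabs_le; lra|]. intros h p h' p'.
    rewrite Rminus_diag, Rabs_R0. pose proof (Rabs_pos (h - h')).
    pose proof (Rabs_pos (p - p')). lra. }
  destruct (lip2_add _ _ Hf (lip2_mul _ _ Hc Hg)) as (C & HC & HB & HL).
  exists C. split; [exact HC|]. split; [intros h p|intros h p h' p'].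
  - replace (f h p - g h p) with (f h p + -1 * g h p) by ring. apply HB.
  - replace (f h p - g h p - (f h' p' - g h' p')) with
      (f h p + -1 * g h p - (f h' p' + -1 * g h' p')) by ring. apply HL.
Qed.

Lemma lip1_left f : lip1 f -> lip2 (fun h _ => f h).
Proof.
  intros (C & H & Bd & L). exists C. split; [exact H|]. split; [auto|].
  intros h p h' p'. specialize (L h h'). pose proof (Rabs_pos (p - p')). nra.
Qed.

Lemma lip1_right f c : lip1 f -> lip2 (fun _ p => f (p + c)).
Proof.
  intros (C & H & Bd & L). exists C. split; [exact H|]. split; [auto|].
  intros h p h' p'. specialize (L (p + c) (p' + c)).
  replace (p + c - (p' + c)) with (p - p') in L by ring.
  pose proof (Rabs_pos (h - h')). nra.
Qed.

Lemma lip2_sq_dist f g f' g' : lip2 f -> lip2 g -> lip2 f' -> lip2 g' ->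
  lip2 (fun h p => (f h p - g h p) * (f h p - g h p) + (f' h p - g' h p) * (f' h p - g' h p)).
Proof.
  intros. apply lip2_add; apply lip2_mul; now apply lip2_sub.
Qed.

(** The window for [h] is twice that for [p] because [h] is later controlled through [p - h] and
    [p]. The error is at most [3 * C * del], which leaves [2 * del] of the value at the centre. *)
Lemma lip2_nonzero f h0 p0 : lip2 f -> f h0 p0 <> 0 ->
  exists del, 0 < del /\ forall h p, Rabs (h - h0) < 2 * del -> Rabs (p - p0) < del ->
    (0 < f h0 p0 -> del < f h p) /\ (f h0 p0 < 0 -> f h p < - del).
Proof.
  intros (C & HC & _ & L) Hne.
  assert (Hpos : 0 < Rabs (f h0 p0)) by (now apply Rabs_pos_lt).
  exists (Rabs (f h0 p0) / (3 * C + 2)).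
  assert (Hd : 0 < Rabs (f h0 p0) / (3 * C + 2)) by (apply Rdiv_lt_0_compat; lra).
  set (del := Rabs (f h0 p0) / (3 * C + 2)) in *.
  assert (E : Rabs (f h0 p0) = del * (3 * C + 2)) by (unfold del; field; lra).
  split; [exact Hd|]. intros h p Hh Hp. specialize (L h p h0 p0).
  assert (Hle : C * (Rabs (h - h0) + Rabs (p - p0)) <= C * (3 * del))
    by (apply Rmult_le_compat_l; lra).
  assert (HL : Rabs (f h p - f h0 p0) <= 3 * C * del) by lra.
  apply Rabs_bounds in HL.
  split; intros Hs; [rewrite Rabs_right in E by lra|rewrite Rabs_left in E by lra]; lra.
Qed.

Lemma sq_sum_nonneg a b : 0 <= a * a + b * b.
Proof. nra. Qed.

(* [bisec eps h p] vanishes when the human at [h] is equidistant from the points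
   [p - eps] and [p + eps]; [offset eps h p] then locates her on the perpendicular
   bisector, up to a positive factor, from the midpoint of these points. *)
Definition bisec (eps h p : R) : R := D h (p + eps) - D h (p - eps).
Definition offset (eps h p : R) : R :=
  cross (psub (tr (p + eps)) (tr (p - eps))) (psub (tr h) (tr (p - eps))).

Lemma track_lip2 eps :
  lip2 (fun h _ => fst (tr h)) /\ lip2 (fun h _ => snd (tr h)) /\
  lip2 (fun _ p => fst (tr (p + eps))) /\ lip2 (fun _ p => snd (tr (p + eps))).
Proof.
  destruct track_lip as [Hx Hy].
  exact (conj (lip1_left _ Hx) (conj (lip1_left _ Hy)
           (conj (lip1_right _ eps Hx) (lip1_right _ eps Hy)))).
Qed.

Lemma sqd_lip_shift eps : lip2 (fun h p => D h (p + eps)).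
Proof.
  destruct (track_lip2 eps) as (H1 & H2 & H3 & H4).
  exact (lip2_sq_dist _ _ _ _ H3 H1 H4 H2).
Qed.

Lemma sqd_lip : lip2 D.
Proof.
  destruct (sqd_lip_shift 0) as (C & HC & HB & HL). exists C. split; [exact HC|].
  split; [intros h p|intros h p h' p'].
  - specialize (HB h p). now rewrite Rplus_0_r in HB.
  - specialize (HL h p h' p'). now rewrite !Rplus_0_r in HL.
Qed.

Lemma bisec_lip eps : lip2 (bisec eps).
Proof. exact (lip2_sub _ _ (sqd_lip_shift eps) (sqd_lip_shift (- eps))). Qed.

Lemma offset_lip eps : lip2 (offset eps).
Proof.
  destruct (track_lip2 eps) as (H1 & H2 & H3 & H4).
  destruct (track_lip2 (- eps)) as (_ & _ & H5 & H6).
  exact (lip2_sub _ _ (lip2_mul _ _ (lip2_sub _ _ H3 H5) (lip2_sub _ _ H2 H6))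
                      (lip2_mul _ _ (lip2_sub _ _ H4 H6) (lip2_sub _ _ H1 H5))).
Qed.

Lemma chord_nonzero eps p : 0 < eps < 1 ->
  0 < dot (psub (tr (p + eps)) (tr (p - eps))) (psub (tr (p + eps)) (tr (p - eps))).
Proof.
  intros He. pose proof (sqd_nonneg (p - eps) (p + eps)) as [H|H]; [exact H|].
  exfalso. symmetry in H. apply sqd_zero in H.
  pose proof INRn_ge_3.
  apply track_inj_near in H; [lra|]. apply Rabs_def1; lra.
Qed.

(** Equal distances and a given offset are two linear equations for the human's position, uniquely
    solvable as the chord has positive length. So a multiple of the offset comes from the same
    multiple of the vector from the midpoint. *)
Lemma bisec_combination eps h h' p lam : 0 < eps < 1 ->
  bisec eps h p = 0 -> bisec eps h' p = 0 -> offset eps h p = lam * offset eps h' p ->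
  let mx := (fst (tr (p + eps)) + fst (tr (p - eps))) / 2 in
  let my := (snd (tr (p + eps)) + snd (tr (p - eps))) / 2 in
  fst (tr h) - mx = lam * (fst (tr h') - mx) /\ snd (tr h) - my = lam * (snd (tr h') - my).
Proof.
  intros He E1 E2 E3. cbv zeta. pose proof (chord_nonzero eps p He) as Hd.
  unfold bisec, sqd, offset, cross, dot, psub in *. cbn [fst snd] in *.
  set (ux := fst (tr (p + eps))) in *. set (uy := snd (tr (p + eps))) in *.
  set (wx := fst (tr (p - eps))) in *. set (wy := snd (tr (p - eps))) in *.
  set (hx := fst (tr h)) in *. set (hy := snd (tr h)) in *.
  set (gx := fst (tr h')) in *. set (gy := snd (tr h')) in *.
  clearbody ux uy wx wy hx hy gx gy.
  set (x := hx - (ux + wx) / 2 - lam * (gx - (ux + wx) / 2)).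
  set (y := hy - (uy + wy) / 2 - lam * (gy - (uy + wy) / 2)).
  assert (F1 : (ux - wx) * x + (uy - wy) * y = 0).
  { transitivity
      (- ((ux - hx) * (ux - hx) + (uy - hy) * (uy - hy) -
          ((wx - hx) * (wx - hx) + (wy - hy) * (wy - hy))) / 2 +
       lam * ((ux - gx) * (ux - gx) + (uy - gy) * (uy - gy) -
          ((wx - gx) * (wx - gx) + (wy - gy) * (wy - gy))) / 2);
      [unfold x, y; field|rewrite E1, E2; field]. }
  assert (F2 : (ux - wx) * y - (uy - wy) * x = 0).
  { transitivity
      ((ux - wx) * (hy - wy) - (uy - wy) * (hx - wx) -
       lam * ((ux - wx) * (gy - wy) - (uy - wy) * (gx - wx)));
      [unfold x, y; field|rewrite E3; ring]. }
  set (a := ux - wx) in *. set (b := uy - wy) in *. set (q := a * a + b * b) in *.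
  assert (G1 : q * x = 0).
  { transitivity (a * (a * x + b * y) - b * (a * y - b * x)); [unfold q; ring|].
    rewrite F1, F2. ring. }
  assert (G2 : q * y = 0).
  { transitivity (b * (a * x + b * y) + a * (a * y - b * x)); [unfold q; ring|].
    rewrite F1, F2. ring. }
  apply Rmult_integral in G1, G2.
  destruct G1 as [G1|G1]; [lra|]. destruct G2 as [G2|G2]; [lra|].
  unfold x in G1. unfold y in G2. lra.
Qed.

Lemma same_offset eps h h' p : 0 < eps < 1 ->
  bisec eps h p = 0 -> bisec eps h' p = 0 -> offset eps h p = offset eps h' p ->
  tr h = tr h'.
Proof.
  intros He E1 E2 E3.
  destruct (bisec_combination eps h h' p 1 He E1 E2) as [H1 H2]; [lra|].
  apply injective_projections; lra.
Qed.

Definition farthest (h0 : R) : Prop :=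
  forall s, dot (tr s) (tr s) <= dot (tr h0) (tr h0).

(** The squared norm is convex on each edge, so a vertex of largest norm is farthest on the whole
    track. *)
Lemma farthest_exists : exists h0, farthest h0.
Proof.
  assert (HV : forall m, (0 < m)%nat -> exists i, (i < m)%nat /\ forall j, (j < m)%nat ->
             dot (V j) (V j) <= dot (V i) (V i)).
  { induction m as [|m IH]; intros Hm; [lia|].
    destruct m as [|m].
    - exists 0%nat. split; [lia|]. intros j Hj. replace j with 0%nat by lia. lra.
    - destruct IH as (i & Hi & H); [lia|].
      destruct (Rle_dec (dot (V (S m)) (V (S m))) (dot (V i) (V i))) as [Hle|Hgt].
      + exists i. split; [lia|]. intros j Hj.
        destruct (Nat.eq_dec j (S m)) as [->|Hne]; [exact Hle|apply H; lia].
      + exists (S m). split; [lia|]. intros j Hj.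
        destruct (Nat.eq_dec j (S m)) as [->|Hne]; [lra|].
        specialize (H j ltac:(lia)). lra. }
  pose proof n_ge_3 as Hn.
  destruct (HV n ltac:(lia)) as (i & Hi & H).
  exists (IZR (Z.of_nat i)).
  assert (Ei : tr (IZR (Z.of_nat i)) = V i).
  { rewrite track_vertex. unfold vtxZ. rewrite Z.mod_small by lia. now rewrite Nat2Z.id. }
  intros s. rewrite Ei. destruct (on_some_edge s) as [k Hk].
  assert (Hvx : forall k, dot (vx k) (vx k) <= dot (V i) (V i)).
  { intros k'. destruct (vx_index k') as (j & Hj & -> & _). now apply H. }
  pose proof (Hvx k) as H1. pose proof (Hvx (k + 1)%Z) as H2.
  rewrite (track_on_edge k) by lra. unfold edge, dot, psub in *. cbn [fst snd] in *.
  set (f := s - IZR k). assert (Hf : 0 <= f <= 1) by (unfold f; lra).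
  set (ax := fst (vx k)) in *. set (ay := snd (vx k)) in *.
  set (bx := fst (vx (k + 1)%Z)) in *. set (by' := snd (vx (k + 1)%Z)) in *.
  set (m := fst (V i) * fst (V i) + snd (V i) * snd (V i)) in *.
  assert (G1 : 0 <= f * (m - (bx * bx + by' * by'))) by (apply Rmult_le_pos; lra).
  assert (G2 : 0 <= (1 - f) * (m - (ax * ax + ay * ay))) by (apply Rmult_le_pos; lra).
  assert (G3 : 0 <= f * (1 - f)) by (apply Rmult_le_pos; lra).
  assert (G4 : 0 <= f * (1 - f) * ((bx - ax) * (bx - ax) + (by' - ay) * (by' - ay)))
    by (apply Rmult_le_pos; [lra|apply sq_sum_nonneg]).
  replace ((ax + f * (bx - ax)) * (ax + f * (bx - ax)) + (ay + f * (by' - ay)) * (ay + f * (by' - ay)))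
    with (f * (bx * bx + by' * by') + (1 - f) * (ax * ax + ay * ay) -
          f * (1 - f) * ((bx - ax) * (bx - ax) + (by' - ay) * (by' - ay))) by ring.
  lra.
Qed.

(* Strict convexity of the disk: nothing lies on the bisector beyond a farthest point. *)
Lemma farthest_last eps h0 h p lam : 0 < eps < 1 -> farthest h0 ->
  bisec eps h0 p = 0 -> bisec eps h p = 0 -> 0 < lam < 1 ->
  offset eps h0 p = lam * offset eps h p -> offset eps h p <> 0 -> False.
Proof.
  intros He Hf E1 E2 Hl E3 Hne.
  destruct (bisec_combination eps h0 h p lam He E1 E2 E3) as [H1 H2].
  pose proof (Hf h) as F1. pose proof (Hf (p + eps)) as F2. pose proof (Hf (p - eps)) as F3.
  unfold offset, cross, dot, psub in *. cbn [fst snd] in *.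
  set (ux := fst (tr (p + eps))) in *. set (uy := snd (tr (p + eps))) in *.
  set (wx := fst (tr (p - eps))) in *. set (wy := snd (tr (p - eps))) in *.
  set (hx := fst (tr h0)) in *. set (hy := snd (tr h0)) in *.
  set (gx := fst (tr h)) in *. set (gy := snd (tr h)) in *.
  clearbody ux uy wx wy hx hy gx gy.
  set (mx := (ux + wx) / 2) in *. set (my := (uy + wy) / 2) in *.
  set (x := gx - mx) in *. set (y := gy - my) in *.
  set (m := hx * hx + hy * hy) in *.
  assert (Hm : mx * mx + my * my <= m).
  { unfold mx, my. pose proof (sq_sum_nonneg (ux - wx) (uy - wy)). lra. }
  assert (Hxy : 0 < x * x + y * y).
  { destruct (Req_dec x 0) as [Ex|Ex]; [destruct (Req_dec y 0) as [Ey|Ey]|].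
    - exfalso. apply Hne. replace gx with mx by (unfold x in Ex; lra).
      replace gy with my by (unfold y in Ey; lra). unfold mx, my. field.
    - assert (0 < y * y) by nra. nra.
    - assert (0 < x * x) by nra. nra. }
  assert (Em : m = lam * (gx * gx + gy * gy) + (1 - lam) * (mx * mx + my * my)
               - lam * (1 - lam) * (x * x + y * y)).
  { unfold m. replace hx with (mx + lam * x) by lra. replace hy with (my + lam * y) by lra.
    unfold x, y. ring. }
  assert (G1 : 0 <= lam * (m - (gx * gx + gy * gy))) by (apply Rmult_le_pos; lra).
  assert (G2 : 0 <= (1 - lam) * (m - (mx * mx + my * my))) by (apply Rmult_le_pos; lra).
  assert (G3 : 0 < lam * (1 - lam)) by (apply Rmult_lt_0_compat; lra).
  assert (G4 : 0 < lam * (1 - lam) * (x * x + y * y)) by (now apply Rmult_lt_0_compat).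
  lra.
Qed.

(** ** Zeros of [bisec] *)

Lemma sqd_continuous h x : continuity_pt (D h) x.
Proof.
  destruct sqd_lip as (C & HC & _ & L). intros e He.
  exists (e / (C + 1)). split; [apply Rdiv_lt_0_compat; lra|].
  intros y [_ Hy]. simpl in *. unfold Rdist in *.
  specialize (L h y h x). rewrite Rminus_diag, Rabs_R0, Rplus_0_l in L.
  eapply Rle_lt_trans; [exact L|].
  apply Rle_lt_trans with ((C + 1) * Rabs (y - x)).
  - pose proof (Rabs_pos (y - x)). nra.
  - apply Rlt_le_trans with ((C + 1) * (e / (C + 1))).
    + apply Rmult_lt_compat_l; lra.
    + right. field. lra.
Qed.

(** Rolle's argument: the ends have equal distances, so an extremum lies inside or the distance is
    constant on the whole interval. *)
Lemma bisec_zero_ext eps h p : 0 < eps -> bisec eps h p = 0 ->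
  exists p', p - eps < p' < p + eps /\ lext h p'.
Proof.
  intros He E. unfold bisec in E.
  assert (Hball : forall x u, p - eps < x < p + eps ->
            Rabs (u - x) < Rmin (x - (p - eps)) (p + eps - x) -> p - eps <= u <= p + eps).
  { intros x u Hx Hu. apply Rmin_Rgt_l in Hu. destruct Hu as [H1 H2].
    apply Rabs_bounds_lt in H1, H2. lra. }
  destruct (continuity_ab_maj (D h) (p - eps) (p + eps)) as (x & Hx1 & Hx2);
    [lra|intros; apply sqd_continuous|].
  destruct (continuity_ab_min (D h) (p - eps) (p + eps)) as (y & Hy1 & Hy2);
    [lra|intros; apply sqd_continuous|].
  destruct (classic (p - eps < x < p + eps)) as [Hx|Hx].
  { exists x. split; [exact Hx|]. right. apply local_max_sqd.
    exists (Rmin (x - (p - eps)) (p + eps - x)). split; [apply Rmin_glb_lt; lra|].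
    intros u Hu. apply Hx1. now apply (Hball x). }
  destruct (classic (p - eps < y < p + eps)) as [Hy|Hy].
  { exists y. split; [exact Hy|]. left. apply local_min_sqd.
    exists (Rmin (y - (p - eps)) (p + eps - y)). split; [apply Rmin_glb_lt; lra|].
    intros u Hu. apply Hy1. now apply (Hball y). }
  exists p. split; [lra|]. left. apply local_min_sqd. exists eps.
  split; [exact He|]. intros u Hu. apply Rabs_bounds_lt in Hu.
  assert (Hend : forall z, p - eps <= z <= p + eps -> ~ (p - eps < z < p + eps) ->
            D h z = D h (p + eps)).
  { intros z Hz1 Hz2. destruct (Req_dec z (p - eps)) as [->|Hz3]; [lra|].
    now replace z with (p + eps) by lra. }
  rewrite (Hend x Hx2 Hx) in Hx1. rewrite (Hend y Hy2 Hy) in Hy1.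
  specialize (Hx1 p ltac:(lra)). specialize (Hy1 u ltac:(lra)). lra.
Qed.

(** ** Off the diagonal the human is never the midpoint of a short chord *)

(** Compactness and simplicity: points close in the plane are close along the track, up to whole
    turns. *)
Lemma close_points : exists eta, 0 < eta /\
  forall s t, D s t < eta -> exists c, Rabs (s - t - IZR c * INR n) < 1 / 4.
Proof.
  pose proof INRn_ge_3 as Hn.
  destruct (lebesgue2 (fun s t del => forall x y, Rabs (x - s) < del -> Rabs (y - t) < del ->
     D x y < del -> exists c, Rabs (x - y - IZR c * INR n) < 1 / 4) 0 (INR n) 0 (INR n))
    as (d & Hd & H).
  - intros s t _ _. destruct (Req_dec (D s t) 0) as [E|E].
    + apply sqd_zero in E. symmetry in E. apply track_inj in E.
      destruct E as [c ->]. exists (1 / 8). split; [lra|]. intros x y Hx Hy _.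
      exists c. apply Rabs_bounds_lt in Hx, Hy. apply Rabs_def1; lra.
    + destruct (lip2_nonzero D s t sqd_lip E) as (del & Hdel & H).
      exists del. split; [exact Hdel|]. intros x y Hx Hy HD. exfalso.
      destruct (H x y ltac:(lra) Hy) as [H1 _].
      pose proof (sqd_nonneg s t). specialize (H1 ltac:(lra)). lra.
  - exists d. split; [exact Hd|]. intros s t Hst.
    destruct (reduce_mod s) as [a Ha]. destruct (reduce_mod t) as [b Hb].
    destruct (H (s + IZR a * INR n) (t + IZR b * INR n) ltac:(lra) ltac:(lra))
      as (x & y & del & _ & _ & G1 & G2 & G3 & HP).
    destruct (HP _ _ G2 G3) as [c Hc].
    { rewrite sqd_period. lra. }
    exists (c - a + b)%Z. rewrite plus_IZR, minus_IZR.
    replace (s - t - (IZR c - IZR a + IZR b) * INR n) with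
      (s + IZR a * INR n - (t + IZR b * INR n) - IZR c * INR n) by ring. exact Hc.
Qed.

(** If the chord spans a vertex and the human is at or beyond one of its ends, the midpoint relation
    makes the two edges point in opposite directions. If the chord lies in one edge, its midpoint is
    at [p], but [h] differs from [p]. *)
Lemma not_midpoint eps h p : 0 < eps < 1 / 4 -> eps <= Rabs (h - p) < 1 / 4 ->
  ~ (2 * fst (tr h) = fst (tr (p + eps)) + fst (tr (p - eps)) /\
     2 * snd (tr h) = snd (tr (p + eps)) + snd (tr (p - eps))).
Proof.
  intros He Hhp [E1 E2]. pose proof INRn_ge_3 as Hn.
  destruct (classic (exists k, p - eps < IZR k < p + eps)) as [[k Hk]|Hno].
  - pose proof (IZR_pred k) as Ek.
    assert (Ev : vx k = (fst (vx (k - 1)%Z) + fst (edge (k - 1)),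
                         snd (vx (k - 1)%Z) + snd (edge (k - 1)))).
    { unfold edge, psub. cbn [fst snd]. replace (k - 1 + 1)%Z with k by ring.
      apply injective_projections; cbn [fst snd]; ring. }
    rewrite (track_on_edge k (p + eps)), (track_on_edge (k - 1) (p - eps)) in E1, E2 by lra.
    rewrite Ev in E1, E2. cbn [fst snd] in E1, E2. rewrite Ek in E1, E2.
    destruct Hhp as [H1 H2].
    destruct (Rle_dec p h) as [Hph|Hph].
    + rewrite Rabs_right in H1, H2 by lra.
      rewrite (track_on_edge k h) in E1, E2 by lra.
      rewrite Ev in E1, E2. cbn [fst snd] in E1, E2.
      apply (no_spike k (2 * (h - IZR k) - (p + eps - IZR k)) (IZR k - p + eps));
        [lra|lra|]. split; lra.
    + rewrite Rabs_left in H1, H2 by lra.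
      rewrite (track_on_edge (k - 1) h) in E1, E2 by lra.
      cbn [fst snd] in E1, E2. rewrite Ek in E1, E2.
      apply (no_spike k (p + eps - IZR k) (2 * (IZR k - h) - (IZR k - p + eps)));
        [lra|lra|]. split; lra.
  - destruct (on_some_edge (p - eps)) as [k Hk].
    assert (Hk2 : p + eps <= IZR k + 1).
    { apply Rnot_lt_le. intros Hlt. apply Hno. exists (k + 1)%Z. rewrite plus_IZR. lra. }
    assert (E : tr h = tr p).
    { rewrite (track_on_edge k (p + eps)), (track_on_edge k (p - eps)) in E1, E2 by lra.
      rewrite (track_on_edge k p) by lra. cbn [fst snd] in E1, E2.
      apply injective_projections; cbn [fst snd]; lra. }
    apply track_inj_near in E; [|lra].
    subst h. rewrite Rminus_diag, Rabs_R0 in Hhp. lra.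
Qed.

(** Zero offset puts the human at the midpoint of the chord, hence near [p] in the plane when [eps]
    is small, hence near it along the track, directly or one turn later; [not_midpoint] excludes
    both. *)
Lemma offset_nonzero : exists e0, 0 < e0 /\ forall eps h p, 0 < eps < e0 ->
  eps <= p - h <= INR n - eps -> bisec eps h p = 0 -> offset eps h p <> 0.
Proof.
  pose proof INRn_ge_3 as Hn.
  destruct close_points as (eta & Heta & Hclose).
  destruct track_lip as [(C1 & HC1 & _ & L1) (C2 & HC2 & _ & L2)].
  cbv beta in L1, L2.
  set (Q := C1 * C1 + C2 * C2 + 1).
  assert (HQ : 0 < Q) by (unfold Q; nra).
  destruct (Rmin3 (1 / 4) (eta / Q) 1) as (e0 & He0 & M1 & M2 & _);
    [lra|apply Rdiv_lt_0_compat; lra|lra|].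
  exists e0. split; [exact He0|]. intros eps h p He Hhp E0 E1.
  assert (He1 : 0 < eps < 1) by lra.
  destruct (bisec_combination eps h h p 0 He1 E0 E0) as [X Y]; [rewrite E1; ring|].
  assert (X1 : 2 * fst (tr h) = fst (tr (p + eps)) + fst (tr (p - eps))) by lra.
  assert (Y1 : 2 * snd (tr h) = snd (tr (p + eps)) + snd (tr (p - eps))) by lra.
  assert (HD : D h p < eta).
  { unfold sqd, dot, psub. cbn [fst snd].
    pose proof (L1 (p + eps) p) as A1. pose proof (L1 (p - eps) p) as A2.
    pose proof (L2 (p + eps) p) as B1. pose proof (L2 (p - eps) p) as B2.
    rewrite Rabs_plus_sub in A1, B1 by lra. rewrite Rabs_minus_sub in A2, B2 by lra.
    apply Rabs_bounds in A1, A2, B1, B2.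
    set (x := fst (tr p) - fst (tr h)). set (y := snd (tr p) - snd (tr h)).
    assert (Hx : - (C1 * eps) <= x <= C1 * eps) by (unfold x; lra).
    assert (Hy : - (C2 * eps) <= y <= C2 * eps) by (unfold y; lra).
    assert (x * x <= (C1 * eps) * (C1 * eps)) by nra.
    assert (y * y <= (C2 * eps) * (C2 * eps)) by nra.
    assert (Hee : eps * eps <= eps) by nra.
    assert ((C1 * eps) * (C1 * eps) <= C1 * C1 * eps) by nra.
    assert ((C2 * eps) * (C2 * eps) <= C2 * C2 * eps) by nra.
    assert (HQe : Q * eps < eta).
    { apply Rlt_le_trans with (Q * (eta / Q)); [apply Rmult_lt_compat_l; lra|].
      right. field. lra. }
    unfold Q in HQe. lra. }
  destruct (Hclose h p HD) as [c Hc].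
  assert (Hcases : c = 0%Z \/ c = (-1)%Z).
  { apply Rabs_bounds_lt in Hc.
    assert (H1 : IZR c < 1) by nra. assert (H2 : -2 < IZR c) by nra.
    apply lt_IZR in H1, H2. lia. }
  destruct Hcases as [-> | ->].
  - apply (not_midpoint eps h p); [lra| |now split].
    replace (h - p - 0 * INR n) with (h - p) in Hc by ring.
    split; [|exact Hc]. rewrite Rabs_left by lra. lra.
  - replace (h - p - -1 * INR n) with (h + INR n - p) in Hc by ring.
    apply (not_midpoint eps (h + INR n) p); [lra| |].
    + split; [|exact Hc]. rewrite Rabs_right by lra. lra.
    + rewrite track_self_shift. now split.
Qed.

(** * Position of an extremum relative to the trap *)

Definition below_trap (h p : R) : Prop := forall t, Trap h t -> p < t.
Definition above_trap (h p : R) : Prop := forall t, Trap h t -> t < p.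

Definition same_side (h p h' p' : R) : Prop :=
  (below_trap h p <-> below_trap h' p') /\ (above_trap h p <-> above_trap h' p').

Lemma same_side_sym h p h' p' : same_side h p h' p' -> same_side h' p' h p.
Proof. unfold same_side. tauto. Qed.

Lemma same_side_trans h p h' p' h'' p'' :
  same_side h p h' p' -> same_side h' p' h'' p'' -> same_side h p h'' p''.
Proof. unfold same_side. tauto. Qed.

Lemma trap_neq h t : Trap h t -> tr h <> tr t.
Proof. intros (_ & _ & Ht). now apply track_neq_strip. Qed.

Lemma trap_persists h0 t0 eps : Trap h0 t0 -> 0 < eps ->
  exists e, 0 < e /\ forall h, Rabs (h - h0) < e ->
    exists t, Trap h t /\ Rabs (t - t0) < eps.
Proof.
  intros HT He.
  destruct (min_branch_exists h0 t0 (proj1 HT) (trap_neq _ _ HT)) as (b & del & Hb).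
  destruct (trap_branch h0 t0 b del Hb) as (e1 & He1 & H1).
  destruct Hb as [(Hdel & Hl & Hb0 & _) _].
  destruct (lip_near b h0 eps Hl He) as (e2 & He2 & H2).
  exists (Rmin e1 e2). split; [now apply Rmin_glb_lt|]. intros h Hh.
  apply Rmin_Rgt_l in Hh. exists (b h). split; [now apply H1|].
  rewrite <- Hb0. now apply H2.
Qed.

Lemma trap_isolated h p : exists del, 0 < del /\
  forall t, Rabs (t - p) < del -> Trap h t -> t = p.
Proof.
  assert (H0 : Rabs (h - h) = 0) by (rewrite Rminus_diag; apply Rabs_R0).
  destruct (classic (tr h = tr p)) as [E|E].
  - destruct (near_caught_win h p E) as (del & Hd & H).
    exists del. split; [exact Hd|]. intros t Ht (Hm & Hw & _).
    exfalso. apply Hw. apply H; [lra|exact Ht|exact Hm].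
  - destruct (classify h p E) as [Hm|[Hm|[(del & Hd & H)|(sg & tau & g & del & Hp)]]].
    + destruct (min_branch_exists h p Hm E) as (b & del & (Hd & _ & Hb0 & H) & _).
      exists del. split; [exact Hd|]. intros t Ht HT.
      destruct (H h ltac:(lra)) as [_ H']. rewrite <- Hb0. apply H'; [exact Ht|].
      left. apply HT.
    + destruct (max_branch_exists h p Hm) as (del & (Hd & _ & _ & H) & _).
      exists del. split; [exact Hd|]. intros t Ht HT.
      destruct (H h ltac:(lra)) as [_ H']. apply H'; [exact Ht|]. left. apply HT.
    + exists del. split; [exact Hd|]. intros t Ht HT. exfalso.
      apply (H h t); [lra|exact Ht|]. left. apply HT.
    + destruct Hp as (_ & _ & Hd & _ & _ & _ & Hn & _).
      exists del. split; [exact Hd|]. intros t Ht HT. exfalso.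
      destruct (Hn h t ltac:(lra) Ht) as [H _]; [left; apply HT|].
      rewrite Rminus_diag in H. lra.
Qed.

(** The sign [sg] yields the highest and the lowest trapped position at once. A supremum that is not
    attained would be a limit of trapped positions, against [trap_isolated]. *)
Lemma trap_extreme sg h : sg = 1 \/ sg = -1 -> (exists t, Trap h t) ->
  exists u, Trap h u /\ forall t, Trap h t -> sg * t <= sg * u.
Proof.
  intros Hsg [t0 Ht0]. assert (Hinv : forall t, sg * (sg * t) = t)
    by (intros; destruct Hsg; subst sg; ring).
  destruct (completeness (fun x => Trap h (sg * x))) as [m [Hm1 Hm2]].
  - exists (Rabs h + INR n). intros t (_ & _ & Ht).
    pose proof (Rle_abs h). pose proof (Rle_abs (- h)). rewrite Rabs_Ropp in *.
    pose proof (pos_INR n). destruct Hsg; subst sg; lra.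
  - exists (sg * t0). now rewrite Hinv.
  - exists (sg * m). rewrite Hinv. split.
    2:{ intros t Ht. apply Hm1. now rewrite Hinv. }
    destruct (trap_isolated h (sg * m)) as (del & Hd & H). apply NNPP. intros Hno.
    assert (m <= m - del); [|lra]. apply Hm2. intros t Ht.
    apply Rnot_lt_le. intros Hlt. apply Hno. specialize (Hm1 t Ht).
    rewrite <- (H (sg * t)); [exact Ht| |exact Ht].
    destruct Hsg; subst sg; apply Rabs_def1; lra.
Qed.

(** Having a trapped position is an open condition on the human by [trap_persists] and a closed one
    by [trap_back]. *)
Lemma trap_everywhere : (exists h t, Trap h t) -> forall h, exists t, Trap h t.
Proof.
  intros (h0 & t0 & H0) h.
  assert (Hloc : forall x, exists del, 0 < del /\ forall u, Rabs (u - x) < del ->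
            ((exists t, Trap u t) <-> exists t, Trap x t)).
  { intros x. destruct (trap_back x 1 Rlt_0_1) as (d1 & Hd1 & H1).
    destruct (classic (exists t, Trap x t)) as [[t Ht]|Hno].
    - destruct (trap_persists x t 1 Ht Rlt_0_1) as (e & He & H2).
      exists e. split; [exact He|]. intros u Hu. split; [now exists t|].
      intros _. destruct (H2 u Hu) as (t' & Ht' & _). now exists t'.
    - exists d1. split; [exact Hd1|]. intros u Hu. split; [|tauto].
      intros (t & Ht). destruct (H1 u t Hu Ht) as (p1 & t' & _ & HT & _). now exists t'. }
  assert (E := locally_constant (fun x => exists t, Trap x t) (Rmin h h0) (Rmax h h0)).
  apply (E) with (t := h0).
  - intros t _. destruct (Hloc t) as (del & Hd & H). exists del. split; [exact Hd|].
    intros u _ Hu. now apply H.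
  - split; [apply Rmin_l|apply Rmax_l].
  - split; [apply Rmin_r|apply Rmax_r].
  - now exists t0.
Qed.

Section Trapped.
Context (Htrap : exists h t, Trap h t).

(* A run cannot cross a local extremum, so trapped puppies stay on their side of [p0]. *)
Lemma branch_same_side h0 p0 b del : branch h0 p0 b del -> tr h0 <> tr p0 ->
  (exists e, 0 < e /\ forall h, Rabs (h - h0) < e -> (Trap h (b h) <-> Trap h0 p0)) ->
  exists e, 0 < e /\ forall h, Rabs (h - h0) < e -> same_side h (b h) h0 p0.
Proof.
  intros (Hdel & Hl & Hb0 & Hb) Hcau (e0 & He0 & Htr).
  destruct (classic (Trap h0 p0)) as [HT|HT].
  { exists e0. split; [exact He0|]. intros h Hh.
    assert (HT' : Trap h (b h)) by (now apply Htr).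
    unfold same_side, below_trap, above_trap.
    split; split; intros H; exfalso;
      try (specialize (H _ HT)); try (specialize (H _ HT')); lra. }
  assert (Hext0 : lext h0 p0).
  { destruct (Hb h0) as [H _]; [rewrite Rminus_diag, Rabs_R0; lra|]. now rewrite Hb0 in H. }
  destruct (lip_near b h0 (del / 4) Hl ltac:(lra)) as (e1 & He1 & H1).
  destruct (trap_back h0 (del / 4) ltac:(lra)) as (e2 & He2 & H2).
  assert (Hside : forall sg, sg = 1 \/ sg = -1 -> exists e, 0 < e /\
            forall h, Rabs (h - h0) < e -> (exists t, Trap h0 t /\ 0 < sg * (t - p0)) ->
            exists t, Trap h t /\ 0 < sg * (t - b h)).
  { intros sg Hsg.
    destruct (classic (exists t, Trap h0 t /\ 0 < sg * (t - p0))) as [(t & Ht & Hlt)|Hno].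
    - destruct (trap_persists h0 t (sg * (t - p0) / 2) Ht ltac:(lra)) as (e & He & H).
      destruct (lip_near b h0 (sg * (t - p0) / 2) Hl ltac:(lra)) as (e' & He' & H').
      exists (Rmin e e'). split; [now apply Rmin_glb_lt|]. intros h Hh _.
      apply Rmin_Rgt_l in Hh. destruct (H h) as (t' & Ht' & Hd'); [tauto|].
      exists t'. split; [exact Ht'|]. specialize (H' h ltac:(tauto)).
      apply Rabs_bounds_lt in Hd', H'. destruct Hsg; subst sg; lra.
    - exists 1. split; [lra|]. tauto. }
  destruct (Hside 1 ltac:(auto)) as (e3 & He3 & H3).
  destruct (Hside (-1) ltac:(auto)) as (e4 & He4 & H4).
  destruct (Rmin3 e0 e1 e2 He0 He1 He2) as (e5 & He5 & L0 & L1 & L2).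
  destruct (Rmin3 e5 e3 e4 He5 He3 He4) as (e6 & He6 & L5 & L3 & L4).
  exists (Rmin e6 del). split; [now apply Rmin_glb_lt|]. intros h Hh.
  apply Rmin_Rgt_l in Hh. destruct Hh as [Hh Hhd].
  assert (HTh : ~ Trap h (b h)) by (rewrite (Htr h); [exact HT|lra]).
  specialize (H1 h ltac:(lra)). rewrite Hb0 in H1. apply Rabs_bounds_lt in H1.
  specialize (H3 h ltac:(lra)). specialize (H4 h ltac:(lra)).
  destruct (Hb h Hhd) as [_ Hu].
  assert (Hfar : forall t', Trap h t' -> t' <> b h /\ (t' <= p0 - del \/ p0 + del <= t')).
  { intros t' Ht'. assert (t' <> b h) by (intros ->; tauto). split; [assumption|].
    apply NNPP. intros Hnot. apply H. apply Hu; [apply Rabs_def1; lra|left; apply Ht']. }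
  assert (Hback : forall t', Trap h t' -> exists p1 t, Rabs (t' - p1) < del / 4 /\
            Trap h0 t /\ t <> p0 /\ ~ (p1 < p0 < t) /\ ~ (t < p0 < p1)).
  { intros t' Ht'. destruct (H2 h t' ltac:(lra) Ht') as (p1 & t & G1 & G2 & G3).
    exists p1, t. split; [exact G1|]. split; [exact G2|].
    split; [intros ->; tauto|].
    destruct G3 as [-> |G3]; [split; lra|].
    split; intros G; apply (run_no_ext h0 p1 t p0 G3); auto. }
  unfold same_side, below_trap, above_trap. split; split; intros H t Ht.
  - destruct (Rtotal_order p0 t) as [G|[G|G]]; [exact G|subst t; tauto|exfalso].
    destruct H4 as (t' & Ht' & Hlt); [exists t; split; [exact Ht|lra]|].
    specialize (H t' Ht'). lra.
  - destruct (Hfar t Ht) as [G1 [G2|G2]]; [exfalso|lra].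
    destruct (Hback t Ht) as (p1 & t0 & K1 & K2 & K3 & K4 & K5).
    apply Rabs_bounds_lt in K1. specialize (H t0 K2). lra.
  - destruct (Rtotal_order t p0) as [G|[G|G]]; [exact G|subst t; tauto|exfalso].
    destruct H3 as (t' & Ht' & Hlt); [exists t; split; [exact Ht|lra]|].
    specialize (H t' Ht'). lra.
  - destruct (Hfar t Ht) as [G1 [G2|G2]]; [lra|exfalso].
    destruct (Hback t Ht) as (p1 & t0 & K1 & K2 & K3 & K4 & K5).
    apply Rabs_bounds_lt in K1. specialize (H t0 K2). lra.
Qed.

Lemma max_neq h p : lmax h p -> tr h <> tr p.
Proof.
  intros Hm E. apply (min_not_max h p); [|exact Hm].
  now apply caught_min.
Qed.

Lemma max_same_side h0 p0 : lmax h0 p0 -> exists e, 0 < e /\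
  forall h, Rabs (h - h0) < e -> same_side h p0 h0 p0.
Proof.
  intros Hm. destruct (max_branch_exists h0 p0 Hm) as (del & Hb & HM).
  apply (branch_same_side h0 p0 (fun _ => p0) del Hb (max_neq _ _ Hm)).
  exists del. split; [apply Hb|]. intros h Hh.
  split; intros HT; exfalso; (eapply min_not_max; [apply HT|]); auto.
Qed.

(** The delicate case, where the minimum [g h] and the maximum [p0] merge. If [g h] is trapped,
    walking to the merging point makes the puppy run to a trapped position on the other side of
    [p0], which persists over [h]; then neither [g h] nor [p0] is below or above the trap. If it is
    not trapped, nothing trapped separates the two. *)
Lemma pivot_same_side h0 p0 sg tau g del : pivot h0 p0 sg tau g del ->
  exists e, 0 < e /\ forall h p h' p',
    Rabs (h - h0) < e -> Rabs (p - p0) < e -> lext h p ->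
    Rabs (h' - h0) < e -> Rabs (p' - p0) < e -> lext h' p' -> same_side h p h' p'.
Proof.
  intros Hp. assert (Hp' := Hp).
  destruct Hp' as (Hsg & Htau & Hdel & Hl & Hg0 & Hside & Hnear & _ & Hrs).
  assert (Hcross : exists e, 0 < e /\ forall h, Rabs (h - h0) < e ->
            (exists r, run h0 p0 r /\ Trap h0 r) ->
            exists t, Trap h t /\ sg * (t - p0) < 0).
  { destruct (classic (exists r, run h0 p0 r /\ Trap h0 r)) as [(r & R1 & R2)|Hno].
    - specialize (Hrs r R1).
      assert (Hpos : 0 < Rabs (r - p0)) by (apply Rabs_pos_lt; intros E; rewrite E in Hrs; lra).
      destruct (trap_persists h0 r _ R2 Hpos) as (e & He & H).
      exists e. split; [exact He|]. intros h Hh _. destruct (H h Hh) as (t & Ht & Hd).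
      exists t. split; [exact Ht|].
      destruct Hsg as [-> | ->].
      + rewrite (Rabs_left (r - p0)) in Hd by lra. apply Rabs_bounds_lt in Hd. lra.
      + rewrite (Rabs_right (r - p0)) in Hd by lra. apply Rabs_bounds_lt in Hd. lra.
    - exists 1. split; [lra|]. tauto. }
  destruct Hcross as (e1 & He1 & H1).
  exists (Rmin e1 del). split; [now apply Rmin_glb_lt|].
  assert (Hmx : forall h p, Rabs (h - h0) < Rmin e1 del -> Rabs (p - p0) < Rmin e1 del ->
            lext h p -> 0 < tau * (h - h0) /\ same_side h p h p0).
  { intros h p Hh Hpp He. apply Rmin_Rgt_l in Hh, Hpp.
    destruct (Hnear h p ltac:(tauto) ltac:(tauto) He) as [Ht Hor]. split; [exact Ht|].
    destruct Hor as [-> | ->]; [|unfold same_side; tauto].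
    destruct (Hside h ltac:(tauto) Ht) as (S1 & S2 & S3 & S4 & _).
    unfold same_side, below_trap, above_trap.
    destruct (classic (Trap h (g h))) as [HT|HT].
    - destruct (trap_pivot h0 p0 sg tau g del Hp h) as (r & R1 & R2); try tauto.
      destruct (H1 h ltac:(tauto)) as (t & T1 & T2); [now exists r|].
      split; split; intros H; exfalso;
        pose proof (H _ HT); pose proof (H _ T1); destruct Hsg; subst sg; lra.
    - assert (Hsame : forall t, Trap h t -> (g h < t <-> p0 < t) /\ (t < g h <-> t < p0)).
      { intros t HTt. assert (N1 : t <> g h) by (intros ->; tauto).
        assert (N2 : t <> p0).
        { intros ->. apply (min_not_max h p0); [apply HTt|exact S3]. }
        assert (N3 : ~ (0 < sg * (t - p0) < sg * (g h - p0))).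
        { intros N. apply (S4 t N). left. apply HTt. }
        destruct Hsg; subst sg; split; split; intros; lra. }
      split; split; intros H t HTt; specialize (H t HTt); now apply (Hsame t HTt). }
  intros h p h' p' A1 A2 A3 B1 B2 B3.
  destruct (Hmx h p A1 A2 A3) as [At AS]. destruct (Hmx h' p' B1 B2 B3) as [Bt BS].
  apply same_side_trans with h p0; [exact AS|].
  apply same_side_trans with h' p0; [|now apply same_side_sym].
  apply Rmin_Rgt_l in A1, B1.
  set (a := Rmin h h'). set (b := Rmax h h').
  assert (Hab : forall x, a <= x <= b -> Rabs (x - h0) < del /\ 0 < tau * (x - h0)).
  { intros x Hx. destruct A1 as [_ A1], B1 as [_ B1].
    apply Rabs_bounds_lt in A1, B1.
    unfold a, b, Rmin, Rmax in Hx.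
    destruct (Rle_dec h h'); (split; [apply Rabs_def1; lra|]);
      destruct Htau; subst tau; lra. }
  (* All positions between [h] and [h'] are on the [tau] side, where [p0] remains a local maximum,
     so its position relative to the trap is locally constant. *)
  assert (Hloc : forall x, a <= x <= b -> exists d, 0 < d /\ forall u, a <= u <= b ->
             Rabs (u - x) < d -> same_side u p0 x p0).
  { intros x Hx. destruct (Hab x Hx) as [X1 X2].
    destruct (Hside x X1 X2) as (_ & _ & XM & _).
    destruct (max_same_side x p0 XM) as (e & He & H).
    exists e. split; [exact He|]. intros u _ Hu. now apply H. }
  assert (Ha : a <= h <= b) by (split; [apply Rmin_l|apply Rmax_l]).
  assert (Hb : a <= h' <= b) by (split; [apply Rmin_r|apply Rmax_r]).
  split.
  - apply (locally_constant (fun x => below_trap x p0) a b); auto.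
    intros x Hx. destruct (Hloc x Hx) as (d & Hd & H). exists d. split; [exact Hd|].
    intros u Hu Hux. apply (H u Hu Hux).
  - apply (locally_constant (fun x => above_trap x p0) a b); auto.
    intros x Hx. destruct (Hloc x Hx) as (d & Hd & H). exists d. split; [exact Hd|].
    intros u Hu Hux. apply (H u Hu Hux).
Qed.

(** At the two ends of the strip nothing is trapped nearby. Just after the human everything is below
    the trap, and just before her next turn everything is above it; these exclude the opposite
    position because a trap exists over every [h]. *)
Lemma same_side_local h0 p0 : h0 <= p0 <= h0 + INR n ->
  exists e, 0 < e /\ forall h p h' p',
    Rabs (h - h0) < e -> Rabs (p - p0) < e -> h < p < h + INR n -> lext h p ->
    Rabs (h' - h0) < e -> Rabs (p' - p0) < e -> h' < p' < h' + INR n -> lext h' p' ->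
    same_side h p h' p'.
Proof.
  intros Hp0. pose proof INRn_ge_3 as Hn.
  destruct (classic (tr h0 = tr p0)) as [E|E].
  - destruct (near_caught_win h0 p0 E) as (del & Hdel & Hw).
    assert (Hcase : p0 = h0 \/ p0 = h0 + INR n).
    { destruct (Rlt_dec p0 (h0 + INR n)) as [Hlt|Hge]; [left|right; lra].
      apply track_inj_near; [now symmetry|]. apply Rabs_def1; lra. }
    exists (Rmin del 1). split; [apply Rmin_glb_lt; lra|].
    assert (Hno : forall h t, Rabs (h - h0) < Rmin del 1 -> Rabs (t - p0) < Rmin del 1 ->
              ~ Trap h t).
    { intros h t H1 H2 (Hm & Hnw & _). apply Rmin_Rgt_l in H1, H2. apply Hnw.
      apply Hw; tauto. }
    pose proof (Rmin_l del 1) as L1. pose proof (Rmin_r del 1) as L2.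
    set (e := Rmin del 1) in *. clearbody e.
    destruct Hcase as [-> | ->].
    + assert (Hlow : forall h p, Rabs (h - h0) < e -> Rabs (p - h0) < e ->
                h < p < h + INR n -> below_trap h p /\ ~ above_trap h p).
      { intros h p H1 H2 H3.
        assert (Hb : below_trap h p).
        { intros t Ht. apply Rnot_le_lt. intros Hle. apply (Hno h t H1); [|exact Ht].
          destruct Ht as (_ & _ & Ht). apply Rabs_bounds_lt in H1, H2.
          apply Rabs_def1; lra. }
        split; [exact Hb|]. intros Ha. destruct (trap_everywhere Htrap h) as [t Ht].
        specialize (Hb t Ht). specialize (Ha t Ht). lra. }
      intros h p h' p' A1 A2 A3 _ B1 B2 B3 _.
      pose proof (Hlow h p A1 A2 A3). pose proof (Hlow h' p' B1 B2 B3).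
      unfold same_side. tauto.
    + assert (Hup : forall h p, Rabs (h - h0) < e -> Rabs (p - (h0 + INR n)) < e ->
                h < p < h + INR n -> above_trap h p /\ ~ below_trap h p).
      { intros h p H1 H2 H3.
        assert (Hb : above_trap h p).
        { intros t Ht. apply Rnot_le_lt. intros Hle. apply (Hno h t H1); [|exact Ht].
          destruct Ht as (_ & _ & Ht). apply Rabs_bounds_lt in H1, H2.
          apply Rabs_def1; lra. }
        split; [exact Hb|]. intros Ha. destruct (trap_everywhere Htrap h) as [t Ht].
        specialize (Hb t Ht). specialize (Ha t Ht). lra. }
      intros h p h' p' A1 A2 A3 _ B1 B2 B3 _.
      pose proof (Hup h p A1 A2 A3). pose proof (Hup h' p' B1 B2 B3).
      unfold same_side. tauto.
  - assert (Hbr : forall b del, branch h0 p0 b del ->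
       (exists e, 0 < e /\ forall h, Rabs (h - h0) < e -> same_side h (b h) h0 p0) ->
       exists e, 0 < e /\ forall h p h' p',
         Rabs (h - h0) < e -> Rabs (p - p0) < e -> h < p < h + INR n -> lext h p ->
         Rabs (h' - h0) < e -> Rabs (p' - p0) < e -> h' < p' < h' + INR n -> lext h' p' ->
         same_side h p h' p').
    { intros b del (Hdel & _ & _ & Hb) (e & He & H).
      exists (Rmin e del). split; [now apply Rmin_glb_lt|].
      intros h p h' p' A1 A2 _ A4 B1 B2 _ B4. apply Rmin_Rgt_l in A1, A2, B1, B2.
      destruct (Hb h ltac:(tauto)) as [_ U]. destruct (Hb h' ltac:(tauto)) as [_ U'].
      rewrite (U p) by tauto. rewrite (U' p') by tauto.
      apply same_side_trans with h0 p0; [apply H; tauto|].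
      apply same_side_sym. apply H; tauto. }
    destruct (classify h0 p0 E) as [Hm|[Hm|[(del & Hd & H)|(sg & tau & g & del & Hp)]]].
    + destruct (min_branch_exists h0 p0 Hm E) as (b & del & Hb).
      apply (Hbr b del (proj1 Hb)).
      apply (branch_same_side h0 p0 b del (proj1 Hb) E).
      now apply (trap_branch h0 p0 b del).
    + destruct (max_branch_exists h0 p0 Hm) as (del & Hb & HM).
      apply (Hbr (fun _ => p0) del Hb). now apply max_same_side.
    + exists del. split; [exact Hd|]. intros h p h' p' A1 A2 _ A4. exfalso.
      now apply (H h p).
    + destruct (pivot_same_side _ _ _ _ _ _ Hp) as (e & He & H).
      exists e. split; [exact He|]. intros. now apply H.
Qed.

Lemma same_side_uniform a b : exists d, 0 < d /\ forall h p h' p',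
  a <= h <= b -> h < p < h + INR n -> lext h p -> h' < p' < h' + INR n -> lext h' p' ->
  Rabs (h' - h) < d -> Rabs (p' - p) < d -> same_side h p h' p'.
Proof.
  pose proof INRn_ge_3 as Hn.
  (* The coordinates [h] and [p - h] turn the strip into a box. The factor 3 covers the return to
     [p], which costs two radii, and the step to the second configuration. *)
  destruct (lebesgue2 (fun s t del => forall h p h' p',
    Rabs (h - s) < 3 * del -> Rabs (p - (s + t)) < 3 * del -> h < p < h + INR n -> lext h p ->
    Rabs (h' - s) < 3 * del -> Rabs (p' - (s + t)) < 3 * del -> h' < p' < h' + INR n ->
    lext h' p' -> same_side h p h' p') a b 0 (INR n)) as (d & Hd & H).
  - intros s t _ Ht. destruct (same_side_local s (s + t) ltac:(lra)) as (e & He & H).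
    exists (e / 3). split; [lra|]. replace (3 * (e / 3)) with e by field. exact H.
  - exists d. split; [exact Hd|]. intros h p h' p' A1 A2 A3 B2 B3 C1 C2.
    destruct (H h (p - h) A1 ltac:(lra)) as (s & t & del & _ & _ & D1 & D2 & D3 & HP).
    apply Rabs_bounds_lt in C1, C2, D2, D3.
    apply HP; try assumption; apply Rabs_def1; lra.
Qed.

(** * The three pieces of the critical set and their separation *)

Lemma min_strict h p : lmin h p ->
  exists k, 0 < k /\ asc h p (p + k) /\ desc h (p - k) p.
Proof.
  intros Hm. destruct (interior_or_vertex p) as [[k Hk]|[k ->]].
  - apply (min_interior k) in Hm; [|exact Hk].
    exists (Rmin (p - IZR k) (IZR k + 1 - p)).
    pose proof (Rmin_l (p - IZR k) (IZR k + 1 - p)).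
    pose proof (Rmin_r (p - IZR k) (IZR k + 1 - p)).
    split; [apply Rmin_glb_lt; lra|]. split; intros x y Hx Hxy Hy.
    + apply (sqd_inc k); lra.
    + apply (sqd_dec k); lra.
  - pose proof (IZR_pred k) as Ek. apply min_vertex in Hm.
    exists 1. split; [lra|]. split; intros x y Hx Hxy Hy.
    + apply (sqd_inc k); lra.
    + apply (sqd_dec (k - 1)); lra.
Qed.

(** [Eq] is the middle piece: some trapped position is at or below [p] and some is at or above it.
    It contains the trap itself. *)
Definition position (c : comparison) (h p : R) : Prop :=
  match c with
  | Lt => below_trap h p
  | Gt => above_trap h p
  | Eq => ~ below_trap h p /\ ~ above_trap h p
  end.

Lemma position_total h p : exists c, position c h p.
Proof.
  destruct (classic (below_trap h p)); [now exists Lt|].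
  destruct (classic (above_trap h p)); [now exists Gt|]. now exists Eq.
Qed.

Lemma position_unique h p h' p' c c' :
  same_side h p h' p' -> position c h p -> position c' h' p' -> c = c'.
Proof.
  intros [S1 S2] H H'.
  assert (Hno : ~ (below_trap h' p' /\ above_trap h' p')).
  { intros [A B]. destruct (trap_everywhere Htrap h') as [t Ht].
    specialize (A t Ht). specialize (B t Ht). lra. }
  destruct c, c'; simpl in *; tauto.
Qed.

Context (h0 dL eps : R) (Hfar : farthest h0) (HdL : 0 < dL) (Heps : 0 < eps < 1).
Context (Huni : forall h p h' p', h0 - INR n <= h <= h0 + INR n ->
  h < p < h + INR n -> lext h p -> h' < p' < h' + INR n -> lext h' p' ->
  Rabs (h' - h) < dL -> Rabs (p' - p) < dL -> same_side h p h' p').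
Context (Hnz : forall h p, eps <= p - h <= INR n - eps ->
  bisec eps h p = 0 -> offset eps h p <> 0).

Notation Ee := (bisec eps).
Notation rho := (offset eps).

(** How a zero of [bisec], or a grid point near it, inherits a piece from an extremum. With [dL / 4]
    the witnesses of two points at distance below [dL / 2] are within [dL], so by [Huni] the
    inherited piece is unambiguous. *)
Definition near (c : comparison) (h p : R) : Prop :=
  exists h1 p1, Rabs (h1 - h) < dL / 4 /\ Rabs (p1 - p) < dL / 4 /\
    h0 - INR n <= h1 <= h0 + INR n /\ h1 < p1 < h1 + INR n /\
    lext h1 p1 /\ position c h1 p1.

Lemma near_unique c c' h p h' p' : near c h p -> near c' h' p' ->
  Rabs (h - h') < dL / 2 -> Rabs (p - p') < dL / 2 -> c = c'.
Proof.
  intros (h1 & p1 & A1 & A2 & A3 & A4 & A5 & A6) (h2 & p2 & B1 & B2 & B3 & B4 & B5 & B6) C1 C2.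
  apply (position_unique h1 p1 h2 p2); [|assumption|assumption].
  apply Rabs_bounds_lt in A1, A2, B1, B2, C1, C2.
  apply Huni; try assumption; apply Rabs_def1; lra.
Qed.

(** Local input for the compactness arguments: away from the zeros [bisec] exceeds the radius, so
    the hypothesis of being nearly zero fails. The human is given by the gap [w] between her and
    [p], which makes the strip a box. *)
Lemma bisec_away w p0 : Ee (p0 - w) p0 <> 0 -> exists del, 0 < del /\
  forall h p d, d <= del -> Rabs (p - h - w) < d -> Rabs (p - p0) < d -> d < Rabs (Ee h p).
Proof.
  intros Hn0. destruct (lip2_nonzero (Ee) (p0 - w) p0 (bisec_lip eps) Hn0)
    as (del & Hd & H).
  exists del. split; [exact Hd|]. intros h p d Hdd H1 H2.
  apply Rabs_bounds_lt in H1, H2.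
  destruct (H h p) as [G1 G2]; [apply Rabs_def1; lra|apply Rabs_def1; lra|].
  destruct (Rtotal_order (Ee (p0 - w) p0) 0) as [E|[E|E]]; [|tauto|].
  - specialize (G2 E). rewrite Rabs_left; lra.
  - specialize (G1 E). rewrite Rabs_right; lra.
Qed.

Lemma offset_differ w w' p0 : rho (p0 - w) p0 <> rho (p0 - w') p0 -> exists del, 0 < del /\
  forall h h' p d, d <= del ->
    Rabs (p - h - w) < d -> Rabs (p - h' - w') < d -> Rabs (p - p0) < d ->
    d < Rabs (rho h p - rho h' p) /\
    (rho (p0 - w) p0 < rho (p0 - w') p0 -> rho h p < rho h' p) /\
    (rho (p0 - w') p0 < rho (p0 - w) p0 -> rho h' p < rho h p).
Proof.
  intros Hd0. destruct (offset_lip eps) as (C & HC & _ & L).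
  set (x := rho (p0 - w) p0) in *. set (y := rho (p0 - w') p0) in *.
  assert (Hpos : 0 < Rabs (x - y)) by (apply Rabs_pos_lt; lra).
  exists (Rabs (x - y) / (6 * C + 2)).
  assert (Hdel : 0 < Rabs (x - y) / (6 * C + 2)) by (apply Rdiv_lt_0_compat; lra).
  split; [exact Hdel|]. set (del := Rabs (x - y) / (6 * C + 2)) in *.
  assert (E : Rabs (x - y) = del * (6 * C + 2)) by (unfold del; field; lra).
  intros h h' p d Hdd H1 H2 H3.
  assert (K : forall g z v, Rabs (p - g - v) < d -> z = rho (p0 - v) p0 ->
            - (3 * C * d) <= rho g p - z <= 3 * C * d).
  { intros g z v Hg ->. apply Rabs_bounds.
    eapply Rle_trans; [apply L|].
    replace (3 * C * d) with (C * (3 * d)) by ring. apply Rmult_le_compat_l; [exact HC|].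
    pose proof (Rabs_triang (p - p0) (- (p - g - v))) as Ht. rewrite Rabs_Ropp in Ht.
    replace (p - p0 + - (p - g - v)) with (g - (p0 - v)) in Ht by ring. lra. }
  specialize (K h x w H1 eq_refl) as K1. specialize (K h' y w' H2 eq_refl) as K2.
  assert (Hd0' : 0 < d).
  { pose proof (Rabs_pos (p - p0)). lra. }
  assert (Hm : C * d <= C * del) by (apply Rmult_le_compat_l; lra).
  destruct (Rtotal_order x y) as [Hxy|[Hxy|Hxy]]; [|tauto|].
  - rewrite Rabs_left in E by lra.
    split; [rewrite Rabs_left; lra|]. split; intros; lra.
  - rewrite Rabs_right in E by lra.
    split; [rewrite Rabs_right; lra|]. split; intros; lra.
Qed.

Lemma band_same w w' p0 : eps <= w <= INR n - eps -> eps <= w' <= INR n - eps ->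
  Ee (p0 - w) p0 = 0 -> Ee (p0 - w') p0 = 0 -> rho (p0 - w) p0 = rho (p0 - w') p0 -> w = w'.
Proof.
  intros Hw Hw' E1 E2 E3.
  assert (E : tr (p0 - w) = tr (p0 - w')) by (now apply (same_offset eps _ _ p0)).
  apply track_inj_near in E; [lra|]. apply Rabs_def1; lra.
Qed.

Lemma near_conflict w w' p0 : w = w' -> exists del, 0 < del /\
  forall h h' p c c' d, d <= del -> Rabs (p - h - w) < d -> Rabs (p - h' - w') < d ->
    Rabs (p - p0) < d -> near c h p -> near c' h' p -> c = c'.
Proof.
  intros <-. exists (dL / 4). split; [lra|]. intros h h' p c c' d Hd H1 H2 H3 N1 N2.
  apply Rabs_bounds_lt in H1, H2, H3.
  apply (near_unique c c' h p h' p N1 N2).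
  - apply Rabs_def1; lra.
  - rewrite Rminus_diag, Rabs_R0. lra.
Qed.

(** By compactness only pairs of exact zeros over one [p0] matter. Equal offsets mean equal gaps by
    [band_same], and then different pieces are too far apart to be both nearby; different offsets
    remain different nearby. *)
Lemma offsets_separated : exists eta, 0 < eta /\ forall h h' p c c',
  eps <= p - h <= INR n - eps -> eps <= p - h' <= INR n - eps -> h0 <= p <= h0 + INR n ->
  near c h p -> near c' h' p -> c <> c' ->
  Rabs (Ee h p) <= eta -> Rabs (Ee h' p) <= eta -> eta < Rabs (rho h p - rho h' p).
Proof.
  destruct (lebesgue3 (fun w w' p0 d => forall h h' p c c',
     Rabs (p - h - w) < d -> Rabs (p - h' - w') < d -> Rabs (p - p0) < d ->
     near c h p -> near c' h' p -> c <> c' ->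
     Rabs (Ee h p) <= d -> Rabs (Ee h' p) <= d -> d < Rabs (rho h p - rho h' p))
     eps (INR n - eps) eps (INR n - eps) h0 (h0 + INR n)) as (eta & He & H).
  - intros w w' p0 Hw Hw' Hp0.
    destruct (Req_dec (Ee (p0 - w) p0) 0) as [E1|E1].
    2:{ destruct (bisec_away w p0 E1) as (del & Hd & H). exists del. split; [exact Hd|].
        intros h h' p c c' A1 A2 A3 _ _ _ A4 A5. exfalso.
        specialize (H h p del (Rle_refl _) A1 A3). lra. }
    destruct (Req_dec (Ee (p0 - w') p0) 0) as [E2|E2].
    2:{ destruct (bisec_away w' p0 E2) as (del & Hd & H). exists del. split; [exact Hd|].
        intros h h' p c c' A1 A2 A3 _ _ _ A4 A5. exfalso.
        specialize (H h' p del (Rle_refl _) A2 A3). lra. }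
    destruct (Req_dec (rho (p0 - w) p0) (rho (p0 - w') p0)) as [E3|E3].
    + destruct (near_conflict w w' p0) as (del & Hd & H); [now apply band_same with p0|].
      exists del. split; [exact Hd|]. intros h h' p c c' A1 A2 A3 N1 N2 Hcc. exfalso.
      apply Hcc. now apply (H h h' p c c' del (Rle_refl _)).
    + destruct (offset_differ w w' p0 E3) as (del & Hd & H). exists del. split; [exact Hd|].
      intros h h' p c c' A1 A2 A3 _ _ _ _ _.
      now apply (H h h' p del (Rle_refl _)).
  - exists eta. split; [exact He|]. intros h h' p c c' A1 A2 A3 N1 N2 Hcc B1 B2.
    destruct (H (p - h) (p - h') p A1 A2 A3) as (w & w' & p0 & d & _ & _ & _ & Hd & D1 & D2 & D3 & HP).
    specialize (HP h h' p c c' D1 D2 D3 N1 N2 Hcc ltac:(lra) ltac:(lra)). lra.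
Qed.

Lemma offsets_nonzero : exists eta, 0 < eta /\ forall h p,
  eps <= p - h <= INR n - eps -> h0 <= p <= h0 + INR n ->
  Rabs (Ee h p) <= eta -> eta < Rabs (rho h p).
Proof.
  destruct (lebesgue2 (fun w p0 d => forall h p,
     Rabs (p - h - w) < d -> Rabs (p - p0) < d ->
     Rabs (Ee h p) <= d -> d < Rabs (rho h p))
     eps (INR n - eps) h0 (h0 + INR n)) as (eta & He & H).
  - intros w p0 Hw Hp0.
    destruct (Req_dec (Ee (p0 - w) p0) 0) as [E1|E1].
    2:{ destruct (bisec_away w p0 E1) as (del & Hd & H). exists del. split; [exact Hd|].
        intros h p A1 A2 A3. exfalso.
        specialize (H h p del (Rle_refl _) A1 A2). lra. }
    assert (E2 : rho (p0 - w) p0 <> 0) by (apply Hnz; [lra|exact E1]).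
    destruct (lip2_nonzero rho (p0 - w) p0 (offset_lip eps) E2) as (del & Hd & H).
    exists del. split; [exact Hd|]. intros h p A1 A2 _.
    apply Rabs_bounds_lt in A1, A2.
    destruct (H h p) as [G1 G2]; [apply Rabs_def1; lra|apply Rabs_def1; lra|].
    destruct (Rtotal_order (rho (p0 - w) p0) 0) as [E|[E|E]]; [|tauto|].
    + specialize (G2 E). rewrite Rabs_left; lra.
    + specialize (G1 E). rewrite Rabs_right; lra.
  - exists eta. split; [exact He|]. intros h p A1 A2 B1.
    destruct (H (p - h) p A1 A2) as (w & p0 & d & _ & _ & Hd & D1 & D2 & HP).
    specialize (HP h p D1 D2 ltac:(lra)). lra.
Qed.

(** Again reduced to exact zeros. A zero of another piece beyond the farthest point would put her
    strictly between the midpoint and a point of the track, at the ratio [x / y] of the two offsets,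
    against [farthest_last]. *)
Lemma offsets_last sg : (sg = 1 \/ sg = -1) -> exists eta, 0 < eta /\ forall h p c c',
  eps <= p - h0 <= INR n - eps -> eps <= p - h <= INR n - eps ->
  near c h0 p -> near c' h p -> c <> c' ->
  Rabs (Ee h0 p) <= eta -> Rabs (Ee h p) <= eta ->
  0 < sg * rho h0 p -> sg * rho h p <= sg * rho h0 p.
Proof.
  intros Hsg.
  destruct (lebesgue2 (fun w w' d => forall h p c c',
     Rabs (p - h0 - w) < d -> Rabs (p - h - w') < d ->
     near c h0 p -> near c' h p -> c <> c' ->
     Rabs (Ee h0 p) <= d -> Rabs (Ee h p) <= d ->
     0 < sg * rho h0 p -> sg * rho h p <= sg * rho h0 p)
     eps (INR n - eps) eps (INR n - eps)) as (eta & He & H).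
  - intros w w' Hw Hw'. set (p0 := h0 + w).
    assert (Ep : p0 - w = h0) by (unfold p0; ring).
    assert (Hclose : forall p d, Rabs (p - h0 - w) < d -> Rabs (p - p0) < d).
    { intros p d Hp. unfold p0. now replace (p - (h0 + w)) with (p - h0 - w) by ring. }
    destruct (Req_dec (Ee (p0 - w) p0) 0) as [E1|E1].
    2:{ destruct (bisec_away w p0 E1) as (del & Hd & H). exists del. split; [exact Hd|].
        intros h p c c' A1 A2 _ _ _ A4 A5. exfalso.
        specialize (H h0 p del (Rle_refl _) A1 (Hclose _ _ A1)). lra. }
    destruct (Req_dec (Ee (p0 - w') p0) 0) as [E2|E2].
    2:{ destruct (bisec_away w' p0 E2) as (del & Hd & H). exists del. split; [exact Hd|].
        intros h p c c' A1 A2 _ _ _ A4 A5. exfalso.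
        specialize (H h p del (Rle_refl _) A2 (Hclose _ _ A1)). lra. }
    destruct (Req_dec (rho (p0 - w) p0) (rho (p0 - w') p0)) as [E3|E3].
    + destruct (near_conflict w w' p0) as (del & Hd & H); [now apply band_same with p0|].
      exists del. split; [exact Hd|]. intros h p c c' A1 A2 N1 N2 Hcc. exfalso.
      apply Hcc. apply (H h0 h p c c' del (Rle_refl _)); auto.
    + assert (N1 : rho (p0 - w) p0 <> 0) by (apply Hnz; [lra|exact E1]).
      assert (N2 : rho (p0 - w') p0 <> 0) by (apply Hnz; [lra|exact E2]).
      destruct (lip2_nonzero rho (p0 - w) p0 (offset_lip eps) N1) as (d1 & Hd1 & H1).
      destruct (offset_differ w w' p0 E3) as (d2 & Hd2 & H2).
      exists (Rmin d1 d2). split; [now apply Rmin_glb_lt|].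
      pose proof (Rmin_l d1 d2) as L1. pose proof (Rmin_r d1 d2) as L2.
      set (d := Rmin d1 d2) in *.
      intros h p c c' A1 A2 _ _ _ _ _ Hpos.
      pose proof (Hclose _ _ A1) as A3.
      destruct (H2 h0 h p d L2 A1 A2 A3) as (_ & G1 & G2).
      destruct (H1 h0 p) as [K1 K2].
      { rewrite Ep, Rminus_diag, Rabs_R0. lra. }
      { lra. }
      set (x := rho (p0 - w) p0) in *. set (y := rho (p0 - w') p0) in *.
      assert (Hx : 0 < sg * x).
      { destruct (Rtotal_order x 0) as [Hx|[Hx|Hx]]; [specialize (K2 Hx)|tauto|specialize (K1 Hx)];
          destruct Hsg; subst sg; lra. }
      destruct (Rlt_dec (sg * y) (sg * x)) as [Hlt|Hge].
      { destruct Hsg; subst sg; [specialize (G2 ltac:(lra))|specialize (G1 ltac:(lra))]; lra. }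
      exfalso.
      assert (Hy : sg * x < sg * y) by (destruct Hsg; subst sg; lra).
      apply (farthest_last eps h0 (p0 - w') p0 (x / y) Heps Hfar).
      * rewrite <- Ep. exact E1.
      * exact E2.
      * assert (Eq : x / y = (sg * x) / (sg * y)).
        { field. split; [exact N2|]. destruct Hsg; subst sg; lra. }
        rewrite Eq. split; [apply Rdiv_lt_0_compat; lra|].
        apply Rmult_lt_reg_r with (sg * y); [lra|].
        unfold Rdiv. rewrite Rmult_assoc, Rinv_l by lra. lra.
      * rewrite <- Ep. fold x y. field. exact N2.
      * exact N2.
  - exists eta. split; [exact He|]. intros h p c c' A1 A2 N1 N2 Hcc B1 B2 B3.
    destruct (H (p - h0) (p - h) A1 A2) as (w & w' & d & _ & _ & Hd & D1 & D2 & HP).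
    now apply (HP h p c c' D1 D2 N1 N2 Hcc ltac:(lra) ltac:(lra)).
Qed.

(** At either boundary one end of the chord is the human's own position, at distance zero. The sign
    of [bisec] is thus fixed there, and zeros cannot leave the strip. *)
Lemma bisec_on_band a b : exists eta, 0 < eta /\ forall h, a <= h <= b ->
  eta <= Ee h (h + eps) /\ Ee h (h + INR n - eps) <= - eta.
Proof.
  pose proof INRn_ge_3 as Hn.
  assert (Hpos : forall h, 0 < Ee h (h + eps)).
  { intros h. unfold bisec. replace (h + eps - eps) with h by ring.
    rewrite (sqd_refl h h eq_refl).
    destruct (sqd_nonneg h (h + eps + eps)) as [H|H]; [lra|exfalso].
    symmetry in H. apply sqd_zero in H. apply track_inj_near in H; [lra|].
    apply Rabs_def1; lra. }
  assert (Hneg : forall h, Ee h (h + INR n - eps) < 0).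
  { intros h. unfold bisec. replace (h + INR n - eps + eps) with (h + INR n) by ring.
    rewrite (sqd_refl h (h + INR n)) by (apply track_self_shift).
    destruct (sqd_nonneg h (h + INR n - eps - eps)) as [H|H]; [lra|exfalso].
    symmetry in H. apply sqd_zero in H. apply track_inj_near in H; [lra|].
    apply Rabs_def1; lra. }
  destruct (lebesgue1 (fun x d => forall h, Rabs (h - x) < d ->
     d <= Ee h (h + eps) /\ Ee h (h + INR n - eps) <= - d) a b) as (eta & He & H).
  - intros x _.
    destruct (lip2_nonzero Ee x (x + eps) (bisec_lip eps)) as (d1 & Hd1 & H1).
    { specialize (Hpos x). lra. }
    destruct (lip2_nonzero Ee x (x + INR n - eps) (bisec_lip eps)) as (d2 & Hd2 & H2).
    { specialize (Hneg x). lra. }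
    exists (Rmin d1 d2). split; [now apply Rmin_glb_lt|]. intros h Hh.
    pose proof (Rmin_l d1 d2). pose proof (Rmin_r d1 d2).
    destruct (H1 h (h + eps)) as [G1 _]; [lra| |].
    { replace (h + eps - (x + eps)) with (h - x) by ring. lra. }
    destruct (H2 h (h + INR n - eps)) as [_ G2]; [lra| |].
    { replace (h + INR n - eps - (x + INR n - eps)) with (h - x) by ring. lra. }
    specialize (G1 (Hpos x)). specialize (G2 (Hneg x)). lra.
  - exists eta. split; [exact He|]. intros h Hh.
    destruct (H h Hh) as (x & d & _ & Hd & D1 & HP). specialize (HP h D1). lra.
Qed.

(** * Sign changes of [bisec] on a grid *)

Definition decide (P : Prop) : bool := if excluded_middle_informative P then true else false.

Lemma decide_spec P : decide P = true <-> P.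
Proof. unfold decide. destruct (excluded_middle_informative P); split; congruence || tauto. Qed.

Lemma decide_false P : decide P = false <-> ~ P.
Proof. unfold decide. destruct (excluded_middle_informative P); split; congruence || tauto. Qed.

Lemma ivt_sign g a b : a <= b -> lip g ->
  decide (0 <= g a) <> decide (0 <= g b) -> exists t, a <= t <= b /\ g t = 0.
Proof.
  intros Hab Hl Hne.
  destruct (Rtotal_order (g a) 0) as [Ha|[Ha|Ha]].
  - destruct (Rle_dec 0 (g b)) as [Hb|Hb].
    + destruct (ivt_zero (fun t => -1 * g t) a b) as (t & Ht & E); try lra.
      * now apply lip_scale.
      * exists t. split; [exact Ht|lra].
    + exfalso. apply Hne.
      rewrite (proj2 (decide_false (0 <= g a))) by lra.
      now rewrite (proj2 (decide_false (0 <= g b))) by lra.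
  - exists a. split; [lra|exact Ha].
  - destruct (Rle_dec (g b) 0) as [Hb|Hb].
    + apply ivt_zero; auto.
    + exfalso. apply Hne.
      rewrite (proj2 (decide_spec (0 <= g a))) by lra.
      now rewrite (proj2 (decide_spec (0 <= g b))) by lra.
Qed.

Lemma lip2_left f p : lip2 f -> lip (fun h => f h p).
Proof.
  intros (C & HC & _ & L). exists C. split; [exact HC|]. intros s t. specialize (L s p t p).
  now rewrite Rminus_diag, Rabs_R0, Rplus_0_r in L.
Qed.

Lemma lip2_right f h : lip2 f -> lip (fun p => f h p).
Proof.
  intros (C & HC & _ & L). exists C. split; [exact HC|]. intros s t. specialize (L h s h t).
  now rewrite Rminus_diag, Rabs_R0, Rplus_0_l in L.
Qed.

Context (HepsL : eps < dL / 8).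
Context (C eta : R) (HC : 0 <= C) (Heta : 0 < eta).
Context (HE : forall h p h' p', Rabs (Ee h p - Ee h' p') <= C * (Rabs (h - h') + Rabs (p - p'))).
Context (Hrho : forall h p h' p', Rabs (rho h p - rho h' p') <= C * (Rabs (h - h') + Rabs (p - p'))).
Context (Hsep : forall h h' p c c',
  eps <= p - h <= INR n - eps -> eps <= p - h' <= INR n - eps -> h0 <= p <= h0 + INR n ->
  near c h p -> near c' h' p -> c <> c' ->
  Rabs (Ee h p) <= eta -> Rabs (Ee h' p) <= eta -> eta < Rabs (rho h p - rho h' p)).
Context (Hrnz : forall h p, eps <= p - h <= INR n - eps -> h0 <= p <= h0 + INR n ->
  Rabs (Ee h p) <= eta -> eta < Rabs (rho h p)).
Context (Hlast : forall sg, sg = 1 \/ sg = -1 -> forall h p c c',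
  eps <= p - h0 <= INR n - eps -> eps <= p - h <= INR n - eps ->
  near c h0 p -> near c' h p -> c <> c' ->
  Rabs (Ee h0 p) <= eta -> Rabs (Ee h p) <= eta ->
  0 < sg * rho h0 p -> sg * rho h p <= sg * rho h0 p).
Context (Hband : forall h, h0 - INR n <= h <= h0 + INR n ->
  eta <= Ee h (h + eps) /\ Ee h (h + INR n - eps) <= - eta).

(** [N] steps make a turn and [m] steps make [eps], so both boundaries of the strip run through grid
    points. The mesh bounds keep the variation over a square small against [eta] and, together with
    [eps], small against [dL]. *)
Context (N m : nat) (step : R) (Hstep : 0 < step).
Context (HN : INR N * step = INR n) (Hm : INR m * step = eps).
Context (Hsmall : 8 * C * step < eta) (HstepL : step < dL / 16).

(** The human ranges over two turns with [h0] at column [N], the puppy over the one turn after [h0];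
    two turns are required because the strip is slanted. *)
Definition hh (i : nat) : R := h0 - INR n + INR i * step.
Definition pp (j : nat) : R := h0 + INR j * step.
Definition inside (i j : nat) : bool := ((i + m <=? j + N) && (j + m <=? i))%nat.
Definition sgn (i j : nat) : bool := decide (0 <= Ee (hh i) (pp j)).
Definition wh (i j : nat) : bool := inside i j && inside (S i) j && xorb (sgn i j) (sgn (S i) j).
Definition wv (i j : nat) : bool := inside i j && inside i (S j) && xorb (sgn i j) (sgn i (S j)).
(** Piece and side of the chord, read at the first end of an edge; around a square with marks
    [flag_constant] makes the choice of the corner immaterial. *)
Definition flag (c : comparison) (sg : R) (i j : nat) : bool :=
  decide (near c (hh i) (pp j)) && decide (0 < sg * rho (hh i) (pp j)).
Definition uh c sg i j : bool := wh i j && flag c sg i j.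
Definition uv c sg i j : bool := wv i j && flag c sg i j.
Definition gt (sg : R) (j y x : nat) : bool :=
  decide (sg * rho (hh x) (pp j) < sg * rho (hh y) (pp j)).

Lemma inside_spec i j : inside i j = true <-> (i + m <= j + N)%nat /\ (j + m <= i)%nat.
Proof.
  unfold inside. rewrite andb_true_iff, !Nat.leb_le. tauto.
Qed.

Lemma INR_step_le a b : (a <= b)%nat -> INR a * step <= INR b * step.
Proof. intros H. apply Rmult_le_compat_r; [lra|now apply le_INR]. Qed.

Lemma pp_hh i j : pp j - hh i = INR n + INR j * step - INR i * step.
Proof. unfold pp, hh. ring. Qed.

Lemma hh_S i : hh (S i) = hh i + step.
Proof. unfold hh. rewrite S_INR. ring. Qed.

Lemma pp_S j : pp (S j) = pp j + step.
Proof. unfold pp. rewrite S_INR. ring. Qed.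

Lemma hh_N : hh N = h0.
Proof. unfold hh. lra. Qed.

Lemma inside_band i j : inside i j = true -> eps <= pp j - hh i <= INR n - eps.
Proof.
  intros H. apply inside_spec in H. destruct H as [H1 H2].
  apply INR_step_le in H1, H2. rewrite 2!plus_INR in H1. rewrite plus_INR in H2.
  rewrite pp_hh. lra.
Qed.

Lemma hh_box i : (i <= 2 * N)%nat -> h0 - INR n <= hh i <= h0 + INR n.
Proof.
  intros H. apply INR_step_le in H. rewrite mult_INR in H. simpl in H.
  unfold hh. pose proof (pos_INR i). assert (0 <= INR i * step) by (apply Rmult_le_pos; lra).
  lra.
Qed.

Lemma pp_box j : (j <= N)%nat -> h0 <= pp j <= h0 + INR n.
Proof.
  intros H. apply INR_step_le in H. unfold pp.
  pose proof (pos_INR j). assert (0 <= INR j * step) by (apply Rmult_le_pos; lra). lra.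
Qed.

Lemma Ee_close h p h' p' a : Rabs (h - h') + Rabs (p - p') <= a * step ->
  Rabs (Ee h p - Ee h' p') <= a * (C * step).
Proof.
  intros H. eapply Rle_trans; [apply HE|].
  replace (a * (C * step)) with (C * (a * step)) by ring. now apply Rmult_le_compat_l.
Qed.

Lemma rho_close h p h' p' a : Rabs (h - h') + Rabs (p - p') <= a * step ->
  Rabs (rho h p - rho h' p') <= a * (C * step).
Proof.
  intros H. eapply Rle_trans; [apply Hrho|].
  replace (a * (C * step)) with (C * (a * step)) by ring. now apply Rmult_le_compat_l.
Qed.

Lemma Cstep_nonneg : 0 <= C * step.
Proof. apply Rmult_le_pos; lra. Qed.

(** The sign is known on the boundary layer of the strip and on the next one inwards. Hence no
    marked edge touches the boundary, and every square next to a mark lies wholly inside. *)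
Lemma sgn_low i j : (i <= 2 * N)%nat -> (j + N = i + m \/ j + N = i + m + 1)%nat ->
  sgn i j = true.
Proof.
  intros Hi Hj. apply decide_spec. pose proof Cstep_nonneg as HCs.
  destruct (Hband (hh i) (hh_box i Hi)) as [H1 _].
  assert (E : pp j = hh i + eps \/ pp j = hh i + eps + step).
  { destruct Hj as [Hj|Hj]; apply (f_equal INR) in Hj; rewrite !plus_INR in Hj;
      apply (f_equal (fun x => x * step)) in Hj; unfold pp, hh; simpl in Hj; lra. }
  assert (Hc : Rabs (Ee (hh i) (pp j) - Ee (hh i) (hh i + eps)) <= 1 * (C * step)).
  { apply Ee_close. rewrite Rminus_diag, Rabs_R0.
    destruct E as [-> | ->].
    - rewrite Rminus_diag, Rabs_R0. lra.
    - rewrite Rabs_plus_sub; lra. }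
  apply Rabs_bounds in Hc. lra.
Qed.

Lemma sgn_high i j : (i <= 2 * N)%nat -> (j + m = i \/ j + m + 1 = i)%nat ->
  sgn i j = false.
Proof.
  intros Hi Hj. apply decide_false. pose proof Cstep_nonneg as HCs.
  destruct (Hband (hh i) (hh_box i Hi)) as [_ H1].
  assert (E : pp j = hh i + INR n - eps \/ pp j = hh i + INR n - eps - step).
  { destruct Hj as [Hj|Hj]; apply (f_equal INR) in Hj; rewrite !plus_INR in Hj;
      apply (f_equal (fun x => x * step)) in Hj; unfold pp, hh; simpl in Hj; lra. }
  assert (Hc : Rabs (Ee (hh i) (pp j) - Ee (hh i) (hh i + INR n - eps)) <= 1 * (C * step)).
  { apply Ee_close. rewrite Rminus_diag, Rabs_R0.
    destruct E as [-> | ->].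
    - rewrite Rminus_diag, Rabs_R0. lra.
    - rewrite Rabs_minus_sub; lra. }
  apply Rabs_bounds in Hc. lra.
Qed.

Lemma wh_strict i j : (i < 2 * N)%nat -> wh i j = true ->
  (i + m + 2 <= j + N)%nat /\ (j + m + 1 <= i)%nat.
Proof.
  intros Hi H. unfold wh in H. rewrite !andb_true_iff, !inside_spec in H.
  destruct H as [[[A1 A2] [A3 A4]] A5].
  destruct (Nat.eq_dec (j + N) (i + m + 1)) as [E|E].
  { rewrite (sgn_low i j), (sgn_low (S i) j) in A5 by lia. discriminate. }
  destruct (Nat.eq_dec (j + m) i) as [E'|E'].
  { rewrite (sgn_high i j), (sgn_high (S i) j) in A5 by lia. discriminate. }
  lia.
Qed.

Lemma wv_strict i j : (i <= 2 * N)%nat -> wv i j = true ->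
  (i + m + 1 <= j + N)%nat /\ (j + m + 2 <= i)%nat.
Proof.
  intros Hi H. unfold wv in H. rewrite !andb_true_iff, !inside_spec in H.
  destruct H as [[[A1 A2] [A3 A4]] A5].
  destruct (Nat.eq_dec (j + N) (i + m)) as [E|E].
  { rewrite (sgn_low i j), (sgn_low i (S j)) in A5 by lia. discriminate. }
  destruct (Nat.eq_dec (j + m + 1) i) as [E'|E'].
  { rewrite (sgn_high i j), (sgn_high i (S j)) in A5 by lia. discriminate. }
  lia.
Qed.

Definition marks (i j : nat) : Prop := marked wh wv i j.

Lemma marks_inside i j x r : (i < 2 * N)%nat -> marks i j ->
  same_or_next i x -> same_or_next j r -> inside x r = true.
Proof.
  intros Hi Hm' Hx Hrr. apply inside_spec.
  destruct Hm' as [H|[H|[H|H]]];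
    [apply wh_strict in H|apply wh_strict in H|apply wv_strict in H|apply wv_strict in H];
    try lia; destruct Hx, Hrr; subst; lia.
Qed.

Lemma edge_zero_h i j : xorb (sgn i j) (sgn (S i) j) = true ->
  exists h, hh i <= h <= hh (S i) /\ Ee h (pp j) = 0.
Proof.
  intros H. apply (ivt_sign (fun h => Ee h (pp j))).
  - rewrite hh_S. lra.
  - apply lip2_left, bisec_lip.
  - intros E. unfold sgn in H. rewrite E in H. rewrite xorb_nilpotent in H. discriminate.
Qed.

Lemma edge_zero_v i j : xorb (sgn i j) (sgn i (S j)) = true ->
  exists p, pp j <= p <= pp (S j) /\ Ee (hh i) p = 0.
Proof.
  intros H. apply (ivt_sign (fun p => Ee (hh i) p)).
  - rewrite pp_S. lra.
  - apply lip2_right, bisec_lip.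
  - intros E. unfold sgn in H. rewrite E in H. rewrite xorb_nilpotent in H. discriminate.
Qed.

Lemma marks_zero i j : marks i j -> exists h p,
  hh i <= h <= hh (S i) /\ pp j <= p <= pp (S j) /\ Ee h p = 0.
Proof.
  pose proof (hh_S i). pose proof (pp_S j).
  intros [H1|[H1|[H1|H1]]]; unfold wh, wv in H1; apply andb_true_iff in H1;
    destruct H1 as [_ H1].
  - destruct (edge_zero_h _ _ H1) as (h & Hh & E). exists h, (pp j). repeat split; lra.
  - destruct (edge_zero_h _ _ H1) as (h & Hh & E). exists h, (pp (S j)). repeat split; lra.
  - destruct (edge_zero_v _ _ H1) as (p & Hp & E). exists (hh i), p. repeat split; lra.
  - destruct (edge_zero_v _ _ H1) as (p & Hp & E). exists (hh (S i)), p. repeat split; lra.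
Qed.

Definition vertex_info (c : comparison) (sg : R) (x r : nat) : Prop :=
  inside x r = true /\ near c (hh x) (pp r) /\ Rabs (Ee (hh x) (pp r)) <= eta /\
  0 < sg * rho (hh x) (pp r).

Lemma square_zero_near i j h p p' c : (i < 2 * N)%nat -> marks i j ->
  hh i <= h <= hh (S i) -> pp j <= p <= pp (S j) ->
  p - eps < p' < p + eps -> lext h p' -> position c h p' ->
  forall x r, same_or_next i x -> same_or_next j r -> near c (hh x) (pp r).
Proof.
  intros Hi Hm' Hh Hp Hp' He Hc x r Hx Hrr.
  pose proof (hh_S i) as ES. pose proof (pp_S j) as EP.
  assert (I1 : inside (S i) j = true)
    by (apply (marks_inside i j); auto; [now right|now left]).
  assert (I2 : inside i (S j) = true)
    by (apply (marks_inside i j); auto; [now left|now right]).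
  apply inside_band in I1, I2.
  pose proof (hh_box i ltac:(lia)). pose proof (hh_box (S i) ltac:(lia)).
  exists h, p'. repeat split; try lra; try assumption.
  - destruct Hx; subst x; apply Rabs_def1; lra.
  - destruct Hrr; subst r; apply Rabs_def1; lra.
Qed.

(** A marked square has a true zero on its border, with an extremum within [eps] whose piece all
    corners inherit. At the corners the offset exceeds [eta] in absolute value but varies by less,
    so they also share the side. *)
Lemma square_info i j : (i < 2 * N)%nat -> (j < N)%nat -> marks i j ->
  exists c sg, (sg = 1 \/ sg = -1) /\
    forall x r, same_or_next i x -> same_or_next j r -> vertex_info c sg x r.
Proof.
  intros Hi Hj Hm'. pose proof Cstep_nonneg as HCs.
  pose proof (hh_S i) as ES. pose proof (pp_S j) as EP.
  destruct (marks_zero i j Hm') as (h & p & Hh & Hp & E).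
  destruct (bisec_zero_ext eps h p ltac:(lra) E) as (p' & Hp' & He).
  destruct (position_total h p') as [c Hc].
  pose proof (square_zero_near i j h p p' c Hi Hm' Hh Hp Hp' He Hc) as Hn.
  assert (HEe : forall x r, same_or_next i x -> same_or_next j r ->
            Rabs (Ee (hh x) (pp r)) <= eta).
  { intros x r Hx Hrr.
    assert (H : Rabs (Ee (hh x) (pp r) - Ee h p) <= 2 * (C * step)).
    { apply Ee_close.
      assert (Rabs (hh x - h) <= step) by (destruct Hx; subst x; apply Rabs_le; lra).
      assert (Rabs (pp r - p) <= step) by (destruct Hrr; subst r; apply Rabs_le; lra).
      lra. }
    rewrite E, Rminus_0_r in H. lra. }
  assert (Hins : forall x r, same_or_next i x -> same_or_next j r -> inside x r = true)
    by (intros; now apply (marks_inside i j)).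
  assert (Hrb : forall x r, same_or_next i x -> same_or_next j r ->
            eta < Rabs (rho (hh x) (pp r))).
  { intros x r Hx Hrr. apply Hrnz.
    - apply inside_band. now apply Hins.
    - apply pp_box. destruct Hrr; subst; lia.
    - now apply HEe. }
  pose proof (Hrb i j (or_introl eq_refl) (or_introl eq_refl)) as Hb0.
  assert (Hclose : forall x r, same_or_next i x -> same_or_next j r ->
            Rabs (rho (hh x) (pp r) - rho (hh i) (pp j)) <= 2 * (C * step)).
  { intros x r Hx Hrr. apply rho_close.
    assert (Rabs (hh x - hh i) <= step) by (destruct Hx; subst x; apply Rabs_le; lra).
    assert (Rabs (pp r - pp j) <= step) by (destruct Hrr; subst r; apply Rabs_le; lra).
    lra. }
  exists c, (if Rlt_dec 0 (rho (hh i) (pp j)) then 1 else -1).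
  split; [destruct (Rlt_dec 0 (rho (hh i) (pp j))); auto|].
  intros x r Hx Hrr. repeat split; auto.
  specialize (Hclose x r Hx Hrr). apply Rabs_bounds in Hclose.
  destruct (Rlt_dec 0 (rho (hh i) (pp j))) as [H|H].
  - rewrite Rabs_right in Hb0 by lra. lra.
  - rewrite Rabs_left1 in Hb0 by lra. lra.
Qed.

Lemma near_same_vertex c c' x r : near c (hh x) (pp r) -> near c' (hh x) (pp r) -> c = c'.
Proof.
  intros H H'. apply (near_unique c c' _ _ _ _ H H');
    rewrite Rminus_diag, Rabs_R0; lra.
Qed.

Lemma flag_spec c sg x r : flag c sg x r = true <->
  near c (hh x) (pp r) /\ 0 < sg * rho (hh x) (pp r).
Proof. unfold flag. now rewrite andb_true_iff, !decide_spec. Qed.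

Lemma flag_constant c sg i j : (i < 2 * N)%nat -> (j < N)%nat -> marks i j ->
  (sg = 1 \/ sg = -1) -> forall x r, same_or_next i x -> same_or_next j r ->
  flag c sg x r = flag c sg i j.
Proof.
  intros Hi Hj Hm' Hsg x r Hx Hrr.
  destruct (square_info i j Hi Hj Hm') as (c0 & sg0 & Hsg0 & Hinf).
  assert (Hfl : forall x r, same_or_next i x -> same_or_next j r ->
            (flag c sg x r = true <-> c = c0 /\ sg = sg0)).
  { intros x' r' Hx' Hr'. destruct (Hinf x' r' Hx' Hr') as (_ & K1 & _ & K2).
    rewrite flag_spec. split.
    - intros [K3 K4]. split; [now apply (near_same_vertex c c0 x' r')|].
      destruct Hsg, Hsg0; subst sg sg0; auto; lra.
    - intros [-> ->]. auto. }
  apply eq_true_iff_eq. rewrite (Hfl x r Hx Hrr).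
  symmetry. apply Hfl; now left.
Qed.

(** A cyclic sequence of four signs changes an even number of times, and the flag is constant around
    a square with marks. *)
Lemma curves_closed c sg : (sg = 1 \/ sg = -1) -> (0 < m)%nat ->
  closed_curve N (2 * N) (N - m) (uh c sg) (uv c sg).
Proof.
  intros Hsg Hm0. unfold closed_curve, uh, uv. repeat split.
  - intros i j Hi Hj.
    destruct (wh i j || wh i (S j) || wv i j || wv (S i) j) eqn:E.
    + assert (Hm' : marks i j).
      { unfold marks, marked. rewrite !orb_true_iff in E. tauto. }
      pose proof (flag_constant c sg i j Hi ltac:(lia) Hm' Hsg) as Hf.
      rewrite (Hf i (S j)), (Hf (S i) j) by (try (now left); now right).
      assert (Hins : forall x r, same_or_next i x -> same_or_next j r -> inside x r = true)
        by (intros; now apply (marks_inside i j)).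
      unfold wh, wv. rewrite !Hins by (try (now left); now right). simpl.
      destruct (sgn i j), (sgn (S i) j), (sgn i (S j)), (sgn (S i) (S j)), (flag c sg i j);
        reflexivity.
    + rewrite !orb_false_iff in E. destruct E as (((-> & ->) & ->) & ->). reflexivity.
  - intros j Hj. unfold wv. replace (inside 0 j) with false; [reflexivity|].
    symmetry. apply not_true_iff_false. rewrite inside_spec. lia.
  - intros j Hj. unfold wv. replace (inside (2 * N) j) with false; [reflexivity|].
    symmetry. apply not_true_iff_false. rewrite inside_spec. lia.
  - intros i Hi. unfold wh. replace (inside (S i) 0) with false; [now rewrite andb_false_r|].
    symmetry. apply not_true_iff_false. rewrite inside_spec. lia.
  - intros i Hi. unfold wh. replace (inside i (N - m)) with false; [reflexivity|].
    symmetry. apply not_true_iff_false. rewrite inside_spec. lia.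
Qed.

Lemma marked_info c sg i j : (i < 2 * N)%nat -> (j < N)%nat -> (sg = 1 \/ sg = -1) ->
  marked (uh c sg) (uv c sg) i j ->
  forall x r, same_or_next i x -> same_or_next j r -> vertex_info c sg x r.
Proof.
  intros Hi Hj Hsg Hm'.
  assert (Hmk : marks i j /\ exists x r, same_or_next i x /\ same_or_next j r /\ flag c sg x r = true).
  { unfold marks, marked, uh, uv in *. rewrite !andb_true_iff in Hm'.
    destruct Hm' as [[A B]|[[A B]|[[A B]|[A B]]]]; (split; [tauto|]).
    - exists i, j. repeat split; auto; now left.
    - exists i, (S j). repeat split; auto; [now left|now right].
    - exists i, j. repeat split; auto; now left.
    - exists (S i), j. repeat split; auto; [now right|now left]. }
  destruct Hmk as [Hmk (x0 & r0 & Hx0 & Hr0 & Hf)].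
  destruct (square_info i j Hi Hj Hmk) as (c0 & sg0 & Hsg0 & Hinf).
  apply flag_spec in Hf. destruct Hf as [F1 F2].
  destruct (Hinf x0 r0 Hx0 Hr0) as (_ & K1 & _ & K2).
  assert (c = c0) by (now apply (near_same_vertex c c0 x0 r0)). subst c0.
  assert (sg = sg0) by (destruct Hsg, Hsg0; subst sg sg0; auto; lra). subst sg0.
  exact Hinf.
Qed.

(** Between the two pieces the offsets differ by more than [eta], while this difference varies by at
    most [4 * C * step], less than [eta / 2]; so their order is the same at all corners. *)
Lemma curves_separated c c' sg : c <> c' -> (sg = 1 \/ sg = -1) ->
  separated (2 * N) (N - m) (gt sg) (uh c sg) (uv c sg) (uh c' sg) (uv c' sg).
Proof.
  intros Hcc Hsg i i' j Hi Hi' Hj Hm1 Hm2. pose proof Cstep_nonneg as HCs.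
  pose proof (marked_info c sg i j Hi ltac:(lia) Hsg Hm1) as I1.
  pose proof (marked_info c' sg i' j Hi' ltac:(lia) Hsg Hm2) as I2.
  set (f := fun x y r => sg * rho (hh y) (pp r) - sg * rho (hh x) (pp r)).
  assert (Hbig : forall x y r, same_or_next i x -> same_or_next i' y -> same_or_next j r ->
            eta < Rabs (f x y r)).
  { intros x y r Hx Hy Hrr.
    destruct (I1 x r Hx Hrr) as (A1 & A2 & A3 & A4).
    destruct (I2 y r Hy Hrr) as (B1 & B2 & B3 & B4).
    replace (Rabs (f x y r)) with (Rabs (rho (hh x) (pp r) - rho (hh y) (pp r))).
    - apply (Hsep _ _ _ c c'); auto using inside_band.
      apply pp_box. destruct Hrr; subst; lia.
    - unfold f. destruct Hsg; subst sg.
      + rewrite <- Rabs_Ropp. f_equal. ring.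
      + f_equal. ring. }
  assert (Hclose : forall x y r, same_or_next i x -> same_or_next i' y -> same_or_next j r ->
            Rabs (f x y r - f i i' j) <= 4 * (C * step)).
  { intros x y r Hx Hy Hrr. pose proof (hh_S i). pose proof (hh_S i'). pose proof (pp_S j).
    assert (Ap : Rabs (pp r - pp j) <= step) by (destruct Hrr; subst r; apply Rabs_le; lra).
    assert (K1 : Rabs (rho (hh x) (pp r) - rho (hh i) (pp j)) <= 2 * (C * step)).
    { apply rho_close.
      assert (Rabs (hh x - hh i) <= step) by (destruct Hx; subst x; apply Rabs_le; lra). lra. }
    assert (K2 : Rabs (rho (hh y) (pp r) - rho (hh i') (pp j)) <= 2 * (C * step)).
    { apply rho_close.
      assert (Rabs (hh y - hh i') <= step) by (destruct Hy; subst y; apply Rabs_le; lra). lra. }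
    apply Rabs_bounds in K1, K2. unfold f. apply Rabs_le.
    destruct Hsg; subst sg; lra. }
  exists (decide (0 < f i i' j)). intros x y r Hx Hy Hrr.
  specialize (Hbig x y r Hx Hy Hrr). specialize (Hclose x y r Hx Hy Hrr).
  apply Rabs_bounds in Hclose. unfold gt.
  destruct (Rtotal_order (f x y r) 0) as [H|[H|H]].
  - rewrite Rabs_left in Hbig by lra.
    rewrite (proj2 (decide_false (0 < f i i' j))) by lra.
    split; [apply decide_false|apply decide_spec]; unfold f in H; lra.
  - rewrite H, Rabs_R0 in Hbig. lra.
  - rewrite Rabs_right in Hbig by lra.
    rewrite (proj2 (decide_spec (0 < f i i' j))) by lra.
    split; [apply decide_spec|apply decide_false]; unfold f in H; lra.
Qed.

Lemma curves_top c c' sg : c <> c' -> (sg = 1 \/ sg = -1) -> (0 < N)%nat ->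
  top_at N (2 * N) (N - m) (gt sg) (uv c sg) (uh c' sg).
Proof.
  intros Hcc Hsg HN0 i j Hi Hj H1 H2. apply decide_false. intros Hlt.
  destruct (marked_info c sg N j ltac:(lia) ltac:(lia) Hsg) with (x := N) (r := j)
    as (A1 & A2 & A3 & A4); [unfold marked; tauto|now left|now left|].
  destruct (marked_info c' sg i j Hi ltac:(lia) Hsg) with (x := i) (r := j)
    as (B1 & B2 & B3 & B4); [unfold marked; tauto|now left|now left|].
  apply inside_band in A1, B1. rewrite hh_N in *.
  pose proof (Hlast sg Hsg (hh i) (pp j) c c' A1 B1 A2 B2 Hcc A3 B3 A4). lra.
Qed.

(** ** Parities on the column of the farthest point *)

Lemma column_parity a b : (a <= b)%nat -> (m <= a)%nat -> (b <= N - m)%nat ->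
  xsum (fun j => wv N (a + j)) (b - a) = xorb (sgn N a) (sgn N b).
Proof.
  intros Hab Ha Hb.
  rewrite (xsum_ext _ (fun j => xorb (sgn N (a + j)) (sgn N (a + S j)))).
  - rewrite (xsum_telescope (fun j => sgn N (a + j))).
    rewrite Nat.add_0_r. now replace (a + (b - a))%nat with b by lia.
  - intros j Hj. unfold wv. rewrite Nat.add_succ_r.
    rewrite (proj2 (inside_spec N (a + j))) by lia.
    rewrite (proj2 (inside_spec N (S (a + j)))) by lia. reflexivity.
Qed.

(** The sign is positive at row [m], so the parity of the changes up to row [b] can be read off from
    the sign at [b]. *)
Lemma column_low_part b : (m <= b)%nat -> (b <= N - m)%nat -> (0 < m)%nat -> (m <= N)%nat ->
  xsum (wv N) b = negb (sgn N b).
Proof.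
  intros Hmb Hb Hm0 HmN. replace b with (m + (b - m))%nat at 1 by lia.
  rewrite xsum_split, xsum_zero.
  - rewrite column_parity by lia. rewrite (sgn_low N m) by lia.
    now destruct (sgn N b).
  - intros j Hj. unfold wv. replace (inside N j) with false; [reflexivity|].
    symmetry. apply not_true_iff_false. rewrite inside_spec. lia.
Qed.

Lemma column_near j c p p' : (j < N)%nat -> wv N j = true ->
  pp j <= p <= pp (S j) -> p - eps < p' < p + eps -> lext h0 p' ->
  position c h0 p' -> near c (hh N) (pp j).
Proof.
  intros Hj Hw Hp Hp' He Hc. pose proof (hh_S N) as ES.
  apply (square_zero_near N j h0 p p' c); auto.
  - lia.
  - unfold marks, marked. tauto.
  - rewrite ES, hh_N. lra.
  - now left.
  - now left.
Qed.

Lemma column_sign_split c : (0 < N)%nat ->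
  xorb (xsum (fun j => uv c 1 N j) (N - m)) (xsum (fun j => uv c (-1) N j) (N - m)) =
  xsum (fun j => wv N j && decide (near c (hh N) (pp j))) (N - m).
Proof.
  intros HN0. rewrite <- xsum_xorb. apply xsum_ext. intros j Hj. unfold uv.
  destruct (wv N j) eqn:E; [|reflexivity]. simpl. unfold flag.
  destruct (decide (near c (hh N) (pp j))); [|reflexivity]. simpl.
  destruct (square_info N j ltac:(lia) ltac:(lia)) as (c0 & sg & Hsg & Hinf);
    [unfold marks, marked; tauto|].
  destruct (Hinf N j (or_introl eq_refl) (or_introl eq_refl)) as (_ & _ & _ & Hpos).
  destruct Hsg; subst sg.
  - rewrite (proj2 (decide_spec (0 < 1 * rho (hh N) (pp j)))) by lra.
    now rewrite (proj2 (decide_false (0 < -1 * rho (hh N) (pp j)))) by lra.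
  - rewrite (proj2 (decide_false (0 < 1 * rho (hh N) (pp j)))) by lra.
    now rewrite (proj2 (decide_spec (0 < -1 * rho (hh N) (pp j)))) by lra.
Qed.

Context (Hm0 : (0 < m)%nat) (HmN : (2 * m < N)%nat).
Context (lo up kap : R) (Hlo : Trap h0 lo) (Hlomin : forall t, Trap h0 t -> lo <= t).
Context (Hup : Trap h0 up) (Hupmax : forall t, Trap h0 t -> t <= up).
Context (Hkap : 0 < kap) (Hdesc : desc h0 (lo - kap) lo) (Hasc : asc h0 up (up + kap)).
Context (Hek : 4 * eps < kap) (Helo : 4 * eps < lo - h0) (Heup : 4 * eps < h0 + INR n - up).

Lemma step_le_eps : step <= eps.
Proof.
  rewrite <- Hm. assert (1 <= INR m) by (apply (le_INR 1); lia). nra.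
Qed.

Lemma grid_floor x : h0 <= x -> exists j, pp j <= x < pp (S j).
Proof.
  intros Hx. 
  assert (Hex : exists k, x < pp k).
  { destruct (INR_unbounded ((x - h0) / step)) as [k Hk]. exists k. unfold pp.
    assert (E : (x - h0) / step * step = x - h0) by (field; lra).
    assert ((x - h0) / step * step < INR k * step) by (apply Rmult_lt_compat_r; lra). lra. }
  destruct Hex as [k Hk]. induction k as [|k IH].
  - unfold pp in Hk. simpl in Hk. lra.
  - destruct (Rlt_dec x (pp k)) as [H|H]; [now apply IH|].
    exists k. lra.
Qed.

Lemma pp_lt_inv i j : pp i < pp j -> (i < j)%nat.
Proof.
  unfold pp. intros H. apply INR_lt. nra.
Qed.

Lemma pp_le_mono i j : (i <= j)%nat -> pp i <= pp j.
Proof. intros H. unfold pp. apply INR_step_le in H. lra. Qed.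

Lemma pp_m : pp m = h0 + eps.
Proof. unfold pp. lra. Qed.

Lemma pp_Nm : pp (N - m) = h0 + INR n - eps.
Proof. unfold pp. rewrite minus_INR by lia. lra. Qed.

Lemma not_near c c' x r : near c (hh x) (pp r) -> c <> c' -> decide (near c' (hh x) (pp r)) = false.
Proof.
  intros H Hc. apply decide_false. intros H'. apply Hc. now apply (near_same_vertex c c' x r).
Qed.

Lemma column_mark j : (j < N - m)%nat -> wv N j = true ->
  exists p p', pp j <= p <= pp (S j) /\ p - eps < p' < p + eps /\ lext h0 p'.
Proof.
  intros Hj Hw. unfold wv in Hw. apply andb_true_iff in Hw. destruct Hw as [_ Hw].
  apply edge_zero_v in Hw. destruct Hw as (p & Hp & E). rewrite hh_N in E.
  destruct (bisec_zero_ext eps h0 p ltac:(lra) E) as (p' & Hp' & He).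
  now exists p, p'.
Qed.

(** The chord about row [b] lies within the descent towards [lo], so the sign there is negative and
    the marks up to [b] are odd in number. All of them are below the trap; later marks are not,
    since the descent contains no extremum. *)
Lemma column_below :
  xsum (fun j => wv N j && decide (near Lt (hh N) (pp j))) (N - m) = true.
Proof.
  pose proof step_le_eps as Hse.
  destruct (grid_floor (lo - eps) ltac:(lra)) as (b & Hb1 & Hb2). rewrite pp_S in Hb2.
  assert (Hmb : (m < b)%nat) by (apply pp_lt_inv; rewrite pp_m; lra).
  assert (HbN : (b < N - m)%nat).
  { apply pp_lt_inv. rewrite pp_Nm. destruct Hlo as (_ & _ & Hl). lra. }
  assert (Hsb : sgn N b = false).
  { apply decide_false. rewrite hh_N. unfold bisec.
    assert (sqd h0 (pp b + eps) < sqd h0 (pp b - eps)); [apply Hdesc; lra|lra]. }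
  replace (N - m)%nat with (b + (N - m - b))%nat by lia.
  rewrite xsum_split, (xsum_ext _ (wv N) b), (xsum_zero _ (N - m - b)).
  - rewrite xorb_false_r, column_low_part, Hsb by lia. reflexivity.
  - intros k Hk. destruct (wv N (b + k)) eqn:E; [simpl|reflexivity].
    destruct (column_mark (b + k) ltac:(lia) E) as (p & p' & Hp & Hp' & He).
    destruct (position_total h0 p') as [c Hc].
    apply (not_near c).
    + apply (column_near _ c p p'); auto. lia.
    + intros ->. simpl in Hc. specialize (Hc lo Hlo).
      pose proof (pp_le_mono b (b + k) ltac:(lia)).
      apply (desc_no_ext h0 (lo - kap) lo p' Hdesc); [lra|exact He].
  - intros k Hk. destruct (wv N k) eqn:E; [simpl|reflexivity].
    destruct (column_mark k ltac:(lia) E) as (p & p' & Hp & Hp' & He).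
    apply decide_spec. apply (column_near _ Lt p p'); auto; [lia|].
    pose proof (pp_le_mono (S k) b ltac:(lia)). intros t Ht. specialize (Hlomin t Ht). lra.
Qed.

Lemma column_above :
  xsum (fun j => wv N j && decide (near Gt (hh N) (pp j))) (N - m) = true.
Proof.
  pose proof step_le_eps as Hse. assert (Hu : h0 < up) by (destruct Hup as (_ & _ & Hl); lra).
  (* Rounding up to the next row keeps the whole chord above [up], and [step <= eps] keeps it within
     the ascent of length [kap]. *)
  destruct (grid_floor (up + eps) ltac:(lra)) as (a & Ha1 & Ha2).
  set (b := S a) in *. assert (Hb3 : pp b <= up + 2 * eps) by (unfold b; rewrite pp_S; lra).
  assert (Hmb : (m < b)%nat) by (apply pp_lt_inv; rewrite pp_m; lra).
  assert (HbN : (b < N - m)%nat) by (apply pp_lt_inv; rewrite pp_Nm; lra).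
  assert (Hsb : sgn N b = true).
  { apply decide_spec. rewrite hh_N. unfold bisec.
    assert (sqd h0 (pp b - eps) < sqd h0 (pp b + eps)); [apply Hasc; lra|lra]. }
  replace (N - m)%nat with (b + (N - m - b))%nat by lia.
  rewrite xsum_split, (xsum_zero _ b), (xsum_ext _ (fun k => wv N (b + k)) (N - m - b)).
  - rewrite xorb_false_l, column_parity, Hsb by lia. rewrite (sgn_high N (N - m)) by lia.
    reflexivity.
  - intros k Hk. destruct (wv N (b + k)) eqn:E; [simpl|reflexivity].
    destruct (column_mark (b + k) ltac:(lia) E) as (p & p' & Hp & Hp' & He).
    apply decide_spec. apply (column_near _ Gt p p'); auto; [lia|].
    pose proof (pp_le_mono b (b + k) ltac:(lia)). intros t Ht. specialize (Hupmax t Ht). lra.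
  - intros k Hk. destruct (wv N k) eqn:E; [simpl|reflexivity].
    destruct (column_mark k ltac:(lia) E) as (p & p' & Hp & Hp' & He).
    destruct (position_total h0 p') as [c Hc].
    apply (not_near c).
    + apply (column_near _ c p p'); auto. lia.
    + intros ->. simpl in Hc. specialize (Hc up Hup).
      pose proof (pp_le_mono (S k) b ltac:(lia)).
      apply (asc_no_ext h0 up (up + kap) p' Hasc); [lra|exact He].
Qed.

(** The sign changes between rows [m] and [N - m], so all marks together are odd in number; removing
    the two odd outer pieces leaves an odd one. *)
Lemma column_beside :
  xsum (fun j => wv N j && decide (near Eq (hh N) (pp j))) (N - m) = true.
Proof.
  assert (Hall : xsum (wv N) (N - m) = true).
  { rewrite column_low_part by lia. now rewrite (sgn_high N (N - m)) by lia. }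
  rewrite (xsum_ext _ (fun j => xorb (wv N j)
     (xorb (wv N j && decide (near Lt (hh N) (pp j))) (wv N j && decide (near Gt (hh N) (pp j)))))).
  - rewrite !xsum_xorb, column_below, column_above.
    now rewrite Hall.
  - intros j Hj. destruct (wv N j) eqn:E; [simpl|reflexivity].
    destruct (column_mark j Hj E) as (p & p' & Hp & Hp' & He).
    destruct (position_total h0 p') as [c Hc].
    assert (Hn : near c (hh N) (pp j)) by (apply (column_near _ c p p'); auto; lia).
    destruct c.
    + rewrite (proj2 (decide_spec _) Hn).
      now rewrite (not_near Eq Lt), (not_near Eq Gt).
    + rewrite (proj2 (decide_spec _) Hn).
      now rewrite (not_near Lt Eq), (not_near Lt Gt).
    + rewrite (proj2 (decide_spec _) Hn).
      now rewrite (not_near Gt Eq), (not_near Gt Lt).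
Qed.

Lemma grid_contradiction : False.
Proof.
  assert (Hodd : forall c, exists sg, (sg = 1 \/ sg = -1) /\
            xsum (fun j => uv c sg N j) (N - m) = true).
  { intros c.
    assert (H : xsum (fun j => wv N j && decide (near c (hh N) (pp j))) (N - m) = true).
    { destruct c; [exact column_beside|exact column_below|exact column_above]. }
    rewrite <- column_sign_split in H by lia.
    destruct (xsum (fun j => uv c 1 N j) (N - m)) eqn:E1.
    - exists 1. auto.
    - exists (-1). rewrite xorb_false_l in H. auto. }
  assert (Hno : forall c c' sg, c <> c' -> (sg = 1 \/ sg = -1) ->
            xsum (fun j => uv c sg N j) (N - m) = true ->
            xsum (fun j => uv c' sg N j) (N - m) = true -> False).
  { intros c c' sg Hcc Hsg H1 H2.
    apply (no_two_odd_curves N (2 * N) (N - m) (gt sg) (uh c sg) (uv c sg) (uh c' sg) (uv c' sg));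
      auto; try lia.
    - now apply curves_closed.
    - now apply curves_closed.
    - now apply curves_separated.
    - apply curves_top; auto. lia.
    - apply curves_top; auto. lia. }
  destruct (Hodd Lt) as (s1 & S1 & O1). destruct (Hodd Eq) as (s2 & S2 & O2).
  destruct (Hodd Gt) as (s3 & S3 & O3).
  destruct (Req_dec s1 s2) as [E|E].
  - subst s2. now apply (Hno Lt Eq s1).
  - destruct (Req_dec s1 s3) as [E'|E'].
    + subst s3. now apply (Hno Lt Gt s1).
    + assert (s2 = s3) by (destruct S1, S2, S3; subst; lra). subst s3.
      now apply (Hno Eq Gt s2).
Qed.

End Trapped.

(** * Choice of the constants and conclusion *)

Lemma no_trap : ~ exists h t, trap h t.
Proof.
  intros Hne. pose proof INRn_ge_3 as Hn.
  destruct farthest_exists as [h0 Hfar].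
  destruct (same_side_uniform Hne (h0 - INR n) (h0 + INR n)) as (dL & HdL & Huni).
  pose proof (trap_everywhere Hne h0) as Hex.
  destruct (trap_extreme (-1) h0 (or_intror eq_refl) Hex) as (lo & Hlo & Hlomin).
  destruct (trap_extreme 1 h0 (or_introl eq_refl) Hex) as (up & Hup & Hupmax).
  assert (Hlomin' : forall t, trap h0 t -> lo <= t)
    by (intros t Ht; specialize (Hlomin t Ht); lra).
  assert (Hupmax' : forall t, trap h0 t -> t <= up)
    by (intros t Ht; specialize (Hupmax t Ht); lra).
  destruct (min_strict h0 lo (proj1 Hlo)) as (k1 & Hk1 & _ & Hdesc).
  destruct (min_strict h0 up (proj1 Hup)) as (k2 & Hk2 & Hasc & _).
  destruct offset_nonzero as (e0 & He0 & Hnz0).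
  set (kap := Rmin k1 k2).
  assert (Hkap : 0 < kap) by (now apply Rmin_glb_lt).
  assert (Hkap1 : kap <= k1) by apply Rmin_l. assert (Hkap2 : kap <= k2) by apply Rmin_r.
  clearbody kap.
  assert (Hst1 : h0 < lo) by (destruct Hlo as (_ & _ & H); lra).
  assert (Hst2 : up < h0 + INR n) by (destruct Hup as (_ & _ & H); lra).
  (* The denominators 5 and 9 give strictness in the later conditions [4 * eps < kap],
     [eps < dL / 8] and in the room of [4 * eps] at both ends of the strip. *)
  destruct (Rmin3 (e0 / 2) (kap / 5) (dL / 9)) as (b1 & Hb1 & L1 & L2 & L3); try lra.
  destruct (Rmin3 ((lo - h0) / 5) ((h0 + INR n - up) / 5) (1 / 2)) as (b2 & Hb2 & L4 & L5 & L6); try lra.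
  (* [eps] is an exact fraction of a turn, so that [eps / INR m] divides both; [3 <= M] gives
     [2 * m < N]. *)
  assert (HM : exists M, (3 <= M)%nat /\ INR n / INR M < Rmin b1 b2).
  { assert (Hb : 0 < Rmin b1 b2) by (now apply Rmin_glb_lt).
    destruct (INR_unbounded (INR n / Rmin b1 b2)) as [k Hk].
    exists (k + 3)%nat. split; [lia|].
    assert (Hk3 : INR (k + 3) = INR k + 3) by (rewrite plus_INR; simpl; ring).
    pose proof (pos_INR k). rewrite Hk3.
    apply Rmult_lt_reg_r with (INR k + 3); [lra|].
    replace (INR n / (INR k + 3) * (INR k + 3)) with (INR n) by (field; lra).
    replace (INR n) with (INR n / Rmin b1 b2 * Rmin b1 b2) by (field; lra).
    rewrite (Rmult_comm (INR n / Rmin b1 b2)). apply Rmult_lt_compat_l; lra. }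
  destruct HM as (M & HM3 & HMlt).
  assert (HMpos : 3 <= INR M) by (apply (le_INR 3) in HM3; simpl in HM3; lra).
  set (eps := INR n / INR M) in *.
  assert (Heps0 : 0 < eps) by (apply Rdiv_lt_0_compat; lra).
  pose proof (Rmin_l b1 b2). pose proof (Rmin_r b1 b2).
  assert (HepsM : INR M * eps = INR n) by (unfold eps; field; lra).
  assert (Heps : 0 < eps < 1) by lra.
  clearbody eps.
  assert (Hnz : forall h p, eps <= p - h <= INR n - eps ->
            bisec eps h p = 0 -> offset eps h p <> 0).
  { intros h p. apply Hnz0. lra. }
  destruct (bisec_lip eps) as (C1 & HC1 & _ & HE).
  destruct (offset_lip eps) as (C2 & HC2 & _ & Hrho).
  destruct (offsets_separated Hne h0 dL eps HdL Heps Huni) as (t1 & Ht1 & Hsep).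
  destruct (offsets_nonzero h0 eps Heps Hnz) as (t2 & Ht2 & Hrnz).
  destruct (offsets_last Hne h0 dL eps Hfar HdL Heps Huni Hnz 1) as (t3 & Ht3 & Hl3);
    [now left|].
  destruct (offsets_last Hne h0 dL eps Hfar HdL Heps Huni Hnz (-1)) as (t4 & Ht4 & Hl4);
    [now right|].
  destruct (bisec_on_band eps Heps (h0 - INR n) (h0 + INR n)) as (t5 & Ht5 & Hband).
  destruct (Rmin3 t1 t2 t3 Ht1 Ht2 Ht3) as (t6 & Ht6 & M1 & M2 & M3).
  destruct (Rmin3 t6 t4 t5 Ht6 Ht4 Ht5) as (eta & Heta & M6 & M4 & M5).
  set (C := C1 + C2).
  (* The mesh comes last, as [C] and [eta] depend on [eps]. *)
  assert (Hstep : exists m, (1 <= m)%nat /\ 8 * C * (eps / INR m) < eta /\ eps / INR m < dL / 16).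
  { destruct (INR_unbounded (8 * C * eps / eta + 16 * eps / dL)) as [k Hk].
    exists (k + 1)%nat. split; [lia|].
    assert (Hk1' : INR (k + 1) = INR k + 1) by (rewrite plus_INR; simpl; ring).
    rewrite Hk1'. pose proof (pos_INR k).
    assert (Q1 : 0 <= 8 * C * eps / eta).
    { apply Rmult_le_pos; [|left; now apply Rinv_0_lt_compat].
      unfold C. apply Rmult_le_pos; lra. }
    assert (Q2 : 0 <= 16 * eps / dL).
    { apply Rmult_le_pos; [lra|left; now apply Rinv_0_lt_compat]. }
    split; apply Rmult_lt_reg_r with (INR k + 1); try lra.
    - replace (8 * C * (eps / (INR k + 1)) * (INR k + 1)) with (8 * C * eps) by (field; lra).
      replace (8 * C * eps) with (eta * (8 * C * eps / eta)) by (field; lra).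
      apply Rmult_lt_compat_l; lra.
    - replace (eps / (INR k + 1) * (INR k + 1)) with eps by (field; lra).
      replace eps with (dL / 16 * (16 * eps / dL)) at 1 by (field; lra).
      apply Rmult_lt_compat_l; lra. }
  destruct Hstep as (m & Hm1 & Hsmall & HstepL).
  assert (Hmpos : 1 <= INR m) by (apply (le_INR 1); lia).
  apply (grid_contradiction Hne h0 dL eps HdL Heps) with
    (C := C) (eta := eta) (N := (M * m)%nat) (m := m) (step := eps / INR m)
    (lo := lo) (up := up) (kap := kap); auto; try lra.
  - unfold C. lra.
  - intros h p h' p'. eapply Rle_trans; [apply HE|]. apply Rmult_le_compat_r; [|unfold C; lra].
    apply Rplus_le_le_0_compat; apply Rabs_pos.
  - intros h p h' p'. eapply Rle_trans; [apply Hrho|]. apply Rmult_le_compat_r; [|unfold C; lra].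
    apply Rplus_le_le_0_compat; apply Rabs_pos.
  - intros h h' p c c' A1 A2 A3 A4 A5 A6 A7 A8.
    assert (t1 < Rabs (offset eps h p - offset eps h' p)); [|lra].
    apply (Hsep h h' p c c'); auto; lra.
  - intros h p A1 A2 A3.
    assert (t2 < Rabs (offset eps h p)); [|lra]. apply Hrnz; auto; lra.
  - intros sg Hsg h p c c' A1 A2 A3 A4 A5 A6 A7 A8.
    destruct Hsg; subst sg.
    + apply (Hl3 h p c c'); auto; lra.
    + apply (Hl4 h p c c'); auto; lra.
  - intros h Hh. specialize (Hband h Hh). lra.
  - apply Rdiv_lt_0_compat; lra.
  - rewrite mult_INR. rewrite <- HepsM. field. lra.
  - field. lra.
  - nia.
  - intros x y Hx Hxy Hy. apply Hdesc; lra.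
  - intros x y Hx Hxy Hy. apply Hasc; lra.
Qed.

(** Whole turns of the human bring the puppy less than one turn ahead of her; it is then caught at
    once or in the strip to which [no_trap] applies. *)
Lemma min_wins h p : local_min n V h p -> human_wins n V h p.
Proof.
  intros Hm. destruct (base_Int_part ((p - h) / INR n)) as [H1 H2].
  pose proof INRn_ge_3 as Hn.
  set (c := Int_part ((p - h) / INR n)) in *.
  assert (E : (p - h) / INR n * INR n = p - h) by (field; lra).
  set (h' := h + IZR c * INR n).
  assert (Hh' : h' <= p < h' + INR n) by (unfold h'; nra).
  replace h with (h' + IZR (- c) * INR n) by (unfold h'; rewrite opp_IZR; ring).
  apply win_shift.
  destruct (proj1 Hh') as [Hlt|Heq].
  - apply NNPP. intros Hnw. apply no_trap. exists h', p.
    split; [now apply min_shift|]. split; [exact Hnw|lra].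
  - apply hw_caught. now rewrite Heq.
Qed.

End Polygon.

Theorem theorem11 :
  forall (n : nat) (V : nat -> point),
    simple_polygon n V ->
    (forall i : nat, (i < n)%nat -> ~ acute_vertex n V i) ->
    no_right_triple n V ->
    forall h0 p0 : R,
      forall p1 : R, puppy_settle n V h0 p0 p1 -> human_wins n V h0 p1.
Proof.
  intros n V Hs _ Hr h0 p0 p1 Hset. apply (min_wins n V Hs Hr).
  destruct Hset as [[-> Hm]|Hrun]; [exact Hm|].
  now apply (run_cases n V) in Hrun.
Qed.
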